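(* There are two critical breaking points, at $s=\pm 2$, and the set $\mathfrak{B}$ (the union of all breaking curves together with their endpoints) is $$\mathfrak{B}=\mathfrak{b}_{-\infty}\cup\mathfrak{b}_{\infty}\cup\mathfrak{b}_{+}\cup\mathfrak{b}_{-}\cup\{\pm2\},$$ where $\mathfrak{b}_{-\infty}=(-\infty,-2)$ and $\mathfrak{b}_{\infty}=(2,\infty)$, the breaking curve $\mathfrak{b}_{+}$ connects $-2$ and $2$ while remaining in the upper half plane, and the breaking curve $\mathfrak{b}_{-}$ is obtained by reflecting $\mathfrak{b}_{+}$ about the real axis.
   Context: Let $s\in\mathbb{C}$ and $f(z;s)=sz$. **$h$-functions.** Let $\Sigma=\Sigma(s)$ be a curve from $-1$ to $1$ (oriented from $-1$ to $1$), $\gamma_{c,0}=(-\infty,-1]$ (oriented from $-\infty$ to $-1$), and $\Omega=\Omega(s)=\gamma_{c,0}\cup\Sigma$; the $+$ side of an oriented arc is its left side. $\Omega$ is partitioned into main arcs $\gamma_{m,0},\dots,\gamma_{m,L}$ (union $\mathfrak{M}$) and complementary arcs $\gamma_{c,0},\dots,\gamma_{c,L}$ (union $\mathfrak{C}$), all bounded except $\gamma_{c,0}$. The endpoints of the main arcs form the set $\Lambda=\Lambda(s)\ni\pm1$, which is the set of branch points of a hyperelliptic Riemann surface of genus $L$ whose branch cuts are the main arcs. A modified external field ($h$-function) of genus $L$ for the parameter $s$ is a function $h(z)=h(z;s)$, for a suitable choice of arcs, with: $h$ analytic in $\mathbb{C}\setminus\Omega$; $h_+-h_-=4\pi i\eta_j$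 on $\gamma_{c,j}$; $h_++h_-=4\pi i\omega_j$ on $\gamma_{m,j}$; $h(z)=-sz-\ell+2\log z+O(1/z)$ as $z\to\infty$; $\Re h(z)=O((z\mp1)^{1/2})$ as $z\to\pm1$; $\Re h(z)=O((z-\lambda)^{3/2})$ as $z\to\lambda\in\Lambda\setminus\{\pm1\}$. Here $\eta_j,\omega_j$ are real constants, $\eta_0=1$, $\omega_L=0$, and $\ell$ is a constant depending only on $s$. For the present weight only the genera $L=0,1$ occur, and $h'(z)^2=\Pi(z)^2\frac{1}{z^2-1}\prod_{j=0}^{2L-1}(z-\lambda_j)$ with $\Pi$ a polynomial of degree $1-L$, with $h'(z)=-s+O(1/z)$ at infinity. In genus $0$ with branch points $\pm1$: $h(z;s)=2\log\left(z+(z^2-1)^{1/2}\right)-s(z^2-1)^{1/2}$ and $h'(z;s)=\frac{2-sz}{(z^2-1)^{1/2}}$, with branch cut on $\gamma_{m,0}$ and $(z^2-1)^{1/2}\sim z$ at infinity. **Breaking points.** Primes denote $d/dz$. A point $s_b\in\mathbb{C}$ is a breaking point if there is a saddle point $z_0\in\Omega(s_b)$ with $h'(z_0;s_b)=0$ and $\Re h(z_0;s_b)=0$, the zero of $h'$ being of order at least $1$. If $z_0\in\mathfrak{M}$, $h'(z_0)=0$ means that the analytic extensions of $h'_\pm$ to a neighborhood of $z_0$ (which satisfy $h'_+=-h'_-$) vanish at $z_0$. A breaking point is critical if either (i) the saddle point coincides with a branch point in $\Lambda(s_b)$, or (ii) the order of the zero at the saddle point is greater than one, or there are at least two saddle points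 of $h$ on $\Omega$ counted with multiplicity. A breaking point that is not critical is a regular breaking point. A breaking curve is a smooth curve of breaking points passing through a regular breaking point. *)

(* Defs.v *)
From Stdlib Require Import Reals Lra Lia.
From Coquelicot Require Import Coquelicot.

Local Open Scope R_scope.

Definition holomorphic_at (f : C -> C) (z : C) : Prop :=
  @ex_derive C_AbsRing C_NormedModule f z.

(** Principal logarithm.  The half-angle formula gives [Arg z] in (-PI, PI)
    for every [z] off the closed negative real axis. *)
Definition Clog (z : C) : C :=
  (ln (Cmod z), 2 * atan (Im z / (Cmod z + Re z))).

Fixpoint Cprod (a : nat -> C) (n : nat) : C :=
  match n with
  | O => RtoC 1
  | S m => (Cprod a m * a m)%C
  end.

(** Polynomials of degree at most [d], given by their coefficients. *)
Definition Cpoly (a : nat -> C) (d : nat) (z : C) : C :=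
  @sum_n C_AbelianMonoid (fun k => a k * z ^ k)%C d.

(** The arc gamma_{c,0} = (-oo, -1]. *)
Definition ray (z : C) : Prop := Im z = 0 /\ Re z <= -1.

(** A simple curve Sigma from -1 to 1, parametrized by [0,1], meeting the ray
    only at -1 and cut by the parameters
      0 = brk 0 < brk 1 < ... < brk (2L+1) = 1
    into 2L+1 regular C^1 arcs: the piece [brk k, brk (k+1)] is the main arc
    gamma_{m,j} if k = 2j and the complementary arc gamma_{c,j} if k = 2j-1.
    [dsg k] is the tangent vector along piece k, up to its endpoints; corners
    are allowed at the breaks.  Values of [sg] off [0,1] and of [dsg k] off
    its piece are irrelevant extensions. *)
Record contour (L : nat) : Type := {
  sg : R -> C;
  dsg : nat -> R -> C;
  brk : nat -> R;
  brk_first : brk 0 = 0;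
  brk_last : brk (2 * L + 1) = 1;
  brk_incr : forall k, (k <= 2 * L)%nat -> brk k < brk (S k);
  sg_first : sg 0 = RtoC (-1);
  sg_last : sg 1 = RtoC 1;
  sg_inj : forall t u, 0 <= t <= 1 -> 0 <= u <= 1 -> sg t = sg u -> t = u;
  sg_off_ray : forall t, 0 < t <= 1 -> ~ ray (sg t);
  sg_cont : forall t, 0 <= t <= 1 -> @continuous R_UniformSpace C_UniformSpace sg t;
  sg_derive : forall k t, (k <= 2 * L)%nat -> brk k < t < brk (S k) ->
    @is_derive R_AbsRing C_R_NormedModule sg t (dsg k t);
  dsg_cont : forall k t, (k <= 2 * L)%nat -> brk k <= t <= brk (S k) ->
    @continuous R_UniformSpace C_UniformSpace (dsg k) t;
  dsg_neq0 : forall k t, (k <= 2 * L)%nat -> brk k <= t <= brk (S k) ->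
    dsg k t <> RtoC 0
}.

Arguments sg {L} _ _.
Arguments dsg {L} _ _ _.
Arguments brk {L} _ _.

Definition Omega {L : nat} (G : contour L) (z : C) : Prop :=
  ray z \/ exists t, 0 <= t <= 1 /\ z = sg G t.

(** The set Lambda of the 2L+2 endpoints of the main arcs. *)
Definition branch_point {L : nat} (G : contour L) (z : C) : Prop :=
  exists k, (k <= 2 * L + 1)%nat /\ z = sg G (brk G k).

(** lambda_0, ..., lambda_{2L-1}: the branch points other than -1 and 1. *)
Definition lambda {L : nat} (G : contour L) (j : nat) : C :=
  sg G (brk G (S j)).

(** Boundary values at [g t] of a function [f] defined off the arc [g] with
    tangent [dg].  Near an interior point of a regular C^1 arc, the points
    g u + i e g'(u) with e > 0 small fill out exactly the left side. *)
Definition left_value (g dg : R -> C) (f : C -> C) (t : R) (l : C) : Prop :=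
  filterlim (fun p : R * R => f (g (fst p) + Ci * RtoC (snd p) * dg (fst p))%C)
    (filter_prod (locally t) (at_right 0)) (@locally C_UniformSpace l).

Definition right_value (g dg : R -> C) (f : C -> C) (t : R) (l : C) : Prop :=
  filterlim (fun p : R * R => f (g (fst p) - Ci * RtoC (snd p) * dg (fst p))%C)
    (filter_prod (locally t) (at_right 0)) (@locally C_UniformSpace l).

Definition difference_jump (g dg : R -> C) (f : C -> C) (t : R) (c : C) : Prop :=
  exists hp hm, left_value g dg f t hp /\ right_value g dg f t hm /\
    (hp - hm)%C = c.

Definition sum_jump (g dg : R -> C) (f : C -> C) (t : R) (c : C) : Prop :=
  exists hp hm, left_value g dg f t hp /\ right_value g dg f t hm /\
    (hp + hm)%C = c.

(** h-functions of genus [L] for the parameter [s], with the arcs [G]. *)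
Record h_function (s : C) (L : nat) (G : contour L) (h : C -> C) : Prop := {
  h_genus : (L <= 1)%nat;
  h_analytic : forall z, ~ Omega G z -> holomorphic_at h z;
  h_complementary : exists eta : nat -> R, eta 0%nat = 1 /\
    (forall x, x < -1 ->
      difference_jump RtoC (fun _ => RtoC 1) h x
        (RtoC (4 * PI * eta 0%nat) * Ci)%C) /\
    (forall j t, (1 <= j <= L)%nat -> brk G (2 * j - 1) < t < brk G (2 * j) ->
      difference_jump (sg G) (dsg G (2 * j - 1)) h t
        (RtoC (4 * PI * eta j) * Ci)%C);
  h_main : exists omega : nat -> R, omega L = 0 /\
    forall j t, (j <= L)%nat -> brk G (2 * j) < t < brk G (2 * j + 1) ->
      sum_jump (sg G) (dsg G (2 * j)) h t (RtoC (4 * PI * omega j) * Ci)%C;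
  h_infinity : exists (ell : C) (M r : R), 0 < r /\
    forall z, ~ Omega G z -> r < Cmod z ->
      Cmod (h z - (- s * z - ell + 2 * Clog z)) <= M / Cmod z;
  h_hard_edge : forall e, e = RtoC 1 \/ e = RtoC (-1) ->
    exists M r, 0 < r /\ forall z, ~ Omega G z -> Cmod (z - e) < r ->
      Rabs (Re (h z)) <= M * Rpower (Cmod (z - e)) (1 / 2);
  h_soft_edge : forall j, (j < 2 * L)%nat ->
    exists M r, 0 < r /\ forall z, ~ Omega G z -> Cmod (z - lambda G j) < r ->
      Rabs (Re (h z)) <= M * Rpower (Cmod (z - lambda G j)) (3 / 2);
  (* The degree is 1 - L, except that at s = 0 the leading coefficient, which
     is s up to sign, vanishes. *)
  h_derive_sqr : exists P : nat -> C, forall z, ~ Omega G z ->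
    (C_derive h z ^ 2 =
      Cpoly P (1 - L) z ^ 2 / (z ^ 2 - 1) *
      Cprod (fun j => z - lambda G j) (2 * L))%C;
  h_derive_infinity : exists M r, 0 < r /\
    forall z, ~ Omega G z -> r < Cmod z -> Cmod (C_derive h z + s) <= M / Cmod z
}.

(** [h'] has a zero of order [k] at the point [z0] of Omega.
    Off the branch points, the analytic extensions of h' from the two sides
    are equal or opposite, and it is the order of these extensions.
    At a branch point, h' generically behaves like (z - z0)^(-1/2) if z0 is 1
    or -1 and like (z - z0)^(1/2) otherwise; [k] is the order in excess of
    this, i.e. the multiplicity of z0 as a zero of the polynomial factor Pi
    of h'. *)
Definition derive_zero_order {L : nat} (G : contour L) (h : C -> C) (z0 : C)
    (k : nat) : Prop :=
  exists (r : R) (g : C -> C), 0 < r /\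
    (forall z, Cmod (z - z0) < r -> holomorphic_at g z) /\
    g z0 <> RtoC 0 /\
    forall z, Cmod (z - z0) < r -> ~ Omega G z ->
      (~ branch_point G z0 ->
        C_derive h z = ((z - z0) ^ k * g z)%C \/
        C_derive h z = (- ((z - z0) ^ k * g z))%C) /\
      (z0 = RtoC 1 \/ z0 = RtoC (-1) ->
        (C_derive h z ^ 2 * (z - z0) = ((z - z0) ^ k) ^ 2 * g z)%C) /\
      (branch_point G z0 -> z0 <> RtoC 1 -> z0 <> RtoC (-1) ->
        (C_derive h z ^ 2 = (z - z0) * ((z - z0) ^ k) ^ 2 * g z)%C).

Definition saddle_point {L : nat} (G : contour L) (h : C -> C) (z0 : C)
    (k : nat) : Prop :=
  Omega G z0 /\ (1 <= k)%nat /\ derive_zero_order G h z0 k.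

(** Re h(z0) = 0 for z0 on Omega, in the sense of boundary values: on the main
    arcs Re h_+ = - Re h_-, on the complementary arcs Re h_+ = Re h_-, so that
    Re h_+(z0) = 0 and Re h_-(z0) = 0 are equivalent. *)
Definition Re_vanishes {L : nat} (G : contour L) (h : C -> C) (z0 : C) : Prop :=
  filterlim (fun z => Re (h z))
    (within (fun z => ~ Omega G z) (@locally C_UniformSpace z0)) (locally 0).

Definition breaking_datum (s : C) (L : nat) (G : contour L) (h : C -> C)
    (z0 : C) (k : nat) : Prop :=
  h_function s L G h /\ saddle_point G h z0 k /\ Re_vanishes G h z0.

Definition breaking_point (s : C) : Prop :=
  exists L (G : contour L) h z0 k, breaking_datum s L G h z0 k.

Definition critical_breaking_point (s : C) : Prop :=
  exists L (G : contour L) h z0 k, breaking_datum s L G h z0 k /\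
    (branch_point G z0 \/
     (1 < k)%nat \/
     exists z1 k1, z1 <> z0 /\ saddle_point G h z1 k1).

Definition regular_breaking_point (s : C) : Prop :=
  breaking_point s /\ ~ critical_breaking_point s.

(** Open curves, parametrized by (0,1). *)
Definition smooth_curve (b : R -> C) : Prop :=
  (forall n t, 0 < t < 1 ->
    ex_derive_n (fun u => Re (b u)) n t /\ ex_derive_n (fun u => Im (b u)) n t) /\
  (forall t, 0 < t < 1 ->
    Derive (fun u => Re (b u)) t <> 0 \/ Derive (fun u => Im (b u)) t <> 0) /\
  (forall t u, 0 < t < 1 -> 0 < u < 1 -> b t = b u -> t = u).

Definition on_curve (b : R -> C) (s : C) : Prop :=
  exists t, 0 < t < 1 /\ s = b t.

Definition starts_at (b : R -> C) (s : C) : Prop :=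
  filterlim b (at_right 0) (@locally C_UniformSpace s).

Definition ends_at (b : R -> C) (s : C) : Prop :=
  filterlim b (at_left 1) (@locally C_UniformSpace s).

Definition breaking_curve (b : R -> C) : Prop :=
  smooth_curve b /\
  (forall s, on_curve b s -> breaking_point s) /\
  (exists s, on_curve b s /\ regular_breaking_point s).

(** The set of all points of breaking curves and of their (finite) endpoints. *)
Definition breaking_set (s : C) : Prop :=
  exists b, breaking_curve b /\ (on_curve b s \/ starts_at b s \/ ends_at b s).

(* Main.v *)
Require Import Defs.
From Stdlib Require Import Reals Lra Lia Psatz IndefiniteDescription.
From Stdlib Require Ranalysis5.
From Coquelicot Require Import Coquelicot.
Local Open Scope R_scope.

(** In genus 0 everything is explicit. An h-function satisfies
    h' = (2 - s z) / r for some branch r of (z^2 - 1)^(1/2), so the saddle is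
    z0 = 2 / s, and up to sign and a real constant
    Re h = 2 ln |z + r| - Re (s r). At the hard edges Re h and this expression
    vanish, so s is a breaking point exactly if the saddle lies at height 0:
    2 ln |z0 + r0| = Re (s r0) with r0^2 = z0^2 - 1. In genus 1 the factor Pi
    is a constant and there is no saddle. A saddle is simple and unique, and it
    is a branch point only if 2 / s is 1 or -1; these are the critical values
    s = 2 and s = -2.

    Necessity. Squaring h' leaves a linear factor p0 + p1 z, whose coefficients
    are found from the expansion at infinity ([genus0_coefficients]); a residue
    other than 2 would let h + s z - 2 log z grow logarithmically. The
    comparison of Re h with the height needs a path from z0 to a hard edge off
    Omega. Such a path is the left side of Omega itself: points slightly to the
    left of a regular arc are off Omega ([sg_piece_collar]), and along them the
    difference of the two functions is locally constant
    ([defect_locally_constant]), hence constant up to the edge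
    ([edge_transport]). The continuity of h', hence of r, comes from Darboux's
    theorem: h' is a derivative whose square is continuous
    ([derivative_continuous_of_square]).

    Sufficiency. If 2 / s lies at height 0 it is not real of modulus greater
    than 1 ([real_saddle_height]), so a circular arc joins -1 to 1 through it
    ([arc_through]). With the cut on that arc, q = ((z - 1) / (z + 1))^(1/2) maps
    the complement of the arc into a half-plane, v = (1 + q) / (1 - q) equals
    z + r, and h = 2 log v - s r has all the required properties
    ([h_arc_h_function]).

    The curves. Put z0 + r0 = e^(a + i th) with a >= 0, that is
    s = 2 / cosh (a + i th). The height vanishes iff a = Re tanh (a + i th).
    For a = 0 this gives the real s with |s| >= 2. For a > 0 it is
    sin^2 th = cosh a (cosh a - sinh a / a), where the right-hand side
    increases from 0 with a; so a is a smooth function of th in (0, pi), and of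
    - th, which gives two conjugate curves that end at a = 0, where s is 2 or
    -2 ([height_zero_iff], [smooth_psi], [b_up_limit]). The resulting set is
    closed ([saddle_height_closed]), so end points of further breaking curves
    add nothing to it. *)

(** * Limits and derivatives of complex functions *)

Ltac RtoC_neq := let E := fresh in intros E; apply RtoC_inj in E; lra.

Lemma Rmin_lt (x a b : R) : x < Rmin a b -> x < a /\ x < b.
Proof. pose proof (Rmin_l a b); pose proof (Rmin_r a b); lra. Qed.

(** Limits measured by the modulus instead of the supremum of the two
    coordinates: multiplicativity of the modulus gives the rules for products
    and inverses. *)
Definition Clim {T : Type} (F : (T -> Prop) -> Prop) (f : T -> C) (l : C) : Prop :=
  forall eps : R, 0 < eps -> F (fun x => Cmod (f x - l) < eps).

Definition near_C (z : C) (P : C -> Prop) : Prop :=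
  exists d : R, 0 < d /\ forall w, Cmod (w - z) < d -> P w.

Global Instance near_C_filter (z : C) : Filter (near_C z).
Proof.
  split.
  - exists 1; split; [lra|auto].
  - intros P Q [d [Hd HP]] [e [He HQ]].
    exists (Rmin d e); split; [now apply Rmin_pos|].
    intros w [H1 H2]%Rmin_lt; auto.
  - intros P Q PQ [d [Hd HP]]; exists d; split; auto.
Qed.

Lemma near_C_here (z : C) (P : C -> Prop) : near_C z P -> P z.
Proof.
  intros [d [Hd HP]]; apply HP.
  replace (z - z)%C with (RtoC 0) by ring; now rewrite Cmod_0.
Qed.

Lemma near_C_locally (z : C) (P : C -> Prop) :
  near_C z P <-> @locally C_UniformSpace z P.
Proof.
  split.
  - intros [d [Hd HP]].
    assert (Hs : 0 < sqrt 2) by (apply sqrt_lt_R0; lra).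
    assert (Hd' : 0 < d / sqrt 2) by (now apply Rdiv_lt_0_compat).
    exists (mkposreal _ Hd'); intros w Hw; apply HP.
    apply (C_NormedModule_mixin_compat2 z w) in Hw.
    simpl in Hw. replace (sqrt 2 * (d / sqrt 2)) with d in Hw by (field; lra).
    exact Hw.
  - intros [d HP]; exists d; split; [apply cond_pos|].
    intros w Hw; apply HP.
    now apply C_NormedModule_mixin_compat1.
Qed.

Lemma Clim_filterlim {T : Type} (F : (T -> Prop) -> Prop) {FF : Filter F}
  (f : T -> C) (l : C) :
  Clim F f l <-> filterlim f F (@locally C_UniformSpace l).
Proof.
  split.
  - intros H P HP; apply near_C_locally in HP; destruct HP as [d [Hd HP]].
    change (F (fun x => P (f x))); generalize (H d Hd); apply filter_imp; intros x Hx; now apply HP.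
  - intros H eps Heps; apply (H (fun w => Cmod (w - l) < eps)).
    apply near_C_locally; exists eps; auto.
Qed.

Definition Ccont (f : C -> C) (z : C) : Prop := Clim (near_C z) f (f z).

Section ClimRules.
Context {T : Type} {F : (T -> Prop) -> Prop} {FF : Filter F}.

Lemma Clim_ext_loc (f g : T -> C) (l : C) :
  F (fun x => f x = g x) -> Clim F f l -> Clim F g l.
Proof.
  intros E H eps Heps; generalize (filter_and _ _ E (H eps Heps)).
  apply filter_imp; intros x [-> Hx]; exact Hx.
Qed.

Lemma Clim_const (c : C) : Clim F (fun _ => c) c.
Proof.
  intros eps Heps; apply filter_forall; intros _.
  replace (c - c)%C with (RtoC 0) by ring; now rewrite Cmod_0.
Qed.

Lemma Clim_plus (f g : T -> C) (a b : C) :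
  Clim F f a -> Clim F g b -> Clim F (fun x => f x + g x)%C (a + b)%C.
Proof.
  intros Hf Hg eps Heps.
  assert (E2 : 0 < eps / 2) by lra.
  generalize (filter_and _ _ (Hf _ E2) (Hg _ E2)).
  apply filter_imp; intros x [H1 H2].
  replace (f x + g x - (a + b))%C with ((f x - a) + (g x - b))%C by ring.
  eapply Rle_lt_trans; [apply Cmod_triangle|lra].
Qed.

Lemma Clim_opp (f : T -> C) (a : C) :
  Clim F f a -> Clim F (fun x => - f x)%C (- a)%C.
Proof.
  intros Hf eps Heps; generalize (Hf eps Heps); apply filter_imp; intros x H1.
  replace (- f x - - a)%C with (- (f x - a))%C by ring.
  now rewrite Cmod_opp.
Qed.

Lemma Clim_minus (f g : T -> C) (a b : C) :
  Clim F f a -> Clim F g b -> Clim F (fun x => f x - g x)%C (a - b)%C.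
Proof. intros Hf Hg; apply Clim_plus; [exact Hf|now apply Clim_opp]. Qed.

Lemma Clim_mult (f g : T -> C) (a b : C) :
  Clim F f a -> Clim F g b -> Clim F (fun x => f x * g x)%C (a * b)%C.
Proof.
  intros Hf Hg eps Heps.
  set (A := Cmod a + Cmod b + 1).
  assert (HA : 0 < A) by (pose proof (Cmod_ge_0 a); pose proof (Cmod_ge_0 b); unfold A; lra).
  set (e := Rmin 1 (eps / (2 * A))).
  assert (He : 0 < e).
  { apply Rmin_pos; [lra|apply Rdiv_lt_0_compat; lra]. }
  assert (He1 : e <= 1) by apply Rmin_l.
  assert (He2 : e * A <= eps / 2).
  { replace (eps / 2) with (eps / (2 * A) * A) by (field; lra).
    apply Rmult_le_compat_r; [lra|apply Rmin_r]. }
  generalize (filter_and _ _ (Hf e He) (Hg e He)).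
  apply filter_imp; intros x [H1 H2].
  replace (f x * g x - a * b)%C with
    ((f x - a) * (g x - b) + (a * (g x - b) + b * (f x - a)))%C by ring.
  eapply Rle_lt_trans; [apply Cmod_triangle|].
  eapply Rle_lt_trans; [apply Rplus_le_compat_l, Cmod_triangle|].
  rewrite !Cmod_mult.
  pose proof (Cmod_ge_0 a); pose proof (Cmod_ge_0 b).
  pose proof (Cmod_ge_0 (f x - a)); pose proof (Cmod_ge_0 (g x - b)).
  assert (Cmod (f x - a) * Cmod (g x - b) <= e * 1) by (apply Rmult_le_compat; lra).
  assert (Cmod a * Cmod (g x - b) <= Cmod a * e) by (apply Rmult_le_compat_l; lra).
  assert (Cmod b * Cmod (f x - a) <= Cmod b * e) by (apply Rmult_le_compat_l; lra).
  unfold A in *; nra.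
Qed.

Lemma Clim_inv (f : T -> C) (a : C) :
  a <> RtoC 0 -> Clim F f a -> Clim F (fun x => / f x)%C (/ a)%C.
Proof.
  intros Ha Hf eps Heps.
  assert (HA : 0 < Cmod a) by now apply Cmod_gt_0.
  set (A := Cmod a) in *.
  set (e := Rmin (A / 2) (eps * (A * A / 2) / 2)).
  assert (HAA : 0 < A * A) by nra.
  assert (He : 0 < e) by (apply Rmin_pos; nra).
  generalize (Hf e He); apply filter_imp; intros x H1.
  assert (H2 : A / 2 <= Cmod (f x)).
  { pose proof (Cmod_triangle (f x) (a - f x)).
    replace (f x + (a - f x))%C with a in H by ring.
    rewrite <- (Cmod_opp (a - f x)) in H.
    replace (- (a - f x))%C with (f x - a)%C in H by ring.
    pose proof (Rmin_l (A / 2) (eps * (A * A / 2) / 2)); fold e in H0.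
    fold A in H; lra. }
  assert (Hfx : f x <> RtoC 0) by (apply Cmod_gt_0; lra).
  replace (/ f x - / a)%C with (- (f x - a) * / (f x * a))%C by (field; auto).
  rewrite Cmod_mult, Cmod_opp, Cmod_inv, Cmod_mult by (apply Cmult_neq_0; auto).
  fold A.
  pose proof (Rmin_r (A / 2) (eps * (A * A / 2) / 2)) as H3; fold e in H3.
  assert (A * A / 2 <= Cmod (f x) * A) by nra.
  apply Rmult_lt_reg_r with (Cmod (f x) * A); [nra|].
  rewrite Rmult_assoc, Rinv_l by nra. nra.
Qed.

Lemma Clim_div (f g : T -> C) (a b : C) :
  b <> RtoC 0 -> Clim F f a -> Clim F g b -> Clim F (fun x => f x / g x)%C (a / b)%C.
Proof. intros Hb Hf Hg; apply Clim_mult; [exact Hf|now apply Clim_inv]. Qed.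

Lemma Clim_pow (f : T -> C) (a : C) (n : nat) :
  Clim F f a -> Clim F (fun x => f x ^ n)%C (a ^ n)%C.
Proof.
  intros Hf; induction n as [|n IH]; [exact (Clim_const (RtoC 1))|].
  rewrite Cpow_S. apply (Clim_ext_loc (fun x => f x * f x ^ n)%C).
  - apply filter_forall; intros x; now rewrite Cpow_S.
  - now apply Clim_mult.
Qed.

Lemma Clim_comp (f : T -> C) (g : C -> C) (a : C) :
  Clim F f a -> Ccont g a -> Clim F (fun x => g (f x)) (g a).
Proof.
  intros Hf Hg eps Heps; destruct (Hg eps Heps) as [d [Hd H]].
  generalize (Hf d Hd); apply filter_imp; auto.
Qed.

Lemma Clim_Cmod (f : T -> C) (a : C) :
  Clim F f a -> filterlim (fun x => Cmod (f x)) F (locally (Cmod a)).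
Proof.
  intros Hf P [d HP]; change (F (fun x => P (Cmod (f x)))); generalize (Hf d (cond_pos d)); apply filter_imp; intros x Hx.
  apply HP; apply Rabs_lt_between'; 
  pose proof (Cmod_triangle (f x - a) a); pose proof (Cmod_triangle (a - f x) (f x)).
  replace (f x - a + a)%C with (f x) in H by ring.
  replace (a - f x + f x)%C with a in H0 by ring.
  replace (a - f x)%C with (- (f x - a))%C in H0 by ring.
  rewrite Cmod_opp in H0. lra.
Qed.

Lemma Clim_Re (f : T -> C) (a : C) :
  Clim F f a -> filterlim (fun x => Re (f x)) F (locally (Re a)).
Proof.
  intros Hf P [d HP]; change (F (fun x => P (Re (f x)))); generalize (Hf d (cond_pos d)); apply filter_imp; intros x Hx.
  apply HP. eapply Rle_lt_trans; [|exact Hx].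
  change (Rabs (Re (f x) - Re a) <= Cmod (f x - a)).
  replace (Re (f x) - Re a) with (Re (f x - a)) by (simpl; reflexivity).
  apply re_le_Cmod.
Qed.

Lemma Clim_pair (f g : T -> R) (a b : R) :
  filterlim f F (locally a) -> filterlim g F (locally b) ->
  Clim F (fun x => (f x, g x) : C) (a, b).
Proof.
  intros Hf Hg; apply Clim_filterlim; [exact FF|].
  intros P [d HP].
  assert (H1 : locally a (fun u => ball a d u)) by (exists d; auto).
  assert (H2 : locally b (fun u => ball b d u)) by (exists d; auto).
  change (F (fun x => P (f x, g x))); pose proof (Hf _ H1) as H3; pose proof (Hg _ H2) as H4.
  change (F (fun x => ball a d (f x))) in H3; change (F (fun x => ball b d (g x))) in H4.
  generalize (filter_and _ _ H3 H4); apply filter_imp.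
  intros x [Ha Hb]; apply HP; split; assumption.
Qed.

Lemma Clim_RtoC (f : T -> R) (a : R) :
  filterlim f F (locally a) -> Clim F (fun x => RtoC (f x)) (RtoC a).
Proof. intros Hf; apply Clim_pair; [exact Hf|apply filterlim_const]. Qed.

Lemma Clim_unique {PF : ProperFilter F} (f : T -> C) (a b : C) :
  Clim F f a -> Clim F f b -> a = b.
Proof.
  intros Ha Hb; destruct (Ceq_dec a b) as [|N]; [assumption|exfalso].
  assert (D : 0 < Cmod (a - b)) by (apply Cmod_gt_0; now apply Cminus_eq_contra).
  assert (D2 : 0 < Cmod (a - b) / 2) by lra.
  destruct (filter_ex (F := F) _ (filter_and _ _ (Ha _ D2) (Hb _ D2)))
    as [x [H1 H2]].
  pose proof (Cmod_triangle (- (f x - a)) (f x - b)) as H3.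
  rewrite Cmod_opp in H3. replace (- (f x - a) + (f x - b))%C with (a - b)%C in H3 by ring.
  lra.
Qed.

End ClimRules.

Lemma Ccont_id (z : C) : Ccont (fun w => w) z.
Proof. intros eps Heps; exists eps; auto. Qed.

Lemma Ccont_comp (f g : C -> C) (z : C) :
  Ccont f z -> Ccont g (f z) -> Ccont (fun w => g (f w)) z.
Proof. intros Hf Hg; now apply (Clim_comp f g). Qed.

(** Caratheodory's form of the derivative: the difference quotient extends
    continuously.  It turns the rules of differentiation into algebra. *)
Definition Cderiv (f : C -> C) (z l : C) : Prop :=
  exists phi : C -> C, phi z = l /\ Ccont phi z /\
    forall w, f w = (f z + phi w * (w - z))%C.

Lemma Cderiv_is_derive (f : C -> C) (z l : C) :
  Cderiv f z l <-> @is_derive C_AbsRing C_NormedModule f z l.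
Proof.
  split.
  - intros [phi [Hz [Hc Hw]]]; split.
    + apply @is_linear_scal_l.
    + intros x Hx; 
      apply (@is_filter_lim_locally_unique C_AbsRing (AbsRing_NormedModule C_AbsRing)) in Hx; subst x.
      intros eps. destruct (Hc eps (cond_pos eps)) as [d [Hd H]].
      exists (mkposreal d Hd); intros w Hw'.
      change (Cmod (minus (minus (f w) (f z)) (scal (minus w z) l)) <= eps * Cmod (w - z)).
      rewrite Hw.
      change (Cmod (f z + phi w * (w - z) - f z - (w - z) * l) <= eps * Cmod (w - z)).
      replace (f z + phi w * (w - z) - f z - (w - z) * l)%C with ((phi w - phi z) * (w - z))%C
        by (rewrite Hz; ring).
      rewrite Cmod_mult; apply Rmult_le_compat_r; [apply Cmod_ge_0|].
      apply Rlt_le, H, Hw'.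
  - intros [_ H]. 
    specialize (H z (fun P HP => HP)).
    exists (fun w => if Ceq_dec w z then l else ((f w - f z) / (w - z))%C).
    split; [|split].
    + destruct (Ceq_dec z z); [reflexivity|contradiction].
    + intros eps Heps.
      assert (He2 : 0 < eps / 2) by lra.
      destruct (H (mkposreal _ He2)) as [d Hd].
      exists d; split; [apply cond_pos|].
      intros w Hw; destruct (Ceq_dec z z); [clear e|contradiction].
      destruct (Ceq_dec w z) as [|N].
      { replace (l - l)%C with (RtoC 0) by ring; now rewrite Cmod_0. }
      specialize (Hd w Hw).
      change (Cmod (f w - f z - (w - z) * l) <= eps / 2 * Cmod (w - z)) in Hd.
      assert (N' : (w - z)%C <> RtoC 0) by now apply Cminus_eq_contra.
      replace ((f w - f z) / (w - z) - l)%C with ((f w - f z - (w - z) * l) / (w - z))%C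
        by (field; exact N').
      rewrite Cmod_div by exact N'.
      assert (P : 0 < Cmod (w - z)) by now apply Cmod_gt_0.
      apply Rle_lt_trans with (eps / 2); [|lra].
      apply Rmult_le_reg_r with (Cmod (w - z)); [exact P|].
      unfold Rdiv at 1; rewrite Rmult_assoc, Rinv_l; lra.
    + intros w; destruct (Ceq_dec w z) as [->|N]; [ring|].
      field; now apply Cminus_eq_contra.
Qed.

Lemma Cderiv_holomorphic (f : C -> C) (z l : C) : Cderiv f z l -> holomorphic_at f z.
Proof. intros H; exists l; now apply Cderiv_is_derive. Qed.

Lemma holomorphic_Cderiv (f : C -> C) (z : C) :
  holomorphic_at f z -> Cderiv f z (C_derive f z).
Proof. intros H; apply Cderiv_is_derive, C_derive_correct; [exact z|exact H]. Qed.

Lemma Cderiv_C_derive (f : C -> C) (z l : C) : Cderiv f z l -> C_derive f z = l.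
Proof. intros H; apply is_C_derive_unique; now apply Cderiv_is_derive. Qed.

Lemma Cderiv_Ccont (f : C -> C) (z l : C) : Cderiv f z l -> Ccont f z.
Proof.
  intros [phi [Hz [Hc Hw]]].
  assert (K : Clim (near_C z) (fun w => f z + phi w * (w - z))%C (f z + phi z * (z - z))%C).
  { apply Clim_plus; [apply Clim_const|].
    apply Clim_mult; [exact Hc|].
    apply Clim_minus; [apply Ccont_id|apply Clim_const]. }
  replace (f z + phi z * (z - z))%C with (f z) in K by ring.
  revert K; apply Clim_ext_loc, filter_forall; intros w; now rewrite <- Hw.
Qed.

Lemma Cderiv_const (c z : C) : Cderiv (fun _ => c) z 0.
Proof.
  exists (fun _ => RtoC 0); split; [reflexivity|split; [apply Clim_const|]].
  intros w; ring.
Qed.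

Lemma Cderiv_id (z : C) : Cderiv (fun w => w) z 1.
Proof.
  exists (fun _ => RtoC 1); split; [reflexivity|split; [apply Clim_const|]].
  intros w; ring.
Qed.

Lemma Cderiv_plus (f g : C -> C) (z a b : C) :
  Cderiv f z a -> Cderiv g z b -> Cderiv (fun w => f w + g w)%C z (a + b).
Proof.
  intros [p [Hp [Cp Ep]]] [q [h_of [Cq Eq]]].
  exists (fun w => p w + q w)%C; split; [congruence|split; [now apply Clim_plus|]].
  intros w; rewrite Ep, Eq; ring.
Qed.

Lemma Cderiv_opp (f : C -> C) (z a : C) :
  Cderiv f z a -> Cderiv (fun w => - f w)%C z (- a).
Proof.
  intros [p [Hp [Cp Ep]]].
  exists (fun w => - p w)%C; split; [congruence|split; [now apply Clim_opp|]].
  intros w; rewrite Ep; ring.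
Qed.

Lemma Cderiv_minus (f g : C -> C) (z a b : C) :
  Cderiv f z a -> Cderiv g z b -> Cderiv (fun w => f w - g w)%C z (a - b).
Proof. intros Hf Hg; apply Cderiv_plus; [exact Hf|now apply Cderiv_opp]. Qed.

Lemma Cderiv_mult (f g : C -> C) (z a b : C) :
  Cderiv f z a -> Cderiv g z b ->
  Cderiv (fun w => f w * g w)%C z (a * g z + f z * b).
Proof.
  intros Hf Hg; pose proof (Cderiv_Ccont _ _ _ Hg) as Cg.
  destruct Hf as [p [Hp [Cp Ep]]]; destruct Hg as [q [h_of [Cq Eq]]].
  exists (fun w => p w * g w + f z * q w)%C; split; [congruence|split].
  - apply Clim_plus; apply Clim_mult; try assumption; apply Clim_const.
  - intros w; rewrite Ep, Eq; ring.
Qed.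

Lemma Cderiv_comp (f g : C -> C) (z a b : C) :
  Cderiv f z a -> Cderiv g (f z) b -> Cderiv (fun w => g (f w)) z (b * a).
Proof.
  intros Hf Hg; pose proof (Cderiv_Ccont _ _ _ Hf) as Cf.
  destruct Hf as [p [Hp [Cp Ep]]]; destruct Hg as [q [h_of [Cq Eq]]].
  exists (fun w => q (f w) * p w)%C; split; [congruence|split].
  - apply Clim_mult; [now apply Ccont_comp|exact Cp].
  - intros w. assert (D : (f w - f z = p w * (w - z))%C) by (rewrite (Ep w); ring).
    rewrite (Eq (f w)), D; ring.
Qed.

Lemma Cderiv_inv_id (z : C) : z <> RtoC 0 -> Cderiv Cinv z (- / (z * z))%C.
Proof.
  intros Hz.
  exists (fun w => if Ceq_dec w 0 then (((/ w) - / z) / (w - z))%C else (- / (w * z))%C).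
  split; [destruct (Ceq_dec z 0); [contradiction|reflexivity]|split].
  - apply (Clim_ext_loc (fun w => - / (w * z))%C).
    + exists (Cmod z); split; [now apply Cmod_gt_0|].
      intros w Hw; destruct (Ceq_dec w 0) as [->|]; [|reflexivity].
      replace (RtoC 0 - z)%C with (- z)%C in Hw by ring. rewrite Cmod_opp in Hw; lra.
    + destruct (Ceq_dec z 0); [contradiction|].
      apply Clim_opp, Clim_inv; [now apply Cmult_neq_0|].
      apply Clim_mult; [apply Ccont_id|apply Clim_const].
  - intros w; destruct (Ceq_dec w 0) as [->|].
    + assert (Hz' : (RtoC 0 - z)%C <> RtoC 0).
      { intros E; apply Hz; transitivity (- (RtoC 0 - z))%C; [ring|rewrite E; ring]. }
      generalize (/ RtoC 0)%C; intros i; field; auto.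
    + field; auto.
Qed.

Lemma Cderiv_inv (f : C -> C) (z a : C) :
  f z <> RtoC 0 -> Cderiv f z a -> Cderiv (fun w => / f w)%C z (- a / (f z * f z))%C.
Proof.
  intros Hz Hf. replace (- a / (f z * f z))%C with (- / (f z * f z) * a)%C by (field; auto).
  apply (Cderiv_comp f Cinv); [exact Hf|now apply Cderiv_inv_id].
Qed.

Lemma Cderiv_ext_loc (f g : C -> C) (z l : C) :
  near_C z (fun w => f w = g w) -> Cderiv f z l -> Cderiv g z l.
Proof.
  intros E H; apply Cderiv_is_derive; apply Cderiv_is_derive in H.
  destruct E as [d [Hd E]].
  apply (is_derive_ext_loc f); [|exact H].
  exists (mkposreal d Hd); intros w Hw; now apply E.
Qed.

(** Where a continuous function has a differentiable square and does not
    vanish, it is differentiable. *)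
Lemma Cderiv_of_square (q : C -> C) (z l : C) :
  q z <> RtoC 0 -> Ccont q z -> Cderiv (fun w => q w * q w)%C z l ->
  Cderiv q z (l / (2 * q z))%C.
Proof.
  intros Hz Cq [p [Hp [Cp Ep]]].
  assert (H2 : RtoC 2 <> RtoC 0) by RtoC_neq.
  assert (S : near_C z (fun w => (q w + q z)%C <> RtoC 0)).
  { assert (P : 0 < Cmod (2 * q z)) by (apply Cmod_gt_0, Cmult_neq_0; auto).
    generalize (Cq (Cmod (2 * q z)) P); apply filter_imp; intros w Hw E.
    replace (q w - q z)%C with (q w + q z - 2 * q z)%C in Hw by ring.
    rewrite E in Hw. replace (RtoC 0 - 2 * q z)%C with (- (2 * q z))%C in Hw by ring.
    rewrite Cmod_opp in Hw; lra. }
  destruct S as [d [Hd S]].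
  exists (fun w => if Rlt_dec (Cmod (w - z)) d then (p w / (q w + q z))%C
    else ((q w - q z) / (w - z))%C).
  assert (Z0 : Cmod (z - z) < d) by (replace (z - z)%C with (RtoC 0) by ring; now rewrite Cmod_0).
  split; [|split].
  - destruct (Rlt_dec (Cmod (z - z)) d); [|contradiction].
    rewrite Hp; f_equal; ring.
  - apply (Clim_ext_loc (fun w => p w / (q w + q z))%C).
    + exists d; split; [exact Hd|]; intros w Hw.
      destruct (Rlt_dec (Cmod (w - z)) d); [reflexivity|contradiction].
    + destruct (Rlt_dec (Cmod (z - z)) d); [|contradiction].
      apply Clim_div; [now apply S|exact Cp|].
      apply Clim_plus; [exact Cq|apply Clim_const].
  - intros w; destruct (Rlt_dec (Cmod (w - z)) d) as [Hw|Hw].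
    + specialize (S w Hw). specialize (Ep w).
      assert (E : ((q w - q z) * (q w + q z) = p w * (w - z))%C).
      { transitivity (q w * q w - q z * q z)%C; [ring|]. rewrite Ep; ring. }
      replace (p w / (q w + q z) * (w - z))%C with ((p w * (w - z)) / (q w + q z))%C by (field; exact S).
      rewrite <- E. field; exact S.
    + field. intros E; apply Hw. rewrite E, Cmod_0; exact Hd.
Qed.

(** * Arcs and the complement of Omega *)

Notation path_continuous := (@continuous R_UniformSpace C_UniformSpace).

Ltac re_im_ring := unfold Re, Im; simpl; ring.

Lemma Cmod_le_Re_Im (z : C) : Cmod z <= Rabs (Re z) + Rabs (Im z).
Proof.
  rewrite <- (sqrt_square (Rabs (Re z) + Rabs (Im z))).
  - apply sqrt_le_1_alt. change (fst z) with (Re z); change (snd z) with (Im z).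
    pose proof (Rabs_pos (Re z)); pose proof (Rabs_pos (Im z)).
    rewrite <- (pow2_abs (Re z)), <- (pow2_abs (Im z)); nra.
  - pose proof (Rabs_pos (Re z)); pose proof (Rabs_pos (Im z)); lra.
Qed.

Lemma RtoC_Re (z : C) : Im z = 0 -> z = RtoC (Re z).
Proof. destruct z as [a b]; simpl; now intros ->. Qed.

Lemma re_minus (a b : C) : Re (a - b) = Re a - Re b.
Proof. reflexivity. Qed.

Lemma Im_le_Cmod (z : C) : Rabs (Im z) <= Cmod z.
Proof.
  eapply Rle_trans; [|apply (Rmax_Cmod z)]; apply Rmax_r.
Qed.

Lemma continuous_C_eps (g : R -> C) (t : R) :
  path_continuous g t <->
  forall eps, 0 < eps -> exists d, 0 < d /\ forall u, Rabs (u - t) < d -> Cmod (g u - g t) < eps.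
Proof.
  unfold continuous. rewrite <- Clim_filterlim by apply locally_filter.
  split; intros H eps Heps; destruct (H eps Heps) as [d Hd].
  - exists d; split; [apply cond_pos|exact Hd].
  - destruct Hd as [Hp Hd]; exists (mkposreal d Hp); exact Hd.
Qed.

Lemma is_derive_Re (g : R -> C) (t : R) (l : C) :
  @is_derive R_AbsRing C_R_NormedModule g t l -> is_derive (fun u => Re (g u)) t (Re l).
Proof.
  intros H.
  apply (filterdiff_ext_lin (fun u => Re (g u)) (fun y => fst (scal y l))).
  - apply (filterdiff_comp' (U := R_NormedModule) (V := C_R_NormedModule) (W := R_NormedModule) g fst t (fun y => scal y l) fst).
    + exact H.
    + apply (filterdiff_linear (U := prod_NormedModule R_AbsRing R_NormedModule R_NormedModule)), is_linear_fst.
  - intros y; reflexivity.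
Qed.

Lemma is_derive_Im (g : R -> C) (t : R) (l : C) :
  @is_derive R_AbsRing C_R_NormedModule g t l -> is_derive (fun u => Im (g u)) t (Im l).
Proof.
  intros H.
  apply (filterdiff_ext_lin (fun u => Im (g u)) (fun y => snd (scal y l))).
  - apply (filterdiff_comp' (U := R_NormedModule) (V := C_R_NormedModule) (W := R_NormedModule) g snd t (fun y => scal y l) snd).
    + exact H.
    + apply (filterdiff_linear (U := prod_NormedModule R_AbsRing R_NormedModule R_NormedModule)), is_linear_snd.
  - intros y; reflexivity.
Qed.

Lemma is_derive_continuity_pt (f : R -> R) (x l : R) : is_derive f x l -> continuity_pt f x.
Proof.
  intros H; apply continuity_pt_filterlim, (ex_derive_continuous f x); now exists l.
Qed.

Lemma mean_value_R (f df : R -> R) (t delta m eta : R) :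
  (forall u, Rabs (u - t) < delta -> is_derive f u (df u) /\ Rabs (df u - m) <= eta) ->
  forall u v, Rabs (u - t) < delta -> Rabs (v - t) < delta ->
  Rabs (f v - f u - m * (v - u)) <= eta * Rabs (v - u).
Proof.
  intros H u v Hu Hv.
  assert (B : forall x, Rmin u v <= x <= Rmax u v -> Rabs (x - t) < delta).
  { intros x Hx; unfold Rmin, Rmax in Hx; destruct (Rle_dec u v);
    apply Rabs_def1; apply Rabs_def2 in Hu; apply Rabs_def2 in Hv; lra. }
  destruct (MVT_gen f u v df) as [c [Hc E]].
  - intros x Hx; apply H, B; lra.
  - intros x Hx; apply (is_derive_continuity_pt _ _ (df x)), H, B, Hx.
  - rewrite E. replace (df c * (v - u) - m * (v - u)) with ((df c - m) * (v - u)) by ring.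
    rewrite Rabs_mult; apply Rmult_le_compat_r; [apply Rabs_pos|]. apply H, B, Hc.
Qed.

(** The mean value theorem for both coordinates, which costs the factor 2.
    With [d0] the tangent at [t], chords near [t] are nearly parallel to it.
    *)
Lemma mean_value_C (g dg : R -> C) (t delta eta : R) (d0 : C) :
  (forall u, Rabs (u - t) < delta ->
    @is_derive R_AbsRing C_R_NormedModule g u (dg u) /\ Cmod (dg u - d0) <= eta) ->
  forall u v, Rabs (u - t) < delta -> Rabs (v - t) < delta ->
  Cmod (g v - g u - d0 * RtoC (v - u)) <= 2 * eta * Rabs (v - u).
Proof.
  intros H u v Hu Hv.
  eapply Rle_trans; [apply Cmod_le_Re_Im|].
  assert (R1 : Rabs (Re (g v) - Re (g u) - Re d0 * (v - u)) <= eta * Rabs (v - u)).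
  { apply (mean_value_R (fun x => Re (g x)) (fun x => Re (dg x)) t delta); auto.
    intros x Hx; destruct (H x Hx) as [D E]; split; [now apply is_derive_Re|].
    eapply Rle_trans; [|exact E]. apply (re_le_Cmod (dg x - d0)). }
  assert (R2 : Rabs (Im (g v) - Im (g u) - Im d0 * (v - u)) <= eta * Rabs (v - u)).
  { apply (mean_value_R (fun x => Im (g x)) (fun x => Im (dg x)) t delta); auto.
    intros x Hx; destruct (H x Hx) as [D E]; split; [now apply is_derive_Im|].
    eapply Rle_trans; [|exact E]. apply (Im_le_Cmod (dg x - d0)). }
  replace (Re (g v - g u - d0 * RtoC (v - u))) with (Re (g v) - Re (g u) - Re d0 * (v - u))
    by re_im_ring.
  replace (Im (g v - g u - d0 * RtoC (v - u))) with (Im (g v) - Im (g u) - Im d0 * (v - u))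
    by re_im_ring.
  lra.
Qed.

Definition collar (g dg : R -> C) (u e : R) : C := (g u + Ci * RtoC e * dg u)%C.

(** A regular C^1 arc does not meet its own left collar: locally a chord is
    nearly parallel to the tangent, the collar displacement nearly orthogonal. *)
Lemma collar_off_arc (g dg : R -> C) (t r : R) :
  0 < r -> dg t <> RtoC 0 ->
  (forall u, Rabs (u - t) < r -> @is_derive R_AbsRing C_R_NormedModule g u (dg u)) ->
  path_continuous dg t ->
  exists delta, 0 < delta /\ forall u v e, Rabs (u - t) < delta -> Rabs (v - t) < delta ->
    0 < e -> collar g dg u e <> g v.
Proof.
  intros Hr Hd HD HC.
  assert (M : 0 < Cmod (dg t)) by now apply Cmod_gt_0.
  set (m := Cmod (dg t)) in *.
  assert (M8 : 0 < m / 8) by lra.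
  destruct (proj1 (continuous_C_eps dg t) HC _ M8) as [d1 [Hd1 H1]].
  exists (Rmin r d1); split; [now apply Rmin_pos|].
  assert (K : forall u, Rabs (u - t) < Rmin r d1 ->
    @is_derive R_AbsRing C_R_NormedModule g u (dg u) /\ Cmod (dg u - dg t) <= m / 8).
  { intros u [U1 U2]%Rmin_lt; split; [now apply HD|now apply Rlt_le, H1]. }
  intros u v e Hu Hv He E.
  pose proof (mean_value_C g dg t _ _ (dg t) K u v Hu Hv) as MV.
  destruct (K u Hu) as [_ Ku].
  assert (X : (dg t * (Ci * RtoC e - RtoC (v - u)) =
    (g v - g u - dg t * RtoC (v - u)) - Ci * RtoC e * (dg u - dg t))%C).
  { rewrite <- E; unfold collar; ring. }
  assert (Y : Cmod (dg t * (Ci * RtoC e - RtoC (v - u))) <= m / 4 * Rabs (v - u) + m / 8 * e).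
  { rewrite X. unfold Cminus at 1. eapply Rle_trans; [apply Cmod_triangle|].
    rewrite Cmod_opp, !Cmod_mult, Cmod_Ci, Cmod_R, (Rabs_pos_eq e) by lra.
    nra. }
  rewrite Cmod_mult in Y; fold m in Y.
  pose proof (re_le_Cmod (Ci * RtoC e - RtoC (v - u))) as Z1.
  pose proof (Im_le_Cmod (Ci * RtoC e - RtoC (v - u))) as Z2.
  replace (Re (Ci * RtoC e - RtoC (v - u))) with (- (v - u)) in Z1 by re_im_ring.
  replace (Im (Ci * RtoC e - RtoC (v - u))) with e in Z2 by re_im_ring.
  rewrite Rabs_Ropp in Z1. rewrite (Rabs_pos_eq e) in Z2 by lra.
  set (c := Cmod (Ci * RtoC e - RtoC (v - u))) in *.
  pose proof (Rabs_pos (v - u)). nra.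
Qed.

Lemma arc_distance (g : R -> C) (a b : R) (z : C) :
  a <= b ->
  (forall t, a <= t <= b -> path_continuous g t) ->
  (forall t, a <= t <= b -> g t <> z) ->
  exists mu, 0 < mu /\ forall t, a <= t <= b -> mu <= Cmod (g t - z).
Proof.
  intros Hab HC HN.
  destruct (continuity_ab_min (fun t => Cmod (g t - z)) a b Hab) as [m [Hm Im]].
  - intros t Ht; apply continuity_pt_filterlim.
    apply Clim_Cmod, Clim_minus; [|apply Clim_const].
    apply Clim_filterlim; [apply locally_filter|]. apply HC, Ht.
  - exists (Cmod (g m - z)); split; [|exact Hm].
    apply Cmod_gt_0, Cminus_eq_contra, HN, Im.
Qed.

Lemma arc_bounded (g : R -> C) (a b : R) :
  a <= b ->
  (forall t, a <= t <= b -> path_continuous g t) ->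
  exists M, forall t, a <= t <= b -> Cmod (g t) <= M.
Proof.
  intros Hab HC.
  destruct (continuity_ab_maj (fun t => Cmod (g t)) a b Hab) as [m [Hm Im]].
  - intros t Ht; apply continuity_pt_filterlim, Clim_Cmod.
    apply Clim_filterlim; [apply locally_filter|]. apply HC, Ht.
  - exists (Cmod (g m)); exact Hm.
Qed.

Lemma ray_closed (z : C) : ~ ray z -> near_C z (fun w => ~ ray w).
Proof.
  intros H; destruct (Req_dec (Im z) 0) as [E|N].
  - assert (R1 : -1 < Re z) by (apply Rnot_le_lt; intros K; apply H; now split).
    exists (Re z + 1); split; [lra|]; intros w Hw [_ K].
    pose proof (re_le_Cmod (w - z)) as B.
    replace (Re (w - z)) with (Re w - Re z) in B by re_im_ring.
    apply (Rle_lt_trans _ _ _ B), Rabs_def2 in Hw; lra.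
  - exists (Rabs (Im z)); split; [now apply Rabs_pos_lt|]; intros w Hw [K _].
    pose proof (Im_le_Cmod (w - z)) as B.
    replace (Im (w - z)) with (- Im z) in B by (unfold Im in *; simpl; rewrite K; ring).
    rewrite Rabs_Ropp in B; lra.
Qed.

Section Contour.
Context {L : nat} (G : contour L).

Lemma brk_lt (i j : nat) : (i < j <= 2 * L + 1)%nat -> brk G i < brk G j.
Proof.
  intros [Hij Hj]; induction Hij.
  - apply brk_incr; lia.
  - apply Rlt_trans with (brk G m); [apply IHHij; lia|apply brk_incr; lia].
Qed.

Lemma brk_range (i : nat) : (i <= 2 * L + 1)%nat -> 0 <= brk G i <= 1.
Proof.
  intros Hi; rewrite <- (brk_first L G) at 1; rewrite <- (brk_last L G).
  split.
  - destruct i; [apply Rle_refl|apply Rlt_le, brk_lt; lia].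
  - destruct (Nat.eq_dec i (2 * L + 1)) as [->|]; [apply Rle_refl|apply Rlt_le, brk_lt; lia].
Qed.

Lemma brk_piece (t : R) : 0 <= t <= 1 ->
  exists k, (k <= 2 * L)%nat /\ brk G k <= t <= brk G (S k).
Proof.
  intros [H0 H1].
  assert (K : forall n, (n <= 2 * L)%nat -> t <= brk G (S n) ->
    exists k, (k <= 2 * L)%nat /\ brk G k <= t <= brk G (S k)).
  { induction n as [|n IH]; intros Hn Ht.
    - exists 0%nat; rewrite (brk_first L G); split; [lia|lra].
    - destruct (Rle_dec t (brk G (S n))) as [Hl|Hl]; [apply IH; [lia|exact Hl]|].
      exists (S n); split; [exact Hn|lra]. }
  apply (K (2 * L)%nat); [lia|].
  replace (S (2 * L)) with (2 * L + 1)%nat by lia; rewrite (brk_last L G); exact H1.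
Qed.

Lemma Sigma_closed (z : C) : (forall t, 0 <= t <= 1 -> sg G t <> z) ->
  near_C z (fun w => forall t, 0 <= t <= 1 -> sg G t <> w).
Proof.
  intros H.
  destruct (arc_distance (sg G) 0 1 z) as [mu [Hmu Hd]]; try assumption; [lra|apply sg_cont|].
  exists mu; split; [exact Hmu|]; intros w Hw t Ht E.
  specialize (Hd t Ht); rewrite E in Hd; lra.
Qed.

Lemma Omega_closed (z : C) : ~ Omega G z -> near_C z (fun w => ~ Omega G w).
Proof.
  intros H.
  assert (H1 : ~ ray z) by (intros K; apply H; now left).
  assert (H2 : forall t, 0 <= t <= 1 -> sg G t <> z)
    by (intros t Ht E; apply H; right; exists t; auto).
  generalize (filter_and _ _ (ray_closed z H1) (Sigma_closed z H2)).
  apply filter_imp; intros w [K1 K2] [K|[t [Ht E]]]; [auto|now apply (K2 t Ht)].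
Qed.

(** Near [t] the arc avoids its own collar; the remaining part of the curve
    and the ray stay at a positive distance from [sg G t]. *)
Lemma sg_piece_collar (k : nat) (t : R) :
  (k <= 2 * L)%nat -> brk G k < t < brk G (S k) ->
  exists delta, 0 < delta /\ forall u e, Rabs (u - t) < delta -> 0 < e < delta ->
    ~ Omega G (collar (sg G) (dsg G k) u e).
Proof.
  intros Hk Ht.
  assert (B0 : 0 <= brk G k) by (apply brk_range; lia).
  assert (B1 : brk G (S k) <= 1) by (apply brk_range; lia).
  set (r := Rmin (t - brk G k) (brk G (S k) - t)).
  assert (Hr : 0 < r) by (apply Rmin_pos; lra).
  assert (Hr1 : r <= t - brk G k) by apply Rmin_l.
  assert (Hr2 : r <= brk G (S k) - t) by apply Rmin_r.
  assert (CD : path_continuous (dsg G k) t)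
    by (apply dsg_cont; [exact Hk|lra]).
  destruct (collar_off_arc (sg G) (dsg G k) t r Hr) as [d1 [Hd1 H1]].
  { apply dsg_neq0; [exact Hk|lra]. }
  { intros u Hu; apply Rabs_def2 in Hu; apply sg_derive; [exact Hk|lra]. }
  { exact CD. }
  set (d2 := Rmin d1 (Rmin t (1 - t))).
  assert (Hd2 : 0 < d2) by (repeat apply Rmin_pos; lra).
  assert (D21 : d2 <= d1) by apply Rmin_l.
  assert (D22 : d2 <= t) by (eapply Rle_trans; [apply Rmin_r|apply Rmin_l]).
  assert (D23 : d2 <= 1 - t) by (eapply Rle_trans; [apply Rmin_r|apply Rmin_r]).
  destruct (arc_distance (sg G) 0 (t - d2) (sg G t)) as [m1 [Hm1 K1]]; [lra| | |].
  { intros v Hv; apply sg_cont; lra. }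
  { intros v Hv E; apply sg_inj in E; lra. }
  destruct (arc_distance (sg G) (t + d2) 1 (sg G t)) as [m2 [Hm2 K2]]; [lra| | |].
  { intros v Hv; apply sg_cont; lra. }
  { intros v Hv E; apply sg_inj in E; lra. }
  destruct (ray_closed (sg G t)) as [m3 [Hm3 K3]]; [apply sg_off_ray; lra|].
  set (mu := Rmin m1 (Rmin m2 m3)).
  assert (Hmu : 0 < mu) by (repeat apply Rmin_pos; lra).
  assert (M1 : mu <= m1) by apply Rmin_l.
  assert (M2 : mu <= m2) by (eapply Rle_trans; [apply Rmin_r|apply Rmin_l]).
  assert (M3 : mu <= m3) by (eapply Rle_trans; [apply Rmin_r|apply Rmin_r]).
  assert (CS : path_continuous (sg G) t) by (apply sg_cont; lra).
  assert (Hmu2 : 0 < mu / 2) by lra.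
  destruct (proj1 (continuous_C_eps _ t) CS _ Hmu2) as [d3 [Hd3 H3]].
  destruct (proj1 (continuous_C_eps _ t) CD _ Rlt_0_1) as [d4 [Hd4 H4]].
  set (D := Cmod (dsg G k t) + 1).
  assert (HD : 0 < D) by (pose proof (Cmod_ge_0 (dsg G k t)); unfold D; lra).
  exists (Rmin (Rmin d2 d3) (Rmin d4 (mu / 2 / D))).
  split; [repeat apply Rmin_pos; try lra; apply Rdiv_lt_0_compat; lra|].
  intros u e [[U2 U3]%Rmin_lt [U4 _]%Rmin_lt]%Rmin_lt [E0 [_ [_ E5]%Rmin_lt]%Rmin_lt].
  set (z := collar (sg G) (dsg G k) u e).
  assert (Z : Cmod (z - sg G t) < mu).
  { unfold z, collar.
    replace (sg G u + Ci * RtoC e * dsg G k u - sg G t)%C with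
      ((sg G u - sg G t) + Ci * RtoC e * dsg G k u)%C by ring.
    eapply Rle_lt_trans; [apply Cmod_triangle|].
    rewrite !Cmod_mult, Cmod_Ci, Cmod_R, (Rabs_pos_eq e) by lra.
    specialize (H3 u U3).
    assert (Cmod (dsg G k u) <= D).
    { specialize (H4 u U4). pose proof (Cmod_triangle (dsg G k u - dsg G k t) (dsg G k t)) as T.
      replace (dsg G k u - dsg G k t + dsg G k t)%C with (dsg G k u) in T by ring. unfold D; lra. }
    assert (e * D < mu / 2).
    { replace (mu / 2) with (mu / 2 / D * D) by (field; lra). apply Rmult_lt_compat_r; lra. }
    assert (e * Cmod (dsg G k u) <= e * D) by (apply Rmult_le_compat_l; lra). lra. }
  intros [HR|[v [Hv E]]].
  - apply (K3 z); [lra|exact HR].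
  - destruct (Rlt_dec (Rabs (v - t)) d2) as [Vn|Vf].
    + apply (H1 u v e); [lra|lra|lra|exact E].
    + apply Rnot_lt_le in Vf.
      assert (Cmod (sg G v - sg G t) < mu) by (rewrite <- E; exact Z).
      destruct (Rle_dec v t) as [Hl|Hl].
      * rewrite Rabs_left1 in Vf by lra. specialize (K1 v ltac:(lra)); lra.
      * rewrite Rabs_pos_eq in Vf by lra. specialize (K2 v ltac:(lra)); lra.
Qed.

Lemma ray_collar (x : R) : x < -1 ->
  exists delta, 0 < delta /\ forall u e, Rabs (u - x) < delta -> 0 < e < delta ->
    ~ Omega G (collar RtoC (fun _ => RtoC 1) u e).
Proof.
  intros Hx.
  destruct (Sigma_closed (RtoC x)) as [d [Hd H]].
  { intros t Ht E; destruct (Rle_lt_or_eq_dec 0 t) as [Hp|H0]; [lra| |].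
    - apply (sg_off_ray L G t); [lra|rewrite E; split; simpl; lra].
    - subst t; rewrite sg_first in E; apply RtoC_inj in E; lra. }
  exists (d / 2); split; [lra|]; intros u e Hu He [[HI _]|[v [Hv E]]].
  - unfold collar in HI; simpl in HI; lra.
  - refine (H (sg G v) _ v Hv eq_refl).
    rewrite <- E; unfold collar.
    replace (RtoC u + Ci * RtoC e * 1 - RtoC x)%C with (RtoC (u - x) + Ci * RtoC e)%C
      by (rewrite RtoC_minus; ring).
    eapply Rle_lt_trans; [apply Cmod_triangle|].
    rewrite Cmod_mult, Cmod_Ci, !Cmod_R, (Rabs_pos_eq e) by lra. lra.
Qed.

Lemma collar_near (g dg : R -> C) (u eps : R) : 0 < eps ->
  exists delta, 0 < delta /\ forall e, 0 < e < delta -> Cmod (collar g dg u e - g u) < eps.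
Proof.
  intros He; set (D := Cmod (dg u) + 1).
  assert (HD : 0 < D) by (pose proof (Cmod_ge_0 (dg u)); unfold D; lra).
  exists (eps / D); split; [now apply Rdiv_lt_0_compat|]; intros e [E1 E2].
  unfold collar; replace (g u + Ci * RtoC e * dg u - g u)%C with (Ci * RtoC e * dg u)%C by ring.
  rewrite !Cmod_mult, Cmod_Ci, Cmod_R, (Rabs_pos_eq e) by lra.
  assert (e * D < eps).
  { replace eps with (eps / D * D) by (field; lra). apply Rmult_lt_compat_r; lra. }
  unfold D in *; nra.
Qed.

(** Collar points over nearby interior parameters lie off Omega. Hence a limit
    at a point of Omega, taken through the complement, determines continuous
    functions there. *)
Lemma complement_dense (z0 : C) (eps : R) : Omega G z0 -> 0 < eps ->
  exists z, Cmod (z - z0) < eps /\ ~ Omega G z.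
Proof.
  intros H He.
  assert (P : exists g dg u delta, 0 < delta /\ Cmod (g u - z0) < eps / 2 /\
    forall e, 0 < e < delta -> ~ Omega G (collar g dg u e)).
  { destruct H as [[HI HR]|[t [Ht ->]]].
    - set (x := Re z0 - eps / 4).
      destruct (ray_collar x) as [d [Hd K]]; [unfold x; lra|].
      exists RtoC, (fun _ => RtoC 1), x, d; split; [exact Hd|split].
      + replace (RtoC x - z0)%C with (RtoC (- (eps / 4))).
        * rewrite Cmod_R, Rabs_Ropp, Rabs_pos_eq; lra.
        * destruct z0 as [a b]; simpl in *; subst b; unfold x; simpl.
          apply injective_projections; simpl; ring.
      + intros e Ee; apply K; [rewrite Rminus_diag, Rabs_R0; exact Hd|exact Ee].
    - destruct (brk_piece t Ht) as [k [Hk Bk]].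
      assert (CS : path_continuous (sg G) t) by (apply sg_cont; lra).
      assert (He2 : 0 < eps / 2) by lra.
      destruct (proj1 (continuous_C_eps _ t) CS _ He2) as [d [Hd K]].
      pose proof (brk_incr L G k Hk) as BB.
      assert (Q : exists u, Rabs (u - t) < d /\ brk G k < u < brk G (S k)).
      { destruct (Rle_dec t ((brk G k + brk G (S k)) / 2)).
        - exists (t + Rmin (d / 2) ((brk G (S k) - brk G k) / 4)).
          pose proof (Rmin_l (d / 2) ((brk G (S k) - brk G k) / 4)).
          pose proof (Rmin_r (d / 2) ((brk G (S k) - brk G k) / 4)).
          assert (0 < Rmin (d / 2) ((brk G (S k) - brk G k) / 4)) by (apply Rmin_pos; lra).
          split; [apply Rabs_def1; lra|lra].
        - exists (t - Rmin (d / 2) ((brk G (S k) - brk G k) / 4)).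
          pose proof (Rmin_l (d / 2) ((brk G (S k) - brk G k) / 4)).
          pose proof (Rmin_r (d / 2) ((brk G (S k) - brk G k) / 4)).
          assert (0 < Rmin (d / 2) ((brk G (S k) - brk G k) / 4)) by (apply Rmin_pos; lra).
          split; [apply Rabs_def1; lra|lra]. }
      destruct Q as [u [Q1 Q2]].
      destruct (sg_piece_collar k u Hk Q2) as [d' [Hd' K']].
      exists (sg G), (dsg G k), u, d'; split; [exact Hd'|split; [now apply K|]].
      intros e Ee; apply K'; [rewrite Rminus_diag, Rabs_R0; exact Hd'|exact Ee]. }
  destruct P as [g [dg [u [d [Hd [N K]]]]]].
  assert (He2 : 0 < eps / 2) by lra.
  destruct (collar_near g dg u (eps / 2) He2) as [d' [Hd' K']].
  set (e := Rmin d d' / 2).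
  assert (0 < Rmin d d') by now apply Rmin_pos.
  pose proof (Rmin_l d d'); pose proof (Rmin_r d d').
  exists (collar g dg u e); split; [|apply K; unfold e; lra].
  specialize (K' e ltac:(unfold e; lra)).
  replace (collar g dg u e - z0)%C with ((collar g dg u e - g u) + (g u - z0))%C by ring.
  eapply Rle_lt_trans; [apply Cmod_triangle|lra].
Qed.

Definition off_Omega (z0 : C) (P : C -> Prop) : Prop :=
  near_C z0 (fun z => ~ Omega G z -> P z).

Global Instance off_Omega_filter (z0 : C) : Filter (off_Omega z0).
Proof.
  unfold off_Omega; split.
  - apply filter_forall; auto.
  - intros P Q HP HQ; generalize (filter_and _ _ HP HQ); apply filter_imp; firstorder.
  - intros P Q PQ; apply filter_imp; auto.
Qed.

Lemma off_Omega_proper (z0 : C) : Omega G z0 -> ProperFilter (off_Omega z0).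
Proof.
  intros H; split; [|apply off_Omega_filter].
  intros P [d [Hd HP]].
  destruct (complement_dense z0 d H Hd) as [z [Hz1 Hz2]]; exists z; auto.
Qed.

Lemma near_off_Omega (z0 : C) (P : C -> Prop) : near_C z0 P -> off_Omega z0 P.
Proof. apply (filter_imp (F := near_C z0)); auto. Qed.

Lemma Ccont_off_Omega (f : C -> C) (z0 : C) : Ccont f z0 -> Clim (off_Omega z0) f (f z0).
Proof. intros H eps Heps; apply near_off_Omega, H, Heps. Qed.

Lemma off_Omega_here (z0 : C) : off_Omega z0 (fun z => ~ Omega G z).
Proof. apply (filter_forall (F := near_C z0)); auto. Qed.

End Contour.

(** * Real calculus along segments *)

Lemma is_derive_eps (f : R -> R) (x l : R) :
  (forall eps, 0 < eps -> exists d, 0 < d /\ forall u, Rabs (u - x) < d ->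
    exists m, f u - f x = m * (u - x) /\ Rabs (m - l) < eps) ->
  is_derive f x l.
Proof.
  intros H; apply is_derive_Reals; intros eps Heps.
  destruct (H eps Heps) as [d [Hd K]].
  exists (mkposreal d Hd); intros u Hu0 Hu; simpl in Hu.
  destruct (K (x + u)) as [m [E M]]; [replace (x + u - x) with u by ring; exact Hu|].
  replace ((f (x + u) - f x) / u) with m; [exact M|].
  rewrite E; field; exact Hu0.
Qed.

Lemma Cderiv_line_Re (f : C -> C) (z0 d l : C) (t : R) :
  Cderiv f (z0 + RtoC t * d)%C l ->
  is_derive (fun u => Re (f (z0 + RtoC u * d)%C)) t (Re (l * d)).
Proof.
  intros [phi [Hp [Cp Ep]]]; apply is_derive_eps; intros eps Heps.
  assert (K : 0 < eps / (Cmod d + 1)) by (pose proof (Cmod_ge_0 d); apply Rdiv_lt_0_compat; lra).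
  destruct (Cp _ K) as [e [He H]].
  exists (e / (Cmod d + 1)); split.
  { pose proof (Cmod_ge_0 d); apply Rdiv_lt_0_compat; lra. }
  intros u Hu; exists (Re (phi (z0 + RtoC u * d)%C * d)); split.
  - rewrite (Ep (z0 + RtoC u * d)%C).
    replace (z0 + RtoC u * d - (z0 + RtoC t * d))%C with (RtoC (u - t) * d)%C
      by (rewrite RtoC_minus; ring).
    unfold Re; simpl; ring.
  - rewrite <- Hp.
    replace (Re (phi (z0 + RtoC u * d)%C * d) - Re (phi (z0 + RtoC t * d)%C * d))
      with (Re ((phi (z0 + RtoC u * d)%C - phi (z0 + RtoC t * d)%C) * d)) by re_im_ring.
    eapply Rle_lt_trans; [apply re_le_Cmod|]. rewrite Cmod_mult.
    assert (D : Cmod (z0 + RtoC u * d - (z0 + RtoC t * d)) < e).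
    { replace (z0 + RtoC u * d - (z0 + RtoC t * d))%C with (RtoC (u - t) * d)%C
        by (rewrite RtoC_minus; ring).
      rewrite Cmod_mult, Cmod_R. pose proof (Cmod_ge_0 d).
      apply Rle_lt_trans with (Rabs (u - t) * (Cmod d + 1)).
      - apply Rmult_le_compat_l; [apply Rabs_pos|lra].
      - replace e with (e / (Cmod d + 1) * (Cmod d + 1)) by (field; lra).
        apply Rmult_lt_compat_r; lra. }
    specialize (H _ D). pose proof (Cmod_ge_0 d).
    apply Rle_lt_trans with (eps / (Cmod d + 1) * Cmod d).
    + apply Rmult_le_compat_r; [lra|apply Rlt_le, H].
    + replace eps with (eps / (Cmod d + 1) * (Cmod d + 1)) at 2 by (field; lra).
      apply Rmult_lt_compat_l; lra.
Qed.

Lemma Cderiv_line_Im (f : C -> C) (z0 d l : C) (t : R) :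
  Cderiv f (z0 + RtoC t * d)%C l ->
  is_derive (fun u => Im (f (z0 + RtoC u * d)%C)) t (Im (l * d)).
Proof.
  intros H.
  assert (K : Cderiv (fun w => - Ci * f w)%C (z0 + RtoC t * d) (- Ci * l)).
  { replace (- Ci * l)%C with (0 * f (z0 + RtoC t * d)%C + - Ci * l)%C by ring.
    apply (Cderiv_mult (fun _ => - Ci)%C f); [apply Cderiv_const|exact H]. }
  apply Cderiv_line_Re in K.
  replace (Im (l * d)) with (Re (- Ci * l * d)) by re_im_ring.
  apply (is_derive_ext (fun u => Re (- Ci * f (z0 + RtoC u * d)%C)%C)); [|exact K].
  intros u; re_im_ring.
Qed.

Lemma ln_Cmod (z : C) : z <> RtoC 0 -> ln (Cmod z) = / 2 * ln (Re z ^ 2 + Im z ^ 2).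
Proof.
  intros Hz; apply Cmod_gt_0 in Hz.
  replace (Re z ^ 2 + Im z ^ 2) with (Cmod z * Cmod z) by (rewrite <- Cmod2_alt; ring).
  rewrite ln_mult by exact Hz; lra.
Qed.

Lemma is_derive_ln_norm (a b : R -> R) (t a' b' : R) :
  0 < a t ^ 2 + b t ^ 2 -> is_derive a t a' -> is_derive b t b' ->
  is_derive (fun u => / 2 * ln (a u ^ 2 + b u ^ 2)) t
    ((a t * a' + b t * b') / (a t ^ 2 + b t ^ 2)) /\
  locally t (fun u => 0 < a u ^ 2 + b u ^ 2).
Proof.
  intros P Ha Hb; split.
  - auto_derive.
    + split; [now exists a'|split; [now exists b'|split; [simpl in P; lra|exact I]]].
    + replace (Derive (fun x : R => a x) t) with a' by (symmetry; now apply is_derive_unique).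
      replace (Derive (fun x : R => b x) t) with b' by (symmetry; now apply is_derive_unique).
      field; lra.
  - assert (E : continuous (fun u => a u ^ 2 + b u ^ 2) t).
    { apply (ex_derive_continuous (fun u => a u ^ 2 + b u ^ 2)).
      auto_derive; split; [now exists a'|split; [now exists b'|exact I]]. }
    apply (E (fun y => 0 < y)), (open_gt 0), P.
Qed.

Lemma Cderiv_line_ln_Cmod (f : C -> C) (z0 d l : C) (t : R) :
  f (z0 + RtoC t * d)%C <> RtoC 0 -> Cderiv f (z0 + RtoC t * d) l ->
  is_derive (fun u => ln (Cmod (f (z0 + RtoC u * d)%C))) t (Re (l * d / f (z0 + RtoC t * d)%C)).
Proof.
  intros N H; pose proof (Cderiv_line_Re _ _ _ _ _ H) as HR.
  pose proof (Cderiv_line_Im _ _ _ _ _ H) as HI.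
  assert (P : 0 < Re (f (z0 + RtoC t * d)%C) ^ 2 + Im (f (z0 + RtoC t * d)%C) ^ 2).
  { rewrite <- Cmod2_alt; apply pow_lt; now apply Cmod_gt_0. }
  destruct (is_derive_ln_norm _ _ _ _ _ P HR HI) as [D K].
  apply (is_derive_ext_loc (fun u => / 2 * ln (Re (f (z0 + RtoC u * d)%C) ^ 2 +
    Im (f (z0 + RtoC u * d)%C) ^ 2))).
  - generalize K; apply filter_imp; intros u Hu; symmetry; apply ln_Cmod.
    intros E; rewrite E in Hu; simpl in Hu; lra.
  - match type of D with is_derive _ _ ?x => replace (Re (l * d / f (z0 + RtoC t * d)%C)) with x end;
      [exact D|].
    clear D K HR HI H N; revert P; generalize (f (z0 + RtoC t * d)%C); intros [a b] P; unfold Re, Im in *; simpl in *.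
    field; lra.
Qed.

Lemma locally_constant_on_interval (f : R -> R) (a b : R) :
  (forall x, a < x < b -> locally x (fun y => f y = f x)) ->
  forall x y, a < x < b -> a < y < b -> f x = f y.
Proof.
  intros H.
  assert (D : forall x, a < x < b -> is_derive f x 0).
  { intros x Hx; apply (is_derive_ext_loc (fun _ => f x)).
    - generalize (H x Hx); apply filter_imp; auto.
    - apply @is_derive_const. }
  assert (B : forall x y z, a < x < b -> a < y < b -> Rmin x y <= z <= Rmax x y -> a < z < b).
  { intros x y z Hx Hy Hz; unfold Rmin, Rmax in Hz; destruct (Rle_dec x y); lra. }
  intros x y Hx Hy.
  destruct (MVT_gen f x y (fun _ => 0)) as [c [Hc E]].
  - intros z Hz; apply D, (B x y); try assumption; lra.
  - intros z Hz; apply (is_derive_continuity_pt _ _ 0), D, (B x y); assumption.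
  - lra.
Qed.

(** Darboux: if the derivative changed sign, the maximum of f on the interval
    would be interior, and the derivative would vanish there. *)
Lemma Darboux_pos (f df : R -> R) (b : R) :
  0 <= b -> (forall t, 0 <= t <= b -> is_derive f t (df t) /\ df t <> 0) ->
  0 < df 0 -> 0 < df b.
Proof.
  intros Hb H H0; apply Rnot_le_lt; intros Hn.
  destruct (Rle_lt_or_eq_dec 0 b Hb) as [Hb'|<-]; [|lra].
  assert (Hlt : df b < 0) by (destruct (H b) as [_ N]; lra).
  destruct (continuity_ab_maj f 0 b Hb) as [m [Hm Im]].
  { intros c Hc; apply (is_derive_continuity_pt _ _ (df c)), H, Hc. }
  assert (M0 : m <> 0).
  { intros ->. destruct (H 0) as [D _]; [lra|].
    apply is_derive_Reals in D; destruct (D _ H0) as [d K].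
    set (u := Rmin (d / 2) b). pose proof (cond_pos d).
    assert (0 < u) by (apply Rmin_pos; lra).
    assert (u <= d / 2) by apply Rmin_l. assert (u <= b) by apply Rmin_r.
    specialize (K u ltac:(lra) ltac:(rewrite Rabs_pos_eq; lra)).
    apply Rabs_def2 in K. destruct K as [_ K].
    assert (0 < (f (0 + u) - f 0) / u) by lra.
    specialize (Hm (0 + u) ltac:(lra)).
    assert (0 < (f (0 + u) - f 0) / u * u) by (apply Rmult_lt_0_compat; lra).
    replace ((f (0 + u) - f 0) / u * u) with (f (0 + u) - f 0) in * by (field; lra). lra. }
  assert (Mb : m <> b).
  { intros ->. destruct (H b) as [D _]; [lra|].
    apply is_derive_Reals in D; destruct (D (- df b)) as [d K]; [lra|].
    set (u := Rmin (d / 2) b). pose proof (cond_pos d).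
    assert (0 < u) by (apply Rmin_pos; lra).
    assert (u <= d / 2) by apply Rmin_l. assert (u <= b) by apply Rmin_r.
    specialize (K (- u) ltac:(lra) ltac:(rewrite Rabs_Ropp, Rabs_pos_eq; lra)).
    apply Rabs_def2 in K. destruct K as [K _].
    assert ((f (b + - u) - f b) / - u < 0) by lra.
    specialize (Hm (b + - u) ltac:(lra)).
    assert ((f (b + - u) - f b) / - u * - u > 0) by nra.
    replace ((f (b + - u) - f b) / - u * - u) with (f (b + - u) - f b) in * by (field; lra). lra. }
  destruct (H m Im) as [D N]; apply N.
  pose proof D as D'; apply is_derive_Reals in D'.
  assert (pr : derivable_pt f m) by (exists (df m); exact D').
  rewrite <- (derive_pt_eq_0 f m (df m) pr D').
  apply (deriv_maximum f 0 b m pr); [lra|lra|]. intros x H1 H2; apply Hm; lra.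
Qed.

(** * The square root selected by the derivative of h *)

(** A branch of a square root that is a derivative is automatically
    continuous: the ratio to its value at the centre has nonzero real part,
    whose sign cannot change along a segment. *)
Lemma derivative_continuous_of_square (f df : C -> C) (z1 : C) :
  near_C z1 (fun w => Cderiv f w (df w)) ->
  Ccont (fun w => df w * df w)%C z1 -> df z1 <> RtoC 0 -> Ccont df z1.
Proof.
  intros HD HC Ha eps Heps; set (a := df z1) in *.
  assert (A : 0 < Cmod a) by now apply Cmod_gt_0.
  set (eta := Rmin (1 / 2) (eps / Cmod a)).
  assert (E1 : 0 < eta) by (apply Rmin_pos; [lra|now apply Rdiv_lt_0_compat]).
  assert (E2 : eta <= 1 / 2) by apply Rmin_l.
  assert (E3 : eta * Cmod a <= eps).
  { replace eps with (eps / Cmod a * Cmod a) by (field; lra).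
    apply Rmult_le_compat_r; [lra|apply Rmin_r]. }
  assert (E4 : 0 < eta * (Cmod a * Cmod a)) by (repeat apply Rmult_lt_0_compat; assumption).
  destruct (filter_and _ _ HD (HC _ E4)) as [d [Hd K]].
  assert (S : forall w, Cmod (w - z1) < d -> Cmod ((df w / a - 1) * (df w / a + 1)) < eta).
  { intros w Hw; destruct (K w Hw) as [_ K2]; fold a in K2.
    replace (df w * df w - a * a)%C with ((df w / a - 1) * (df w / a + 1) * (a * a))%C in K2
      by (field; exact Ha).
    rewrite 3!Cmod_mult in K2. rewrite Cmod_mult.
    apply Rmult_lt_reg_r with (Cmod a * Cmod a); [nra|]. exact K2. }
  (* For y = i b one has |y^2 - 1| = 1 + b^2, which exceeds eta <= 1/2. *)
  assert (RN : forall w, Cmod (w - z1) < d -> Re (df w / a) <> 0).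
  { intros w Hw E; specialize (S w Hw).
    set (y := (df w / a)%C) in *.
    pose proof (re_le_Cmod ((y - 1) * (y + 1))) as B.
    replace (Re ((y - 1) * (y + 1))) with (Re y * Re y - Im y * Im y - 1) in B by re_im_ring.
    rewrite E in B. rewrite Rabs_left1 in B; nra. }
  exists d; split; [exact Hd|]; intros w Hw.
  destruct (Ceq_dec w z1) as [->|Nw].
  { fold a; replace (a - a)%C with (RtoC 0) by ring; now rewrite Cmod_0. }
  assert (Nw' : (w - z1)%C <> RtoC 0) by now apply Cminus_eq_contra.
  assert (P : 0 < Re (df w / a)).
  { set (dir := (w - z1)%C) in *.
    set (F := fun t => Re (/ (a * dir) * f (z1 + RtoC t * dir)%C)%C).
    assert (SEG : forall t, 0 <= t <= 1 -> Cmod (z1 + RtoC t * dir - z1) < d).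
    { intros t Ht. replace (z1 + RtoC t * dir - z1)%C with (RtoC t * dir)%C by ring.
      rewrite Cmod_mult, Cmod_R, Rabs_pos_eq by lra. pose proof (Cmod_ge_0 dir); nra. }
    replace w with (z1 + RtoC 1 * dir)%C by (unfold dir; ring).
    apply (Darboux_pos F (fun t => Re (df (z1 + RtoC t * dir)%C / a)%C) 1); [lra| |].
    - intros t Ht; specialize (SEG t Ht); split; [|now apply RN].
      destruct (K _ SEG) as [D _].
      replace (df (z1 + RtoC t * dir)%C / a)%C with
        (/ (a * dir) * df (z1 + RtoC t * dir)%C * dir)%C by (field; auto).
      apply (Cderiv_line_Re (fun w => / (a * dir) * f w)%C).
      replace (/ (a * dir) * df (z1 + RtoC t * dir)%C)%C with
        (0 * f (z1 + RtoC t * dir)%C + / (a * dir) * df (z1 + RtoC t * dir)%C)%C by ring.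
      apply (Cderiv_mult (fun _ => / (a * dir))%C f); [apply Cderiv_const|exact D].
    - replace (z1 + RtoC 0 * dir)%C with z1 by ring. fold a.
      replace (a / a)%C with (RtoC 1) by (field; exact Ha). simpl; lra. }
  specialize (S w Hw); rewrite Cmod_mult in S.
  set (y := (df w / a)%C) in *.
  assert (Y : 1 <= Cmod (y + 1)).
  { pose proof (re_le_Cmod (y + 1)) as B. replace (Re (y + 1)) with (Re y + 1) in B by re_im_ring.
    rewrite Rabs_pos_eq in B; lra. }
  replace (df w - a)%C with ((y - 1) * a)%C by (unfold y; field; exact Ha).
  rewrite Cmod_mult. pose proof (Cmod_ge_0 (y - 1)).
  assert (Cmod (y - 1) < eta) by nra. nra.
Qed.

Lemma near_C_near (z : C) (P : C -> Prop) : near_C z P -> near_C z (fun w => near_C w P).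
Proof.
  intros [d [Hd H]]; exists (d / 2); split; [lra|]; intros w Hw.
  exists (d / 2); split; [lra|]; intros v Hv; apply H.
  replace (v - z)%C with ((v - w) + (w - z))%C by ring.
  eapply Rle_lt_trans; [apply Cmod_triangle|lra].
Qed.

Lemma near_C_neq (z a : C) : z <> a -> near_C z (fun w => w <> a).
Proof.
  intros H; exists (Cmod (z - a)); split; [apply Cmod_gt_0; now apply Cminus_eq_contra|].
  intros w Hw ->. rewrite <- Cmod_opp in Hw. replace (- (a - z))%C with (z - a)%C in Hw by ring. lra.
Qed.

Lemma Ccont_near_neq (f : C -> C) (z a : C) : Ccont f z -> f z <> a -> near_C z (fun w => f w <> a).
Proof.
  intros H N; destruct (near_C_neq _ _ N) as [d [Hd K]].
  generalize (H d Hd); apply filter_imp; auto.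
Qed.

(** [edge_height s z r] is the real part of 2 log (z + r) - s r, the genus 0
    h-function with r in place of (z^2 - 1)^(1/2). *)
Definition edge_height (s z r : C) : R := 2 * ln (Cmod (z + r)) - Re (s * r).

Section Branch.
Variables (s : C) (h dh : C -> C).

(** The branch r of (z^2 - 1)^(1/2) for which h' = (2 - s z) / r. *)
Definition branch (z : C) : C := ((2 - s * z) / dh z)%C.

Definition regular_at (w : C) : Prop :=
  Cderiv h w (dh w) /\ (dh w * dh w * (w * w - 1) = (2 - s * w) * (2 - s * w))%C /\
  (w * w - 1)%C <> RtoC 0 /\ (2 - s * w)%C <> RtoC 0.

Lemma regular_dh_neq0 (w : C) : regular_at w -> dh w <> RtoC 0.
Proof.
  intros [_ [E [N1 N2]]] Z; rewrite Z in E.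
  apply (Cmult_neq_0 _ _ N2 N2). rewrite <- E; ring.
Qed.

Lemma branch_square (w : C) : regular_at w -> (branch w * branch w = w * w - 1)%C.
Proof.
  intros R; pose proof (regular_dh_neq0 w R) as Z; destruct R as [_ [E _]].
  unfold branch. transitivity ((2 - s * w) * (2 - s * w) / (dh w * dh w))%C; [field; exact Z|].
  rewrite <- E; field; exact Z.
Qed.

(** The branch is continuous because h' is, and a continuous root of z^2 - 1
    has derivative z / r. *)
Lemma branch_derive (w : C) : near_C w regular_at -> Cderiv branch w (w / branch w).
Proof.
  intros R; pose proof (near_C_here _ _ R) as R0.
  pose proof (regular_dh_neq0 w R0) as Z.
  assert (CD : Ccont dh w).
  { apply (derivative_continuous_of_square h).
    - generalize R; apply filter_imp; intros v [D _]; exact D.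
    - destruct R0 as [_ [E [N1 N2]]].
      assert (K : Clim (near_C w) (fun v => (2 - s * v) * (2 - s * v) / (v * v - 1))%C
        ((2 - s * w) * (2 - s * w) / (w * w - 1))%C).
      { assert (C1 : Clim (near_C w) (fun v => 2 - s * v)%C (2 - s * w)%C).
        { apply Clim_minus; [apply Clim_const|apply Clim_mult; [apply Clim_const|apply Ccont_id]]. }
        apply Clim_div; [exact N1|now apply Clim_mult|].
        apply Clim_minus; [apply Clim_mult; apply Ccont_id|apply Clim_const]. }
      replace ((2 - s * w) * (2 - s * w) / (w * w - 1))%C with (dh w * dh w)%C in K
        by (rewrite <- E; field; exact N1).
      revert K; apply Clim_ext_loc.
      generalize R; apply filter_imp; intros v [_ [E' [N1' _]]].
      rewrite <- E'; field; exact N1'.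
    - exact Z. }
  assert (B0 : branch w <> RtoC 0).
  { intros B; apply branch_square in R0 as E; rewrite B in E.
    destruct R0 as [_ [_ [N1 _]]]; apply N1; rewrite <- E; ring. }
  replace (w / branch w)%C with ((w + w) / (2 * branch w))%C
    by (field; exact B0).
  apply Cderiv_of_square; [exact B0| |].
  - apply Clim_div; [exact Z| |exact CD].
    apply Clim_minus; [apply Clim_const|apply Clim_mult; [apply Clim_const|apply Ccont_id]].
  - apply (Cderiv_ext_loc (fun v => v * v - 1)%C).
    + generalize R; apply filter_imp; intros v Rv; symmetry; now apply branch_square.
    + replace (w + w)%C with (1 * w + w * 1 - 0)%C by ring.
      apply Cderiv_minus; [apply Cderiv_mult; apply Cderiv_id|apply Cderiv_const].
Qed.

(** Off the arcs h and 2 log (z + r) - s r have the same derivative, hence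
    the difference of their real parts is locally constant. *)
Lemma defect_locally_constant (z1 : C) : near_C z1 regular_at ->
  near_C z1 (fun w => Re (h w) - edge_height s w (branch w) =
    Re (h z1) - edge_height s z1 (branch z1)).
Proof.
  intros R; destruct (near_C_near _ _ R) as [d [Hd K]].
  exists d; split; [exact Hd|]; intros w Hw.
  set (dir := (w - z1)%C).
  assert (SEG : forall t, 0 <= t <= 1 -> Cmod (z1 + RtoC t * dir - z1) < d).
  { intros t Ht. replace (z1 + RtoC t * dir - z1)%C with (RtoC t * dir)%C by ring.
    rewrite Cmod_mult, Cmod_R, Rabs_pos_eq by lra. unfold dir; pose proof (Cmod_ge_0 (w - z1)); nra. }
  set (F := fun t => Re (h (z1 + RtoC t * dir)%C) -
    edge_height s (z1 + RtoC t * dir) (branch (z1 + RtoC t * dir)%C)).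
  assert (D : forall t, 0 <= t <= 1 -> is_derive F t 0).
  { intros t Ht; specialize (K _ (SEG t Ht)); pose proof (near_C_here _ _ K) as R0.
    pose proof (branch_derive _ K) as DB.
    set (v := (z1 + RtoC t * dir)%C) in *.
    pose proof (branch_square v R0) as SQ.
    assert (B0 : branch v <> RtoC 0).
    { intros B; rewrite B in SQ.
      destruct R0 as [_ [_ [N1 _]]]; apply N1; rewrite <- SQ; ring. }
    assert (V0 : (v + branch v)%C <> RtoC 0).
    { intros V. apply C1_nz. replace (RtoC 1) with ((v + branch v) * (v - branch v))%C.
      - rewrite V; ring.
      - transitivity (v * v - branch v * branch v)%C; [ring|rewrite SQ; ring]. }
    destruct R0 as [Dh _].
    assert (D1 : is_derive (fun t => Re (h (z1 + RtoC t * dir)%C)) t (Re (dh v * dir)))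
      by (now apply Cderiv_line_Re).
    assert (D2 : is_derive (fun t => ln (Cmod ((z1 + RtoC t * dir) + branch (z1 + RtoC t * dir)%C))) t
      (Re ((1 + v / branch v) * dir / (v + branch v)))).
    { apply (Cderiv_line_ln_Cmod (fun w => w + branch w)%C); [exact V0|].
      apply Cderiv_plus; [apply Cderiv_id|exact DB]. }
    assert (D3 : is_derive (fun t => Re (s * branch (z1 + RtoC t * dir)%C)%C) t
      (Re ((0 * branch v + s * (v / branch v)) * dir))).
    { apply (Cderiv_line_Re (fun w => s * branch w)%C).
      apply (Cderiv_mult (fun _ => s) branch); [apply Cderiv_const|exact DB]. }
    assert (Z : Re (dh v * dir) - (2 * Re ((1 + v / branch v) * dir / (v + branch v)) -
      Re ((0 * branch v + s * (v / branch v)) * dir)) = 0).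
    { assert (HB : (dh v = (2 - s * v) / branch v)%C).
      { unfold branch. destruct (near_C_here _ _ K) as [_ [E [N1 N2]]].
        pose proof (regular_dh_neq0 v (near_C_here _ _ K)); field; auto. }
      rewrite HB.
      replace ((1 + v / branch v) * dir / (v + branch v))%C with (dir / branch v)%C
        by (field; auto).
      replace ((2 - s * v) / branch v * dir)%C with
        (dir / branch v + dir / branch v - (0 * branch v + s * (v / branch v)) * dir)%C
        by (field; auto).
      unfold Re; simpl; ring. }
    rewrite <- Z.
    apply (is_derive_minus (V := R_NormedModule)); [exact D1|].
    apply (is_derive_minus (V := R_NormedModule)); [|exact D3].
    apply (is_derive_scal (fun t => ln (Cmod ((z1 + RtoC t * dir) + branch (z1 + RtoC t * dir)%C)))).
    exact D2. }
  destruct (MVT_gen F 0 1 (fun _ => 0)) as [c [_ E]].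
  { rewrite Rmin_left, Rmax_right by lra; intros x Hx; apply D; lra. }
  { rewrite Rmin_left, Rmax_right by lra; intros x Hx;
    apply (is_derive_continuity_pt _ _ 0), D, Hx. }
  unfold F in E.
  replace (z1 + RtoC 1 * dir)%C with w in E by (unfold dir; ring).
  replace (z1 + RtoC 0 * dir)%C with z1 in E by ring. lra.
Qed.

End Branch.

(** * The height as a function of the point alone *)

Lemma edge_height_opp (s z r : C) : (r * r = z * z - 1)%C ->
  edge_height s z (- r) = - edge_height s z r.
Proof.
  intros E; unfold edge_height.
  assert (P : ((z + r) * (z + - r) = 1)%C).
  { transitivity (z * z - r * r)%C; [ring|rewrite E; ring]. }
  assert (N1 : 0 < Cmod (z + r)).
  { apply Cmod_gt_0; intros Z; rewrite Z in P; apply C1_nz; rewrite <- P; ring. }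
  assert (N2 : 0 < Cmod (z + - r)).
  { apply Cmod_gt_0; intros Z; rewrite Z in P; apply C1_nz; rewrite <- P; ring. }
  assert (Q : ln (Cmod (z + r)) + ln (Cmod (z + - r)) = 0).
  { rewrite <- ln_mult by assumption. rewrite <- Cmod_mult, P, Cmod_1; apply ln_1. }
  replace (Re (s * - r)) with (- Re (s * r)) by re_im_ring. lra.
Qed.

(** The height is odd in r, and the two roots of r^2 = z^2 - 1 depend
    continuously on z as an unordered pair: |r - r0| |r + r0| = |r^2 - r0^2|.
    So the absolute value of the height is continuous in (s, z), also where
    the roots collide. *)
Lemma edge_height_continuous (s0 z0 r0 : C) (eps : R) :
  (r0 * r0 = z0 * z0 - 1)%C -> 0 < eps ->
  exists delta, 0 < delta /\ forall s z r, Cmod (s - s0) < delta -> Cmod (z - z0) < delta ->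
    (r * r = z * z - 1)%C ->
    Rabs (Rabs (edge_height s z r) - Rabs (edge_height s0 z0 r0)) < eps.
Proof.
  intros E0 Heps.
  set (FF := filter_prod (near_C s0) (filter_prod (near_C z0) (near_C r0))).
  assert (L1 : Clim FF (fun p => fst p) s0).
  { intros e He; apply (Filter_prod _ _ _ (fun x => Cmod (x - s0) < e) (fun _ => True)).
    - exists e; auto.
    - apply filter_true.
    - auto. }
  assert (L2 : Clim FF (fun p => fst (snd p)) z0).
  { intros e He; apply (Filter_prod _ _ _ (fun _ => True) (fun q => Cmod (fst q - z0) < e)).
    - apply filter_true.
    - apply (Filter_prod _ _ _ (fun x => Cmod (x - z0) < e) (fun _ => True)); [exists e; auto|apply filter_true|auto].
    - auto. }
  assert (L3 : Clim FF (fun p => snd (snd p)) r0).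
  { intros e He; apply (Filter_prod _ _ _ (fun _ => True) (fun q => Cmod (snd q - r0) < e)).
    - apply filter_true.
    - apply (Filter_prod _ _ _ (fun _ => True) (fun x => Cmod (x - r0) < e)); [apply filter_true|exists e; auto|auto].
    - auto. }
  assert (V0 : 0 < Cmod (z0 + r0)).
  { apply Cmod_gt_0; intros Z. apply C1_nz.
    transitivity ((z0 + r0) * (z0 - r0))%C; [|rewrite Z; ring].
    transitivity (z0 * z0 - r0 * r0)%C; [rewrite E0; ring|ring]. }
  assert (LN : filterlim (fun p => edge_height (fst p) (fst (snd p)) (snd (snd p))) FF
    (locally (edge_height s0 z0 r0))).
  { unfold edge_height.
    apply (filterlim_comp_2 (G := locally (2 * ln (Cmod (z0 + r0)))) (H := locally (- Re (s0 * r0)))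
      (fun p => 2 * ln (Cmod (fst (snd p) + snd (snd p)))) (fun p => - Re (fst p * snd (snd p))%C) Rplus).
    - apply (filterlim_comp _ _ _ (fun p => Cmod (fst (snd p) + snd (snd p)))
        (fun x => 2 * ln x) _ (locally (Cmod (z0 + r0)))).
      + now apply Clim_Cmod, Clim_plus.
      + apply (ex_derive_continuous (fun x => 2 * ln x)). auto_derive; exact V0.
    - apply (filterlim_comp _ _ _ (fun p => Re (fst p * snd (snd p))%C) Ropp _ (locally (Re (s0 * r0)))).
      + now apply Clim_Re, Clim_mult.
      + apply (filterlim_opp (Re (s0 * r0))).
    - apply (filterlim_plus (2 * ln (Cmod (z0 + r0))) (- Re (s0 * r0))). }
  assert (LE : FF (fun p => Rabs (edge_height (fst p) (fst (snd p)) (snd (snd p)) - edge_height s0 z0 r0) < eps)).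
  { apply (LN (fun y => Rabs (y - edge_height s0 z0 r0) < eps)).
    exists (mkposreal eps Heps); intros y Hy; exact Hy. }
  destruct LE as [Q1 Q [d1 [Hd1 H1]] [Q2 Q3 [d2 [Hd2 H2]] [d3 [Hd3 H3]] HQ] HP].
  assert (CZ : Clim (near_C z0) (fun z => z * z)%C (z0 * z0)%C) by (apply Clim_mult; apply Ccont_id).
  assert (Hd33 : 0 < d3 * d3) by nra.
  destruct (CZ _ Hd33) as [d4 [Hd4 H4]].
  exists (Rmin d1 (Rmin d2 d4)); split; [repeat apply Rmin_pos; assumption|].
  intros s z r [B1 _]%Rmin_lt [_ [B2 B4]%Rmin_lt]%Rmin_lt Er.
  assert (K : forall r', Cmod (r' - r0) < d3 -> Rabs (edge_height s z r' - edge_height s0 z0 r0) < eps).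
  { intros r' Hr'. apply (HP s (z, r')); [now apply H1|apply HQ; [now apply H2|now apply H3]]. }
  assert (TR : forall x y, Rabs (x - y) < eps -> Rabs (Rabs x - Rabs y) < eps).
  { intros x y Hxy; eapply Rle_lt_trans; [apply Rabs_triang_inv2|exact Hxy]. }
  specialize (H4 z B4).
  replace (z * z - z0 * z0)%C with ((r - r0) * (r + r0))%C in H4
    by (transitivity (r * r - r0 * r0)%C; [ring|rewrite Er, E0; ring]).
  rewrite Cmod_mult in H4.
  destruct (Rlt_dec (Cmod (r - r0)) d3) as [Hn|Hf].
  - apply TR, K, Hn.
  - rewrite <- (Rabs_Ropp (edge_height s z r)), <- edge_height_opp by exact Er.
    apply TR, K. replace (- r - r0)%C with (- (r + r0))%C by ring. rewrite Cmod_opp.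
    apply Rnot_lt_le in Hf; pose proof (Cmod_ge_0 (r + r0)). nra.
Qed.

Lemma Csqrt_exists (w : C) : exists r, (r * r = w)%C.
Proof.
  destruct w as [a b].
  set (m := sqrt (a * a + b * b)).
  assert (M2 : m * m = a * a + b * b) by (apply sqrt_sqrt; nra).
  assert (M0 : 0 <= m) by apply sqrt_pos.
  assert (Ma : 0 <= m + a /\ 0 <= m - a) by (split; nra).
  set (x := sqrt ((m + a) / 2)). set (y := sqrt ((m - a) / 2)).
  assert (X : x * x = (m + a) / 2) by (apply sqrt_sqrt; lra).
  assert (Y : y * y = (m - a) / 2) by (apply sqrt_sqrt; lra).
  assert (0 <= x) by apply sqrt_pos. assert (0 <= y) by apply sqrt_pos.
  assert (XY : (2 * (x * y)) * (2 * (x * y)) = b * b).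
  { replace (2 * (x * y) * (2 * (x * y))) with (4 * (x * x) * (y * y)) by ring.
    rewrite X, Y; nra. }
  assert (P : 0 <= 2 * (x * y)) by nra.
  destruct (Rle_dec 0 b).
  - exists (x, y); unfold Cmult; simpl; f_equal; [lra|].
    assert (2 * (x * y) = b) by (apply Rsqr_inj; [exact P|lra|exact XY]). lra.
  - exists (x, - y); unfold Cmult; simpl; f_equal; [lra|].
    assert (2 * (x * y) = - b) by (apply Rsqr_inj; [exact P|lra|unfold Rsqr; lra]). lra.
Qed.

(** * Transport along the side of an arc *)

Lemma collar_close (g dg : R -> C) (t eps : R) :
  path_continuous g t ->
  path_continuous dg t -> 0 < eps ->
  exists delta, 0 < delta /\ forall u e, Rabs (u - t) < delta -> 0 < e < delta ->
    Cmod (collar g dg u e - g t) < eps.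
Proof.
  intros Cg Cd He; assert (He2 : 0 < eps / 2) by lra.
  destruct (proj1 (continuous_C_eps _ t) Cg _ He2) as [d1 [Hd1 H1]].
  destruct (proj1 (continuous_C_eps _ t) Cd _ Rlt_0_1) as [d2 [Hd2 H2]].
  set (D := Cmod (dg t) + 1).
  assert (HD : 0 < D) by (pose proof (Cmod_ge_0 (dg t)); unfold D; lra).
  exists (Rmin (Rmin d1 d2) (eps / 2 / D)).
  split; [repeat apply Rmin_pos; try lra; apply Rdiv_lt_0_compat; lra|].
  intros u e [[U1 U2]%Rmin_lt _]%Rmin_lt [E0 [_ E5]%Rmin_lt].
  unfold collar; replace (g u + Ci * RtoC e * dg u - g t)%C with
    ((g u - g t) + Ci * RtoC e * dg u)%C by ring.
  eapply Rle_lt_trans; [apply Cmod_triangle|].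
  rewrite !Cmod_mult, Cmod_Ci, Cmod_R, (Rabs_pos_eq e) by lra.
  specialize (H1 u U1).
  assert (Cmod (dg u) <= D).
  { specialize (H2 u U2). pose proof (Cmod_triangle (dg u - dg t) (dg t)) as T.
    replace (dg u - dg t + dg t)%C with (dg u) in T by ring. unfold D; lra. }
  assert (e * D < eps / 2).
  { replace (eps / 2) with (eps / 2 / D * D) by (field; lra). apply Rmult_lt_compat_r; lra. }
  assert (e * Cmod (dg u) <= e * D) by (apply Rmult_le_compat_l; lra). lra.
Qed.

Lemma collar_continuous_l (g dg : R -> C) (u e : R) :
  path_continuous g u ->
  path_continuous dg u ->
  Clim (locally u) (fun v => collar g dg v e) (collar g dg u e).
Proof.
  intros Cg Cd; unfold collar.
  apply Clim_plus; [now apply Clim_filterlim; [apply locally_filter|]|].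
  apply Clim_mult; [apply Clim_const|now apply Clim_filterlim; [apply locally_filter|]].
Qed.

Lemma collar_continuous_r (g dg : R -> C) (u e : R) :
  Clim (locally e) (fun v => collar g dg u v) (collar g dg u e).
Proof.
  unfold collar. apply Clim_plus; [apply Clim_const|].
  apply Clim_mult; [|apply Clim_const]. apply Clim_mult; [apply Clim_const|].
  apply Clim_RtoC, filterlim_id.
Qed.

Lemma open_interval_locally (a b x : R) : a < x < b -> locally x (fun y => a < y < b).
Proof.
  intros [H1 H2]; apply filter_and; [now apply (open_gt a)|now apply (open_lt b)].
Qed.

Section Transport.
Context {L : nat} (G : contour L) (s : C) (h : C -> C).

Hypothesis regular_off : forall w, ~ Omega G w -> (2 - s * w)%C <> RtoC 0 ->
  regular_at s h (C_derive h) w.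

Let defect (z : C) : R := Re (h z) - edge_height s z (branch s (C_derive h) z).

Lemma regular_near (w : C) : ~ Omega G w -> (2 - s * w)%C <> RtoC 0 ->
  near_C w (regular_at s h (C_derive h)).
Proof.
  intros H1 H2.
  assert (K : near_C w (fun v => (2 - s * v)%C <> RtoC 0)).
  { apply (Ccont_near_neq (fun v => 2 - s * v)%C); [|exact H2].
    apply Clim_minus; [apply Clim_const|apply Clim_mult; [apply Clim_const|apply Ccont_id]]. }
  generalize (filter_and _ _ (Omega_closed G w H1) K); apply filter_imp; intros v [V1 V2]; auto.
Qed.

Variables (g dg : R -> C) (t1 t2 : R).
Hypothesis g_cont : forall t, t1 < t < t2 -> path_continuous g t.
Hypothesis dg_cont : forall t, t1 < t < t2 -> path_continuous dg t.
Hypothesis collar_off : forall t, t1 < t < t2 -> exists delta, 0 < delta /\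
  forall u e, Rabs (u - t) < delta -> 0 < e < delta -> ~ Omega G (collar g dg u e).
Hypothesis no_saddle : forall t, t1 < t < t2 -> (2 - s * g t)%C <> RtoC 0.

(** Points of the parameter rectangle are joined by a horizontal and a
    vertical segment, along which the defect is locally constant. *)
Lemma defect_on_collar (t : R) : t1 < t < t2 ->
  exists delta k, 0 < delta /\ forall u e, Rabs (u - t) < delta -> 0 < e < delta ->
    defect (collar g dg u e) = k.
Proof.
  intros Ht; destruct (collar_off t Ht) as [d1 [Hd1 H1]].
  destruct (Ccont_near_neq (fun v => 2 - s * v)%C (g t) 0) as [d2 [Hd2 H2]].
  { apply Clim_minus; [apply Clim_const|apply Clim_mult; [apply Clim_const|apply Ccont_id]]. }
  { now apply no_saddle. }
  destruct (collar_close g dg t d2 (g_cont t Ht) (dg_cont t Ht) Hd2) as [d3 [Hd3 H3]].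
  set (d := Rmin (Rmin d1 d3) (Rmin (t - t1) (t2 - t))).
  assert (Hd : 0 < d) by (repeat apply Rmin_pos; lra).
  assert (D1 : d <= d1) by (eapply Rle_trans; [apply Rmin_l|apply Rmin_l]).
  assert (D3 : d <= d3) by (eapply Rle_trans; [apply Rmin_l|apply Rmin_r]).
  assert (D4 : d <= t - t1) by (eapply Rle_trans; [apply Rmin_r|apply Rmin_l]).
  assert (D5 : d <= t2 - t) by (eapply Rle_trans; [apply Rmin_r|apply Rmin_r]).
  assert (LC : forall u e, t - d < u < t + d -> 0 < e < d ->
    near_C (collar g dg u e) (fun w => defect w = defect (collar g dg u e))).
  { intros u e Hu He. assert (U : Rabs (u - t) < d) by (apply Rabs_def1; lra).
    apply defect_locally_constant, regular_near.
    - apply H1; lra.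
    - apply H2, H3; lra. }
  assert (K1 : forall e, 0 < e < d -> forall u v, t - d < u < t + d -> t - d < v < t + d ->
    defect (collar g dg u e) = defect (collar g dg v e)).
  { intros e He.
    apply (locally_constant_on_interval (fun u => defect (collar g dg u e))); intros u Hu.
    destruct (LC u e Hu He) as [r [Hr K]].
    generalize (collar_continuous_l g dg u e (g_cont u ltac:(lra)) (dg_cont u ltac:(lra)) r Hr).
    apply filter_imp; intros v; apply K. }
  assert (K2 : forall u, t - d < u < t + d -> forall e f, 0 < e < d -> 0 < f < d ->
    defect (collar g dg u e) = defect (collar g dg u f)).
  { intros u Hu.
    apply (locally_constant_on_interval (fun e => defect (collar g dg u e))); intros e He.
    destruct (LC u e Hu He) as [r [Hr K]].
    generalize (collar_continuous_r g dg u e r Hr).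
    apply filter_imp; intros v; apply K. }
  exists d, (defect (collar g dg t (d / 2))); split; [exact Hd|]; intros u e Hu He.
  apply Rabs_def2 in Hu.
  rewrite (K1 e He u t) by lra. apply K2; lra.
Qed.

Lemma defect_on_side : exists k, forall t, t1 < t < t2 ->
  exists delta, 0 < delta /\ forall e, 0 < e < delta -> defect (collar g dg t e) = k.
Proof.
  (* [K t] reads off the constant value of the defect over t; as a limit it is
     a function of t alone, and it is again locally constant. *)
  set (K := fun t => real (Lim_seq (fun n => defect (collar g dg t (/ (INR n + 1)))))).
  assert (KE : forall t k delta, 0 < delta ->
    (forall e, 0 < e < delta -> defect (collar g dg t e) = k) -> K t = k).
  { intros t k delta Hd H; unfold K.
    rewrite (Lim_seq_ext_loc _ (fun _ => k)); [now rewrite Lim_seq_const|].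
    assert (Z : is_lim_seq (fun n => / (INR n + 1)) 0).
    { apply (is_lim_seq_inv (fun n => INR n + 1) p_infty); [|easy].
      apply (is_lim_seq_plus _ _ p_infty 1); [apply is_lim_seq_INR|apply is_lim_seq_const|reflexivity]. }
    assert (Z' : eventually (fun n => / (INR n + 1) < delta)) by (apply (Z (fun y => y < delta)), (open_lt delta), Hd).
    generalize Z'; apply filter_imp; intros n Hn; apply H; split; [|exact Hn].
    apply Rinv_0_lt_compat; pose proof (pos_INR n); lra. }
  destruct (Rlt_dec t1 t2) as [H12|H12].
  2: { exists 0; intros t Ht; lra. }
  exists (K ((t1 + t2) / 2)); intros t Ht.
  destruct (defect_on_collar t Ht) as [d [k [Hd H]]].
  exists d; split; [exact Hd|]; intros e He.
  rewrite (H t e) by (try rewrite Rminus_diag, Rabs_R0; lra).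
  rewrite <- (KE t k d Hd).
  2: { intros f Hf; apply H; [rewrite Rminus_diag, Rabs_R0; exact Hd|exact Hf]. }
  apply (locally_constant_on_interval K t1 t2); [|exact Ht|lra].
  clear t Ht d k Hd H e He; intros t Ht.
  destruct (defect_on_collar t Ht) as [d [k [Hd H]]].
  exists (mkposreal d Hd); intros u Hu. change (Rabs (u - t) < d) in Hu.
  rewrite (KE t k d Hd), (KE u k d Hd); [reflexivity| |]; intros f Hf; apply H; try assumption.
  rewrite Rminus_diag, Rabs_R0; exact Hd.
Qed.

(** Where Re h tends to 0, the constant defect is minus the limit of the
    height. *)
Lemma side_approach (k : R) (z1 r1 : C) :
  (forall t, t1 < t < t2 ->
    exists delta, 0 < delta /\ forall e, 0 < e < delta -> defect (collar g dg t e) = k) ->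
  (forall eps, 0 < eps -> exists t, t1 < t < t2 /\ Cmod (g t - z1) < eps) ->
  (forall eps, 0 < eps -> off_Omega G z1 (fun z => Rabs (Re (h z)) < eps)) ->
  (r1 * r1 = z1 * z1 - 1)%C ->
  Rabs k = Rabs (edge_height s z1 r1).
Proof.
  intros Hk Hg Hh Hr.
  assert (A : forall eps, 0 < eps -> Rabs (Rabs k - Rabs (edge_height s z1 r1)) < 2 * eps).
  { intros eps Heps.
    destruct (edge_height_continuous s z1 r1 eps Hr Heps) as [d1 [Hd1 H1]].
    destruct (Hh eps Heps) as [d2 [Hd2 H2]].
    set (d := Rmin d1 d2).
    assert (Hd : 0 < d) by (now apply Rmin_pos).
    assert (D1 : d <= d1) by apply Rmin_l. assert (D2 : d <= d2) by apply Rmin_r.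
    destruct (Hg (d / 2)) as [t [Ht Gt]]; [lra|].
    destruct (Hk t Ht) as [d3 [Hd3 H3]].
    destruct (collar_off t Ht) as [d4 [Hd4 H4]].
    assert (Hdd : 0 < Rmin (d / 2) (Cmod (2 - s * g t) / (Cmod s + 1))).
    { apply Rmin_pos; [lra|]. apply Rdiv_lt_0_compat; [apply Cmod_gt_0; now apply no_saddle|].
      pose proof (Cmod_ge_0 s); lra. }
    destruct (collar_close g dg t _ (g_cont t Ht) (dg_cont t Ht) Hdd) as [d5 [Hd5 H5]].
    set (e := Rmin (Rmin d3 d4) d5 / 2).
    assert (He : 0 < Rmin (Rmin d3 d4) d5) by (repeat apply Rmin_pos; lra).
    assert (E3 : e < d3) by (pose proof (Rmin_l (Rmin d3 d4) d5); pose proof (Rmin_l d3 d4); unfold e; lra).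
    assert (E4 : e < d4) by (pose proof (Rmin_l (Rmin d3 d4) d5); pose proof (Rmin_r d3 d4); unfold e; lra).
    assert (E5 : e < d5) by (pose proof (Rmin_r (Rmin d3 d4) d5); unfold e; lra).
    assert (E0 : 0 < e) by (unfold e; lra).
    specialize (H3 e (conj E0 E3)).
    specialize (H4 t e ltac:(rewrite Rminus_diag, Rabs_R0; lra) (conj E0 E4)).
    specialize (H5 t e ltac:(rewrite Rminus_diag, Rabs_R0; lra) (conj E0 E5)).
    set (z := collar g dg t e) in *.
    assert (Z1 : Cmod (z - z1) < d).
    { replace (z - z1)%C with ((z - g t) + (g t - z1))%C by ring.
      eapply Rle_lt_trans; [apply Cmod_triangle|].
      pose proof (Rmin_l (d / 2) (Cmod (2 - s * g t) / (Cmod s + 1))). lra. }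
    assert (Z2 : (2 - s * z)%C <> RtoC 0).
    { intros E.
      assert (F : Cmod (2 - s * g t) = Cmod s * Cmod (z - g t)).
      { rewrite <- Cmod_mult. replace (2 - s * g t)%C with (2 - s * z + s * (z - g t))%C by ring.
        rewrite E; f_equal; ring. }
      pose proof (Rmin_r (d / 2) (Cmod (2 - s * g t) / (Cmod s + 1))) as M.
      pose proof (Cmod_ge_0 s) as S0. pose proof (Cmod_ge_0 (z - g t)) as S1.
      assert (Q : Cmod (z - g t) * (Cmod s + 1) < Cmod (2 - s * g t)).
      { replace (Cmod (2 - s * g t)) with (Cmod (2 - s * g t) / (Cmod s + 1) * (Cmod s + 1)) at 1
          by (field; lra).
        apply Rmult_lt_compat_r; lra. }
      nra. }
    pose proof (branch_square _ _ _ _ (regular_off z H4 Z2)) as SQ.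
    assert (SS : Cmod (s - s) < d1).
    { replace (s - s)%C with (RtoC 0) by ring; rewrite Cmod_0; exact Hd1. }
    specialize (H1 s z _ SS ltac:(lra) SQ).
    specialize (H2 z ltac:(lra) H4).
    unfold defect in H3; fold z in H3.
    set (N := edge_height s z (branch s (C_derive h) z)) in *.
    set (N1 := edge_height s z1 r1) in *. clearbody N N1.
    apply Rabs_def2 in H1; apply Rabs_def2 in H2. subst k.
    apply Rabs_def1; unfold Rabs in *;
    repeat match goal with |- context [Rcase_abs ?x] => destruct (Rcase_abs x)
      | H : context [Rcase_abs ?x] |- _ => destruct (Rcase_abs x) end; lra. }
  destruct (Req_dec (Rabs k) (Rabs (edge_height s z1 r1))) as [|N]; [assumption|exfalso].
  assert (P : 0 < Rabs (Rabs k - Rabs (edge_height s z1 r1))) by (apply Rabs_pos_lt; lra).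
  specialize (A (Rabs (Rabs k - Rabs (edge_height s z1 r1)) / 2)). lra.
Qed.

End Transport.

(** At a hard edge r = 0 and the height vanishes, so following one side of an
    arc from a hard edge to z0 transports the value of Re h. *)
Lemma edge_transport {L : nat} (G : contour L) (s : C) (h : C -> C) (g dg : R -> C) (t1 t2 : R)
  (e1 z0 r0 : C) :
  (forall w, ~ Omega G w -> (2 - s * w)%C <> RtoC 0 -> regular_at s h (C_derive h) w) ->
  (forall t, t1 < t < t2 -> path_continuous g t) ->
  (forall t, t1 < t < t2 -> path_continuous dg t) ->
  (forall t, t1 < t < t2 -> exists delta, 0 < delta /\
    forall u e, Rabs (u - t) < delta -> 0 < e < delta -> ~ Omega G (collar g dg u e)) ->
  (forall t, t1 < t < t2 -> (2 - s * g t)%C <> RtoC 0) ->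
  (e1 * e1 = 1)%C ->
  (forall eps, 0 < eps -> exists t, t1 < t < t2 /\ Cmod (g t - e1) < eps) ->
  (forall eps, 0 < eps -> off_Omega G e1 (fun z => Rabs (Re (h z)) < eps)) ->
  (forall eps, 0 < eps -> exists t, t1 < t < t2 /\ Cmod (g t - z0) < eps) ->
  (forall eps, 0 < eps -> off_Omega G z0 (fun z => Rabs (Re (h z)) < eps)) ->
  (r0 * r0 = z0 * z0 - 1)%C ->
  edge_height s z0 r0 = 0.
Proof.
  intros H1 H2 H3 H4 H5 He Ge Re1 G0 Re0 Hr.
  destruct (defect_on_side G s h H1 g dg t1 t2 H2 H3 H4 H5) as [k Hk].
  assert (Z : (0 * 0 = e1 * e1 - 1)%C) by (rewrite He; ring).
  pose proof (side_approach G s h H1 g dg t1 t2 H2 H3 H4 H5 k e1 0 Hk Ge Re1 Z) as A.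
  pose proof (side_approach G s h H1 g dg t1 t2 H2 H3 H4 H5 k z0 r0 Hk G0 Re0 Hr) as B.
  assert (E : edge_height s e1 0 = 0).
  { unfold edge_height. replace (e1 + 0)%C with e1 by ring.
    replace (Cmod e1) with 1.
    - rewrite ln_1. replace (s * 0)%C with (RtoC 0) by ring. simpl; ring.
    - assert (M : Cmod e1 * Cmod e1 = 1) by (rewrite <- Cmod_mult, He; apply Cmod_1).
      pose proof (Cmod_ge_0 e1); nra. }
  rewrite E, Rabs_R0 in A. rewrite A in B.
  destruct (Req_dec (edge_height s z0 r0) 0) as [|N]; [assumption|].
  apply Rabs_pos_lt in N; lra.
Qed.

(** * Saddle points of h-functions *)

Lemma Cpoly_0 (a : nat -> C) (z : C) : Cpoly a 0 z = a 0%nat.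
Proof. unfold Cpoly; rewrite sum_O; simpl; ring. Qed.

Lemma Cpoly_1 (a : nat -> C) (z : C) : Cpoly a 1 z = (a 0%nat + a 1%nat * z)%C.
Proof.
  unfold Cpoly; rewrite sum_Sn, sum_O.
  change (a 0%nat * z ^ 0 + a 1%nat * z ^ 1 = a 0%nat + a 1%nat * z)%C.
  rewrite Cpow_1_r; simpl; ring.
Qed.

Lemma RtoC_m1 : RtoC (-1) = (- (1))%C.
Proof. now rewrite <- RtoC_opp. Qed.

Lemma RtoC_2 : RtoC 2 = (1 + 1)%C.
Proof. rewrite <- RtoC_plus; f_equal; lra. Qed.

Lemma Cpow_2 (z : C) : (z ^ 2 = z * z)%C.
Proof. simpl; ring. Qed.

Section Endpoints.
Context {L : nat} (G : contour L).

Lemma Omega_sg (t : R) : 0 <= t <= 1 -> Omega G (sg G t).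
Proof. intros Ht; right; exists t; auto. Qed.

Lemma Omega_1 : Omega G 1.
Proof. rewrite <- (sg_last L G); apply Omega_sg; lra. Qed.

Lemma Omega_m1 : Omega G (RtoC (-1)).
Proof. rewrite <- (sg_first L G); apply Omega_sg; lra. Qed.

Lemma off_Omega_edges (z : C) : ~ Omega G z -> (z * z - 1)%C <> RtoC 0.
Proof.
  intros H E. assert (F : ((z - 1) * (z + 1))%C = RtoC 0) by (rewrite <- E; ring).
  destruct (Ceq_dec (z - 1) 0) as [Z|Z].
  - apply H. replace z with (RtoC 1); [apply Omega_1|].
    replace z with ((z - 1) + 1)%C by ring; rewrite Z; ring.
  - destruct (Ceq_dec (z + 1) 0) as [Z'|Z']; [|now apply (Cmult_neq_0 _ _ Z Z')].
    apply H. replace z with (RtoC (-1)); [apply Omega_m1|].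
    replace z with ((z + 1) - 1)%C by ring; rewrite Z'.
    rewrite RtoC_m1; ring.
Qed.

Lemma branch_point_edges (z : C) : L = 0%nat -> branch_point G z -> z = RtoC 1 \/ z = RtoC (-1).
Proof.
  intros -> [k [Hk ->]]. destruct k as [|[|k]]; [| |lia].
  - right; rewrite brk_first; apply sg_first.
  - left. rewrite <- (sg_last 0 G). f_equal. apply (brk_last 0 G).
Qed.

Lemma edges_branch_point (z : C) : z = RtoC 1 \/ z = RtoC (-1) -> branch_point G z.
Proof.
  intros [->| ->].
  - exists (2 * L + 1)%nat; split; [lia|]. now rewrite brk_last, sg_last.
  - exists 0%nat; split; [lia|]. now rewrite brk_first, sg_first.
Qed.

Lemma off_Omega_neq (z0 : C) : Omega G z0 -> off_Omega G z0 (fun z => z <> z0).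
Proof. intros H; exists 1; split; [lra|]; intros w _ Hw ->; auto. Qed.

Lemma Ccont_pair_unique (f g : C -> C) (z0 : C) : Omega G z0 -> Ccont f z0 -> Ccont g z0 ->
  off_Omega G z0 (fun z => f z = g z) -> f z0 = g z0.
Proof.
  intros HO Hf Hg E.
  pose proof (off_Omega_proper G z0 HO) as PF.
  apply (Clim_unique (F := off_Omega G z0) f).
  - now apply Ccont_off_Omega.
  - apply (Clim_ext_loc g); [|now apply Ccont_off_Omega].
    generalize E; apply filter_imp; auto.
Qed.

End Endpoints.

Lemma Ccont_shift_pow (z0 : C) (k : nat) (z : C) : Ccont (fun z => (z - z0) ^ k)%C z.
Proof. apply Clim_pow, Clim_minus; [apply Ccont_id|apply Clim_const]. Qed.

Lemma shift_pow_S (z0 : C) (k : nat) : ((z0 - z0) ^ S k = 0)%C.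
Proof. rewrite Cpow_S; ring. Qed.

Lemma Ccont_affine (a b z : C) : Ccont (fun z => a + b * z)%C z.
Proof. apply Clim_plus; [apply Clim_const|apply Clim_mult; [apply Clim_const|apply Ccont_id]]. Qed.

Lemma holomorphic_near_Ccont (g : C -> C) (z0 : C) (r : R) : 0 < r ->
  (forall z, Cmod (z - z0) < r -> holomorphic_at g z) -> Ccont g z0.
Proof.
  intros Hr H; eapply Cderiv_Ccont, holomorphic_Cderiv, H.
  replace (z0 - z0)%C with (RtoC 0) by ring; now rewrite Cmod_0.
Qed.

Lemma near_ball (z0 : C) (r : R) (P : C -> Prop) : 0 < r ->
  (forall z, Cmod (z - z0) < r -> P z) -> near_C z0 P.
Proof. intros Hr H; exists r; auto. Qed.

Lemma Cmult_eq_l (a b c : C) : a <> RtoC 0 -> (a * b = a * c)%C -> b = c.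
Proof.
  intros Ha E. replace b with (/ a * (a * b))%C by (field; exact Ha).
  rewrite E; field; exact Ha.
Qed.

Lemma genus0_derive_square (G : contour 0) (h : C -> C) (P : nat -> C) :
  (forall z, ~ Omega G z -> (C_derive h z ^ 2 =
      Cpoly P (1 - 0) z ^ 2 / (z ^ 2 - 1) * Cprod (fun j => z - lambda G j) (2 * 0))%C) ->
  forall z, ~ Omega G z ->
  (C_derive h z * C_derive h z * (z * z - 1) = (P 0%nat + P 1%nat * z) * (P 0%nat + P 1%nat * z))%C.
Proof.
  intros H z Hz; specialize (H z Hz); rewrite !Cpow_2 in H; simpl (1 - 0)%nat in H.
  rewrite Cpoly_1 in H; rewrite H; simpl. field. now apply (off_Omega_edges G).
Qed.

(** After division by the generic factor (z - z0)^(-1) at an edge, and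
    directly elsewhere, the order of the saddle point appears as a power of z
    - z0 dividing the square of the linear factor of h'. *)
Lemma genus0_saddle_factor (G : contour 0) (h : C -> C) (p0 p1 z0 : C) (k : nat) :
  (forall z, ~ Omega G z ->
    (C_derive h z * C_derive h z * (z * z - 1) = (p0 + p1 * z) * (p0 + p1 * z))%C) ->
  Omega G z0 -> derive_zero_order G h z0 k ->
  exists g, Ccont g z0 /\ g z0 <> RtoC 0 /\
    off_Omega G z0 (fun z => ((p0 + p1 * z) * (p0 + p1 * z) = ((z - z0) ^ k) * ((z - z0) ^ k) * g z)%C).
Proof.
  intros HQ HO [r [g [Hr [Hg [G0 HZ]]]]].
  pose proof (holomorphic_near_Ccont g z0 r Hr Hg) as Cg.
  destruct (Ceq_dec z0 1) as [E1|N1]; [|destruct (Ceq_dec z0 (RtoC (-1))) as [E2|N2]].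
  - exists (fun z => (z + 1) * g z)%C; split; [|split].
    + apply Clim_mult; [apply Clim_plus; [apply Ccont_id|apply Clim_const]|exact Cg].
    + apply Cmult_neq_0; [|exact G0]. rewrite E1, <- RtoC_plus; RtoC_neq.
    + apply (near_ball z0 r); [exact Hr|]; intros z Hz Oz.
      destruct (HZ z Hz Oz) as [_ [H _]]; specialize (H (or_introl E1)).
      rewrite !Cpow_2 in H. rewrite E1 in H at 1.
      rewrite <- HQ by exact Oz.
      transitivity ((z + 1) * (C_derive h z * C_derive h z * (z - 1)))%C; [ring|rewrite H; ring].
  - exists (fun z => (z - 1) * g z)%C; split; [|split].
    + apply Clim_mult; [apply Clim_minus; [apply Ccont_id|apply Clim_const]|exact Cg].
    + apply Cmult_neq_0; [|exact G0]. rewrite E2, <- RtoC_minus; RtoC_neq.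
    + apply (near_ball z0 r); [exact Hr|]; intros z Hz Oz.
      destruct (HZ z Hz Oz) as [_ [H _]]; specialize (H (or_intror E2)).
      rewrite !Cpow_2 in H. rewrite E2 in H at 1.
      replace (z - RtoC (-1))%C with (z + 1)%C in H by (rewrite RtoC_m1; ring).
      rewrite <- HQ by exact Oz.
      transitivity ((z - 1) * (C_derive h z * C_derive h z * (z + 1)))%C; [ring|rewrite H; ring].
  - exists (fun z => (z * z - 1) * (g z * g z))%C; split; [|split].
    + apply Clim_mult; [|now apply Clim_mult].
      apply Clim_minus; [apply Clim_mult; apply Ccont_id|apply Clim_const].
    + apply Cmult_neq_0; [|now apply Cmult_neq_0].
      intros E. assert (F : ((z0 - 1) * (z0 - RtoC (-1)))%C = RtoC 0) by (rewrite <- E, RtoC_m1; ring).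
      apply (Cmult_neq_0 (z0 - 1) (z0 - RtoC (-1))); [now apply Cminus_eq_contra|now apply Cminus_eq_contra|exact F].
    + apply (near_ball z0 r); [exact Hr|]; intros z Hz Oz.
      destruct (HZ z Hz Oz) as [H _].
      rewrite <- HQ by exact Oz.
      destruct H as [E|E]; [|rewrite E; ring|rewrite E; ring].
      intros BP; apply (branch_point_edges G z0 eq_refl) in BP; tauto.
Qed.

(** Letting z tend to z0 shows that z0 is a root of the linear factor; after
    division by (z - z0)^2 a second limit excludes a multiple zero. *)
Lemma saddle_root (p0 p1 z0 : C) (k : nat) (G : contour 0) (g : C -> C) :
  Omega G z0 -> Ccont g z0 -> g z0 <> RtoC 0 -> (1 <= k)%nat ->
  off_Omega G z0 (fun z => ((p0 + p1 * z) * (p0 + p1 * z) = ((z - z0) ^ k) * ((z - z0) ^ k) * g z)%C) ->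
  (p0 + p1 * z0 = 0)%C /\ p1 <> RtoC 0 /\ k = 1%nat.
Proof.
  intros HO Cg G0 Hk HE.
  destruct k as [|k]; [lia|].
  assert (R0 : (p0 + p1 * z0 = 0)%C).
  { assert (E : ((p0 + p1 * z0) * (p0 + p1 * z0) = (z0 - z0) ^ S k * (z0 - z0) ^ S k * g z0)%C).
    { apply (Ccont_pair_unique G (fun z => (p0 + p1 * z) * (p0 + p1 * z))%C
        (fun z => (z - z0) ^ S k * (z - z0) ^ S k * g z)%C z0 HO); [| |exact HE].
      - apply Clim_mult; apply Ccont_affine.
      - apply Clim_mult; [|exact Cg]. apply Clim_mult; apply Ccont_shift_pow. }
    rewrite shift_pow_S in E.
    destruct (Ceq_dec (p0 + p1 * z0) 0) as [|N]; [assumption|].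
    exfalso; apply (Cmult_neq_0 _ _ N N); rewrite E; ring. }
  assert (HP : off_Omega G z0 (fun z => (p1 * p1 = (z - z0) ^ k * (z - z0) ^ k * g z)%C)).
  { generalize (filter_and _ _ HE (off_Omega_neq G z0 HO)); apply filter_imp; intros z [E N].
    assert (N' : (z - z0)%C <> RtoC 0) by now apply Cminus_eq_contra.
    apply (Cmult_eq_l ((z - z0) * (z - z0))); [now apply Cmult_neq_0|].
    rewrite Cpow_S in E.
    transitivity ((p0 + p1 * z) * (p0 + p1 * z))%C; [|rewrite E; ring].
    replace (p0 + p1 * z)%C with ((p0 + p1 * z0) + p1 * (z - z0))%C by ring.
    rewrite R0; ring. }
  assert (E1 : (p1 * p1 = (z0 - z0) ^ k * (z0 - z0) ^ k * g z0)%C).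
  { apply (Ccont_pair_unique G (fun z => p1 * p1)%C
      (fun z => (z - z0) ^ k * (z - z0) ^ k * g z)%C z0 HO); [apply Clim_const| |exact HP].
    apply Clim_mult; [|exact Cg]. apply Clim_mult; apply Ccont_shift_pow. }
  assert (P1 : p1 <> RtoC 0).
  { intros ->. pose proof (off_Omega_proper G z0 HO) as PF.
    apply G0. apply (Clim_unique (F := off_Omega G z0) g); [now apply Ccont_off_Omega|].
    apply (Clim_ext_loc (fun _ => RtoC 0)); [|apply Clim_const].
    generalize (filter_and _ _ HP (off_Omega_neq G z0 HO)); apply filter_imp; intros z [E N].
    assert (N' : ((z - z0) ^ k)%C <> RtoC 0) by (apply Cpow_nz; now apply Cminus_eq_contra).
    apply (Cmult_eq_l ((z - z0) ^ k * (z - z0) ^ k)); [now apply Cmult_neq_0|].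
    rewrite <- E; ring. }
  split; [exact R0|split; [exact P1|]].
  destruct k as [|k]; [reflexivity|exfalso].
  rewrite shift_pow_S in E1. apply (Cmult_neq_0 _ _ P1 P1). rewrite E1; ring.
Qed.

(** In genus 1 the polynomial factor of h' is a constant, which leaves no
    room for a saddle point. *)
Lemma genus1_no_saddle (s : C) (G : contour 1) (h : C -> C) (z0 : C) (k : nat) :
  h_function s 1 G h -> Omega G z0 -> derive_zero_order G h z0 k -> (1 <= k)%nat -> False.
Proof.
  intros HF HO [r [g [Hr [Hg [G0 HZ]]]]] Hk.
  destruct k as [|k]; [lia|].
  pose proof (holomorphic_near_Ccont g z0 r Hr Hg) as Cg.
  destruct (h_derive_sqr _ _ _ _ HF) as [P HQ].
  set (p := P 0%nat) in *. set (l0 := lambda G 0) in *. set (l1 := lambda G 1) in *.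
  assert (HS : forall z, ~ Omega G z ->
    (C_derive h z * C_derive h z * (z * z - 1) = p * p * ((z - l0) * (z - l1)))%C).
  { intros z Hz; specialize (HQ z Hz); rewrite !Cpow_2 in HQ; simpl (1 - 1)%nat in HQ.
    rewrite Cpoly_0 in HQ; rewrite HQ; simpl.
    fold p l0 l1. field. now apply (off_Omega_edges G). }
  assert (B01 : brk G 0 < brk G 1) by (apply brk_lt; lia).
  assert (B12 : brk G 1 < brk G 2) by (apply brk_lt; lia).
  assert (B23 : brk G 2 < brk G 3) by (apply brk_lt; lia).
  assert (B0 : brk G 0 = 0) by apply brk_first.
  assert (B3 : brk G 3 = 1) by apply (brk_last 1 G).
  assert (DIST : forall t u, 0 <= t <= 1 -> 0 <= u <= 1 -> t <> u -> sg G t <> sg G u).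
  { intros t u Ht Hu N E; apply N; now apply (sg_inj 1 G). }
  assert (S0 : sg G 0 = RtoC (-1)) by apply sg_first. assert (S1 : sg G 1 = RtoC 1) by apply sg_last.
  assert (D01 : l0 <> l1) by (apply DIST; lra).
  assert (L0p : l0 <> RtoC 1) by (rewrite <- S1; apply DIST; lra).
  assert (L0m : l0 <> RtoC (-1)) by (rewrite <- S0; apply DIST; lra).
  assert (L1p : l1 <> RtoC 1) by (rewrite <- S1; apply DIST; lra).
  assert (L1m : l1 <> RtoC (-1)) by (rewrite <- S0; apply DIST; lra).
  assert (N11 : RtoC 1 <> RtoC (-1)) by RtoC_neq.
  assert (BP : forall z, branch_point G z <-> z = RtoC (-1) \/ z = l0 \/ z = l1 \/ z = RtoC 1).
  { intros z; split.
    - intros [j [Hj ->]]. destruct j as [|[|[|[|j]]]]; [| | | |lia].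
      + rewrite B0, S0; tauto.
      + right; left; reflexivity.
      + right; right; left; reflexivity.
      + rewrite B3, S1; tauto.
    - intros [->|[->|[->| ->]]].
      + now apply edges_branch_point; right.
      + exists 1%nat; split; [lia|reflexivity].
      + exists 2%nat; split; [lia|reflexivity].
      + now apply edges_branch_point; left. }
  assert (CI : forall c, Ccont (fun z => z - c)%C z0)
    by (intros c; apply Clim_minus; [apply Ccont_id|apply Clim_const]).
  (* After cancelling the generic behaviour at z0, p^2 A = (z - z0)^(2k) B
     with A and B continuous and nonzero at z0. *)
  assert (K : exists A B, Ccont A z0 /\ Ccont B z0 /\ A z0 <> RtoC 0 /\ B z0 <> RtoC 0 /\
    off_Omega G z0 (fun z => (p * p * A z = (z - z0) ^ S k * (z - z0) ^ S k * B z)%C)).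
  { assert (SUB : forall c, z0 <> c -> (z0 - c)%C <> RtoC 0) by (intros c; apply Cminus_eq_contra).
    destruct (Ceq_dec z0 1) as [E1|N1]; [|destruct (Ceq_dec z0 (RtoC (-1))) as [E2|N2]].
    - exists (fun z => (z - l0) * (z - l1))%C, (fun z => (z - RtoC (-1)) * g z)%C.
      split; [apply Clim_mult; apply CI|split; [apply Clim_mult; [apply CI|exact Cg]|split; [|split]]];
        [apply Cmult_neq_0; apply SUB; congruence|apply Cmult_neq_0; [apply SUB; congruence|exact G0]|].
      apply (near_ball z0 r); [exact Hr|]; intros z Hz Oz.
      destruct (HZ z Hz Oz) as [_ [H _]]; specialize (H (or_introl E1)).
      rewrite !Cpow_2 in H. rewrite E1 in H at 1.
      rewrite <- HS by exact Oz. rewrite RtoC_m1.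
      transitivity ((z + 1) * (C_derive h z * C_derive h z * (z - 1)))%C; [ring|rewrite H; ring].
    - exists (fun z => (z - l0) * (z - l1))%C, (fun z => (z - 1) * g z)%C.
      split; [apply Clim_mult; apply CI|split; [apply Clim_mult; [apply CI|exact Cg]|split; [|split]]];
        [apply Cmult_neq_0; apply SUB; congruence|apply Cmult_neq_0; [apply SUB; congruence|exact G0]|].
      apply (near_ball z0 r); [exact Hr|]; intros z Hz Oz.
      destruct (HZ z Hz Oz) as [_ [H _]]; specialize (H (or_intror E2)).
      rewrite !Cpow_2 in H. rewrite E2 in H at 1. rewrite RtoC_m1 in H.
      rewrite <- HS by exact Oz.
      transitivity ((z - 1) * (C_derive h z * C_derive h z * (z - - (1))))%C; [ring|rewrite H; ring].
    - assert (CZ : Ccont (fun z => (z - 1) * (z - RtoC (-1)))%C z0) by (apply Clim_mult; apply CI).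
      assert (NZ : ((z0 - 1) * (z0 - RtoC (-1)))%C <> RtoC 0) by (apply Cmult_neq_0; apply SUB; assumption).
      assert (LAM : forall l l', z0 = l -> l <> l' -> branch_point G z0 ->
        (forall z, ((z - l0) * (z - l1) = (z - l) * (z - l'))%C) ->
        exists A B, Ccont A z0 /\ Ccont B z0 /\ A z0 <> RtoC 0 /\ B z0 <> RtoC 0 /\
        off_Omega G z0 (fun z => (p * p * A z = (z - z0) ^ S k * (z - z0) ^ S k * B z)%C)).
      { intros l l' El Nl Bl Hl.
        exists (fun z => z - l')%C, (fun z => (z - 1) * (z - RtoC (-1)) * g z)%C.
        split; [apply CI|split; [now apply Clim_mult|split; [apply SUB; congruence|split; [now apply Cmult_neq_0|]]]].
        generalize (filter_and _ _ (off_Omega_here G z0) (filter_and _ _ (off_Omega_neq G z0 HO)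
          (near_off_Omega G z0 _ (near_ball z0 r (fun z => Cmod (z - z0) < r) Hr (fun z H => H))))).
        apply filter_imp; intros z [Oz [Nz Hz]].
        destruct (HZ z Hz Oz) as [_ [_ H]]; specialize (H Bl N1 N2).
        rewrite !Cpow_2 in H. pose proof (HS z Oz) as HSz. rewrite H, Hl, <- El in HSz.
        assert (N' : (z - z0)%C <> RtoC 0) by now apply Cminus_eq_contra.
        apply (Cmult_eq_l (z - z0)); [exact N'|].
        rewrite RtoC_m1.
        transitivity (p * p * ((z - z0) * (z - l')))%C; [ring|rewrite <- HSz; ring]. }
      destruct (Ceq_dec z0 l0) as [E3|N3]; [|destruct (Ceq_dec z0 l1) as [E4|N4]].
      + apply (LAM l0 l1); [exact E3|exact D01|apply BP; tauto|reflexivity].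
      + apply (LAM l1 l0); [exact E4|congruence|apply BP; tauto|intros z; ring].
      + exists (fun z => (z - l0) * (z - l1))%C, (fun z => (z - 1) * (z - RtoC (-1)) * (g z * g z))%C.
        split; [apply Clim_mult; apply CI|split; [apply Clim_mult; [exact CZ|now apply Clim_mult]|
          split; [apply Cmult_neq_0; apply SUB; assumption|split; [apply Cmult_neq_0; [exact NZ|now apply Cmult_neq_0]|]]]].
        apply (near_ball z0 r); [exact Hr|]; intros z Hz Oz.
        destruct (HZ z Hz Oz) as [H _].
        rewrite <- HS by exact Oz. rewrite RtoC_m1.
        destruct H as [E|E]; [rewrite BP; tauto|rewrite E; ring|rewrite E; ring]. }
  destruct K as [A [B [CA [CB [A0 [B0' HE]]]]]].
  assert (E : (p * p * A z0 = (z0 - z0) ^ S k * (z0 - z0) ^ S k * B z0)%C).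
  { apply (Ccont_pair_unique G (fun z => p * p * A z)%C
      (fun z => (z - z0) ^ S k * (z - z0) ^ S k * B z)%C z0 HO); [| |exact HE].
    - apply Clim_mult; [apply Clim_const|exact CA].
    - apply Clim_mult; [|exact CB]. apply Clim_mult; apply Ccont_shift_pow. }
  assert (PP : (p * p = 0)%C).
  { rewrite shift_pow_S in E. apply (Cmult_eq_l (A z0)); [exact A0|].
    transitivity (p * p * A z0)%C; [ring|rewrite E; ring]. }
  pose proof (off_Omega_proper G z0 HO) as PF.
  apply B0'. apply (Clim_unique (F := off_Omega G z0) B); [now apply Ccont_off_Omega|].
  apply (Clim_ext_loc (fun _ => RtoC 0)); [|apply Clim_const].
  generalize (filter_and _ _ HE (off_Omega_neq G z0 HO)); apply filter_imp; intros z [Ez N].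
  assert (N' : ((z - z0) ^ S k)%C <> RtoC 0) by (apply Cpow_nz; now apply Cminus_eq_contra).
  apply (Cmult_eq_l ((z - z0) ^ S k * (z - z0) ^ S k)); [now apply Cmult_neq_0|].
  rewrite <- Ez, PP; ring.
Qed.

(** * What the expansion at infinity determines *)

Lemma far_off_Omega {L : nat} (G : contour L) :
  Rbar_locally p_infty (fun x => ~ Omega G (RtoC x)).
Proof.
  destruct (arc_bounded (sg G) 0 1) as [M HM]; [lra|apply sg_cont|].
  exists (Rmax M 1); intros x Hx [[_ HR]|[t [Ht E]]].
  - simpl in HR; pose proof (Rmax_r M 1); lra.
  - specialize (HM t Ht); rewrite <- E, Cmod_R in HM.
    pose proof (Rmax_l M 1); pose proof (Rmax_r M 1); rewrite Rabs_pos_eq in HM; lra.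
Qed.

Lemma far_ge (r : R) : Rbar_locally p_infty (fun x => r < x).
Proof. exists r; auto. Qed.

Lemma Clim_inv_far (M : R) : Clim (Rbar_locally p_infty) (fun x => RtoC (M / x)) 0.
Proof.
  intros eps Heps.
  exists (Rmax 1 (Rabs M / eps)); intros x Hx.
  pose proof (Rmax_l 1 (Rabs M / eps)); pose proof (Rmax_r 1 (Rabs M / eps)).
  replace (RtoC (M / x) - 0)%C with (RtoC (M / x)) by ring.
  rewrite Cmod_R. unfold Rdiv; rewrite Rabs_mult, (Rabs_pos_eq (/ x)).
  2: { apply Rlt_le, Rinv_0_lt_compat; lra. }
  apply Rmult_lt_reg_r with x; [lra|]. rewrite Rmult_assoc, Rinv_l, Rmult_1_r by lra.
  replace (Rabs M) with (eps * (Rabs M / eps)) by (field; lra).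
  apply Rmult_lt_compat_l; lra.
Qed.

Lemma Clim_far_bound (f : R -> C) (l : C) (M : R) :
  Rbar_locally p_infty (fun x => Cmod (f x - l) <= M / x) -> Clim (Rbar_locally p_infty) f l.
Proof.
  intros H eps Heps; generalize (filter_and _ _ H (Clim_inv_far M eps Heps)).
  apply filter_imp; intros x [H1 H2].
  replace (RtoC (M / x) - 0)%C with (RtoC (M / x)) in H2 by ring.
  rewrite Cmod_R in H2. pose proof (Rle_abs (M / x)); lra.
Qed.

Lemma Clog_pos (x : R) : 0 < x -> Clog (RtoC x) = RtoC (ln x).
Proof.
  intros Hx; unfold Clog. rewrite Cmod_R, Rabs_pos_eq by lra. simpl.
  unfold Rdiv; rewrite Rmult_0_l, atan_0, Rmult_0_r; reflexivity.
Qed.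

(** Between x and 2 x such a function grows by at least 1/4, so it has no
    limit. *)
Lemma log_growth_diverges (f df : R -> R) (l : R) :
  Rbar_locally p_infty (fun x => is_derive f x (df x) /\ / 2 < x * df x) ->
  ~ filterlim f (Rbar_locally p_infty) (locally l).
Proof.
  intros [X HX] HL.
  assert (E : Rbar_locally p_infty (fun x => Rabs (f x - l) < / 16)).
  { apply (HL (fun y => Rabs (y - l) < / 16)).
    assert (P : 0 < / 16) by lra. exists (mkposreal _ P); intros y Hy; exact Hy. }
  destruct E as [Y HY].
  set (x := Rmax 1 (Rmax X Y) + 1).
  pose proof (Rmax_l 1 (Rmax X Y)); pose proof (Rmax_r 1 (Rmax X Y)).
  pose proof (Rmax_l X Y); pose proof (Rmax_r X Y).
  destruct (MVT_gen f x (2 * x) df) as [c [Hc E]].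
  - rewrite Rmin_left, Rmax_right by (unfold x; lra). intros y Hy; apply HX; unfold x in *; lra.
  - rewrite Rmin_left, Rmax_right by (unfold x; lra). intros y Hy.
    apply (is_derive_continuity_pt _ _ (df y)), HX; unfold x in *; lra.
  - rewrite Rmin_left, Rmax_right in Hc by (unfold x; lra).
    destruct (HX c) as [_ D]; [unfold x in *; lra|].
    pose proof (HY x ltac:(unfold x; lra)) as A. pose proof (HY (2 * x) ltac:(unfold x; lra)) as B.
    apply Rabs_def2 in A; apply Rabs_def2 in B.
    assert (0 < x) by (unfold x; lra). nra.
Qed.

(** The residue of h' at infinity is 2: otherwise h + s z - 2 log z would
    grow logarithmically along the positive axis. *)
Lemma derive_residue (s : C) (L : nat) (G : contour L) (h : C -> C) (D : C) :
  h_function s L G h ->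
  Clim (Rbar_locally p_infty) (fun x => RtoC x * (C_derive h (RtoC x) + s))%C D -> D = RtoC 2.
Proof.
  intros HF HD.
  destruct (Ceq_dec D 2) as [|N]; [assumption|exfalso].
  set (c := (/ (D - 2))%C).
  assert (N' : (D - 2)%C <> RtoC 0) by now apply Cminus_eq_contra.
  set (f := fun x => Re (c * (h (RtoC x) + s * RtoC x))%C - Re (c * 2) * ln x).
  set (df := fun x => Re (c * (C_derive h (RtoC x) + s))%C - Re (c * 2) * / x).
  destruct (h_infinity _ _ _ _ HF) as [ell [M [r [Hr HI]]]].
  apply (log_growth_diverges f df (Re (c * - ell))).
  - assert (K : Rbar_locally p_infty (fun x => / 2 < Re (c * (RtoC x * (C_derive h (RtoC x) + s) - 2))%C)).
    { assert (KL : filterlim (fun x => Re (c * (RtoC x * (C_derive h (RtoC x) + s) - 2))%C)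
        (Rbar_locally p_infty) (locally (Re (c * (D - 2))%C))).
      { apply Clim_Re, Clim_mult; [apply Clim_const|]. apply Clim_minus; [exact HD|apply Clim_const]. }
      apply (KL (fun y => / 2 < y)), (open_gt (/ 2)).
      replace (c * (D - 2))%C with (RtoC 1) by (unfold c; field; exact N'). simpl; lra. }
    generalize (filter_and _ _ K (filter_and _ _ (far_off_Omega G) (far_ge 0))).
    apply filter_imp; intros x [K1 [K2 K3]]; split.
    + assert (DH : Cderiv (fun z => c * (h z + s * z))%C (0 + RtoC x * 1) (c * (C_derive h (RtoC x) + s))).
      { replace (0 + RtoC x * 1)%C with (RtoC x) by ring.
        replace (c * (C_derive h (RtoC x) + s))%C with
          (0 * (h (RtoC x) + s * RtoC x) + c * (C_derive h (RtoC x) + (0 * RtoC x + s * 1)))%C by ring.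
        apply (Cderiv_mult (fun _ => c) (fun z => h z + s * z)%C); [apply Cderiv_const|].
        apply (Cderiv_plus h (fun z => s * z)%C); [apply holomorphic_Cderiv, (h_analytic _ _ _ _ HF), K2|].
        apply (Cderiv_mult (fun _ => s) (fun z => z)); [apply Cderiv_const|apply Cderiv_id]. }
      apply Cderiv_line_Re in DH.
      replace (c * (C_derive h (RtoC x) + s) * 1)%C with (c * (C_derive h (RtoC x) + s))%C in DH by ring.
      unfold f, df. apply (is_derive_minus (V := R_NormedModule)).
      * apply (is_derive_ext (fun u => Re (c * (h (0 + RtoC u * 1)%C + s * (0 + RtoC u * 1)))%C)); [|exact DH].
        intros u. now replace (0 + RtoC u * 1)%C with (RtoC u) by ring.
      * apply (is_derive_scal ln), is_derive_ln, K3.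
    + replace (x * df x) with (Re (c * (RtoC x * (C_derive h (RtoC x) + s) - 2))%C); [exact K1|].
      unfold df. replace (x * (Re (c * (C_derive h (RtoC x) + s))%C - Re (c * 2) * / x)) with
        (x * Re (c * (C_derive h (RtoC x) + s))%C - Re (c * 2)) by (field; lra).
      re_im_ring.
  - assert (K : Clim (Rbar_locally p_infty) (fun x => c * (h (RtoC x) + s * RtoC x - 2 * RtoC (ln x)))%C (c * - ell)%C).
    { apply Clim_mult; [apply Clim_const|]. apply (Clim_far_bound _ _ M).
      generalize (filter_and _ _ (far_off_Omega G) (filter_and _ _ (far_ge 0) (far_ge r))).
      apply filter_imp; intros x [K1 [K2 K3]].
      assert (CX : Cmod (RtoC x) = x) by (rewrite Cmod_R, Rabs_pos_eq; lra).
      specialize (HI (RtoC x) K1). rewrite CX, Clog_pos in HI by exact K2. specialize (HI K3).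
      replace (h (RtoC x) + s * RtoC x - 2 * RtoC (ln x) - - ell)%C with
        (h (RtoC x) - (- s * RtoC x - ell + 2 * RtoC (ln x)))%C by ring. exact HI. }
    apply Clim_Re in K.
    apply (filterlim_ext (fun x => Re (c * (h (RtoC x) + s * RtoC x - 2 * RtoC (ln x)))%C)); [|exact K].
    intros x; unfold f; re_im_ring.
Qed.

(** Compare both sides of h'^2 (z^2 - 1) = (p0 + p1 z)^2 at infinity, where h'
    = - s + 2 / z + o(1 / z): the leading terms give p1^2, the next ones p0
    p1. *)
Lemma genus0_coefficients (s : C) (G : contour 0) (h : C -> C) (p0 p1 : C) :
  h_function s 0 G h ->
  (forall z, ~ Omega G z ->
    (C_derive h z * C_derive h z * (z * z - 1) = (p0 + p1 * z) * (p0 + p1 * z))%C) ->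
  (p1 * p1 = s * s)%C /\ (s <> RtoC 0 -> (p0 * p1 = - (2 * s))%C).
Proof.
  intros HF HQ.
  set (F := Rbar_locally p_infty). set (H := fun x => C_derive h (RtoC x)).
  assert (LI : Clim F (fun x => / RtoC x)%C 0).
  { apply (Clim_ext_loc (fun x => RtoC (1 / x))); [|apply Clim_inv_far].
    generalize (far_ge 0); apply filter_imp; intros x Hx.
    rewrite RtoC_div by lra; field; RtoC_neq. }
  assert (LH : Clim F H (- s)%C).
  { destruct (h_derive_infinity _ _ _ _ HF) as [M [r [Hr HM]]].
    apply (Clim_far_bound _ _ M).
    generalize (filter_and _ _ (far_off_Omega G) (filter_and _ _ (far_ge 0) (far_ge r))).
    apply filter_imp; intros x [K1 [K2 K3]].
    assert (CX : Cmod (RtoC x) = x) by (rewrite Cmod_R, Rabs_pos_eq; lra).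
    specialize (HM (RtoC x) K1); rewrite CX in HM.
    unfold H; replace (C_derive h (RtoC x) - - s)%C with (C_derive h (RtoC x) + s)%C by ring. auto. }
  assert (EV : F (fun x => ~ Omega G (RtoC x) /\ RtoC x <> RtoC 0)).
  { generalize (filter_and _ _ (far_off_Omega G) (far_ge 0)); apply filter_imp; intros x [K1 K2].
    split; [exact K1|]; RtoC_neq. }
  assert (LI2 : Clim F (fun x => 1 - / RtoC x * / RtoC x)%C (1 - 0 * 0)%C).
  { apply Clim_minus; [apply Clim_const|now apply Clim_mult]. }
  assert (P1 : (p1 * p1 = s * s)%C).
  { assert (A : Clim F (fun x => H x * H x * (1 - / RtoC x * / RtoC x))%C (- s * - s * (1 - 0 * 0))%C)
      by (apply Clim_mult; [now apply Clim_mult|exact LI2]).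
    assert (B : Clim F (fun x => (p0 * / RtoC x + p1) * (p0 * / RtoC x + p1))%C ((p0 * 0 + p1) * (p0 * 0 + p1))%C).
    { apply Clim_mult; (apply Clim_plus; [|apply Clim_const]; apply Clim_mult; [apply Clim_const|exact LI]). }
    apply (Clim_ext_loc _ (fun x => (p0 * / RtoC x + p1) * (p0 * / RtoC x + p1))%C) in A.
    - pose proof (Clim_unique _ _ _ A B) as U.
      replace (p1 * p1)%C with ((p0 * 0 + p1) * (p0 * 0 + p1))%C by ring. rewrite <- U; ring.
    - generalize EV; apply filter_imp; intros x [K1 K2].
      specialize (HQ _ K1). fold (H x) in HQ.
      transitivity (H x * H x * (RtoC x * RtoC x - 1) * (/ RtoC x * / RtoC x))%C; [field; exact K2|].
      rewrite HQ; field; exact K2. }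
  split; [exact P1|]; intros S0.
  assert (S2 : (- s - s)%C <> RtoC 0).
  { intros E; apply S0. apply (Cmult_eq_l (RtoC (-2))); [RtoC_neq|].
    replace (RtoC (-2) * s)%C with (- s - s)%C; [rewrite E; ring|].
    replace (RtoC (-2)) with (- (1 + 1))%C; [ring|]. rewrite <- RtoC_plus, <- RtoC_opp; f_equal; lra. }
  assert (LD : Clim F (fun x => RtoC x * (C_derive h (RtoC x) + s))%C
    (((p0 * p0 + s * s) * 0 + (p0 * p1 + p0 * p1)) / ((- s - s) * (1 - 0 * 0)))%C).
  { apply (Clim_ext_loc (fun x => ((p0 * p0 + s * s) * / RtoC x + (p0 * p1 + p0 * p1)) /
      ((H x - s) * (1 - / RtoC x * / RtoC x)))%C).
    - assert (NE : F (fun x => (H x - s)%C <> RtoC 0 /\ (1 - / RtoC x * / RtoC x)%C <> RtoC 0)).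
      { apply filter_and.
        - destruct (near_C_neq _ _ S2) as [d [Hd Kd]].
          assert (LS : Clim F (fun x => H x - s)%C (- s - s)%C) by (apply Clim_minus; [exact LH|apply Clim_const]).
          generalize (LS d Hd); apply filter_imp; auto.
        - assert (N1 : (1 - 0 * 0)%C <> RtoC 0) by (replace (1 - 0 * 0)%C with (RtoC 1) by ring; apply C1_nz).
          destruct (near_C_neq _ _ N1) as [d [Hd Kd]].
          generalize (LI2 d Hd); apply filter_imp; auto. }
      generalize (filter_and _ _ EV NE); apply filter_imp; intros x [[K1 K2] [K3 K4]].
      specialize (HQ _ K1); fold (H x) in HQ; fold (H x).
      apply (Cmult_eq_l ((H x - s) * (1 - / RtoC x * / RtoC x))); [now apply Cmult_neq_0|].
      transitivity ((p0 * p0 + s * s) * / RtoC x + (p0 * p1 + p0 * p1))%C.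
      { field. split; [exact K2|split; [|exact K3]].
        intros E; apply K4. transitivity ((RtoC x * RtoC x - 1) * (/ RtoC x * / RtoC x))%C; [field; exact K2|].
        rewrite E; ring. }
      transitivity ((H x * H x * (RtoC x * RtoC x - 1) - s * s * (RtoC x * RtoC x - 1)) * / RtoC x)%C;
        [|field; exact K2].
      rewrite HQ, <- P1; field; exact K2.
    - apply Clim_div.
      + apply Cmult_neq_0; [exact S2|]. replace (1 - 0 * 0)%C with (RtoC 1) by ring; apply C1_nz.
      + apply Clim_plus; [|apply Clim_const]. apply Clim_mult; [apply Clim_const|exact LI].
      + apply Clim_mult; [|exact LI2]. apply Clim_minus; [exact LH|apply Clim_const]. }
  apply (derive_residue s 0 G h) in LD; [|exact HF].
  assert (E : (p0 * p1 + p0 * p1 = 2 * (- s - s))%C).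
  { rewrite <- LD; field; exact S2. }
  apply (Cmult_eq_l (1 + 1)).
  - rewrite <- RtoC_plus; RtoC_neq.
  - transitivity (p0 * p1 + p0 * p1)%C; [ring|rewrite E; ring].
Qed.

(** * Necessary conditions *)

(** The relations between the coefficients of the linear factor place its root
    at 2 / s. *)
Lemma saddle_unique (s : C) (L : nat) (G : contour L) (h : C -> C) (z0 : C) (k : nat) :
  h_function s L G h -> saddle_point G h z0 k ->
  L = 0%nat /\ (s * z0 = 2)%C /\ k = 1%nat.
Proof.
  intros HF [HO [Hk HZ]].
  pose proof (h_genus _ _ _ _ HF) as HL.
  destruct L as [|[|L]]; [| |lia].
  2: { exfalso; exact (genus1_no_saddle s G h z0 k HF HO HZ Hk). }
  destruct (h_derive_sqr _ _ _ _ HF) as [P HP].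
  pose proof (genus0_derive_square G h P HP) as HQ.
  destruct (genus0_saddle_factor G h _ _ z0 k HQ HO HZ) as [g [Cg [G0 HE]]].
  destruct (saddle_root _ _ z0 k G g HO Cg G0 Hk HE) as [E [N Ek]].
  split; [reflexivity|split; [|exact Ek]].
  destruct (genus0_coefficients s G h _ _ HF HQ) as [P1 PP].
  set (p0 := P 0%nat) in *. set (p1 := P 1%nat) in *.
  assert (S0 : s <> RtoC 0).
  { intros ->. apply (Cmult_neq_0 _ _ N N). rewrite P1; ring. }
  specialize (PP S0).
  apply (Cmult_eq_l s); [exact S0|].
  transitivity (p1 * p1 * z0)%C; [rewrite P1; ring|].
  transitivity ((p0 + p1 * z0) * p1 - p0 * p1)%C; [ring|]. rewrite E, PP; ring.
Qed.

Lemma genus0_regular (s : C) (G : contour 0) (h : C -> C) : h_function s 0 G h -> s <> RtoC 0 ->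
  forall w, ~ Omega G w -> (2 - s * w)%C <> RtoC 0 -> regular_at s h (C_derive h) w.
Proof.
  intros HF S0 w Hw N.
  destruct (h_derive_sqr _ _ _ _ HF) as [P HP].
  pose proof (genus0_derive_square G h P HP) as HQ.
  destruct (genus0_coefficients s G h _ _ HF HQ) as [P1 PP]; specialize (PP S0).
  split; [apply holomorphic_Cderiv, (h_analytic _ _ _ _ HF), Hw|].
  split; [|split; [now apply (off_Omega_edges G)|exact N]].
  rewrite HQ by exact Hw.
  set (p0 := P 0%nat) in *. set (p1 := P 1%nat) in *.
  assert (P0 : (p0 * p0 = 2 * 2)%C).
  { apply (Cmult_eq_l (s * s)); [now apply Cmult_neq_0|].
    rewrite <- P1 at 1. transitivity ((p0 * p1) * (p0 * p1))%C; [ring|]. rewrite PP; ring. }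
  transitivity (p0 * p0 + (p0 * p1 + p0 * p1) * w + p1 * p1 * (w * w))%C; [ring|].
  rewrite P0, PP, P1; ring.
Qed.

Lemma hard_edge_vanishes (s : C) (L : nat) (G : contour L) (h : C -> C) (e : C) :
  h_function s L G h -> e = RtoC 1 \/ e = RtoC (-1) ->
  forall eps, 0 < eps -> off_Omega G e (fun z => Rabs (Re (h z)) < eps).
Proof.
  intros HF He eps Heps.
  destruct (h_hard_edge _ _ _ _ HF e He) as [M [r [Hr HM]]].
  assert (HO : Omega G e) by (destruct He as [-> | ->]; [apply Omega_1|apply Omega_m1]).
  set (M1 := Rabs M + 1).
  assert (HM1 : 0 < M1) by (pose proof (Rabs_pos M); unfold M1; lra).
  set (d := (eps / M1) * (eps / M1)).
  assert (h_of : 0 < eps / M1) by (now apply Rdiv_lt_0_compat).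
  assert (Hd : 0 < d) by (unfold d; nra).
  exists (Rmin r d); split; [now apply Rmin_pos|]; intros z [Z1 Z2]%Rmin_lt Oz.
  assert (Z0 : 0 < Cmod (z - e)).
  { apply Cmod_gt_0, Cminus_eq_contra; intros ->; auto. }
  eapply Rle_lt_trans; [apply (HM z Oz Z1)|].
  replace (1 / 2) with (/ 2) by lra. rewrite Rpower_sqrt by exact Z0.
  assert (SQ : sqrt (Cmod (z - e)) < eps / M1).
  { rewrite <- (sqrt_square (eps / M1)) by lra. apply sqrt_lt_1_alt; split; [lra|exact Z2]. }
  pose proof (sqrt_pos (Cmod (z - e))).
  apply Rle_lt_trans with (M1 * sqrt (Cmod (z - e))).
  - apply Rmult_le_compat_r; [assumption|]. pose proof (Rle_abs M); unfold M1; lra.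
  - replace eps with (M1 * (eps / M1)) by (field; lra). apply Rmult_lt_compat_l; assumption.
Qed.

Lemma Re_vanishes_eps {L : nat} (G : contour L) (h : C -> C) (z0 : C) :
  Re_vanishes G h z0 <->
  forall eps, 0 < eps -> off_Omega G z0 (fun z => Rabs (Re (h z)) < eps).
Proof.
  split.
  - intros H eps Heps.
    assert (K : within (fun z => ~ Omega G z) (@locally C_UniformSpace z0) (fun z => Rabs (Re (h z)) < eps)).
    { apply (H (fun y => Rabs y < eps)). exists (mkposreal eps Heps); intros y Hy.
      change (Rabs (y - 0) < eps) in Hy. now rewrite Rminus_0_r in Hy. }
    apply near_C_locally in K. exact K.
  - intros H P [d HP].
    apply near_C_locally. specialize (H d (cond_pos d)). revert H.
    apply (filter_imp (F := near_C z0)); intros z Hz Oz. apply HP.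
    change (Rabs (Re (h z) - 0) < d). rewrite Rminus_0_r; auto.
Qed.

(** The equation of the breaking set: the saddle 2 / s of the genus 0
    h-function lies at height 0. *)
Definition saddle_height_zero (s : C) : Prop :=
  exists z r, (s * z = 2)%C /\ (r * r = z * z - 1)%C /\ edge_height s z r = 0.

Lemma edge_height_branch_point (s z : C) : (z * z = 1)%C -> edge_height s z 0 = 0.
Proof.
  intros Hz; unfold edge_height. replace (z + 0)%C with z by ring.
  replace (Cmod z) with 1.
  - rewrite ln_1. replace (s * 0)%C with (RtoC 0) by ring. simpl; ring.
  - assert (M : Cmod z * Cmod z = 1) by (rewrite <- Cmod_mult, Hz; apply Cmod_1).
    pose proof (Cmod_ge_0 z); nra.
Qed.

(** The side of Omega that joins z0 to a hard edge has height 0 at the edge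
    and Re h = 0 at z0. *)
Lemma breaking_necessary (s : C) (L : nat) (G : contour L) (h : C -> C) (z0 : C) (k : nat) :
  breaking_datum s L G h z0 k -> saddle_height_zero s.
Proof.
  intros [HF [HS HR]].
  destruct (saddle_unique s L G h z0 k HF HS) as [EL [Ez _]]; subst L.
  destruct HS as [HO _]. exists z0.
  assert (S0 : s <> RtoC 0).
  { intros ->. assert (Z : RtoC 0 = RtoC 2) by (rewrite <- Ez; ring). apply RtoC_inj in Z; lra. }
  pose proof (genus0_regular s G h HF S0) as REG.
  pose proof (proj1 (Re_vanishes_eps G h z0) HR) as R0.
  assert (EDGE : (z0 * z0 = 1)%C -> exists r, (s * z0 = 2)%C /\ (r * r = z0 * z0 - 1)%C /\ edge_height s z0 r = 0).
  { intros E; exists 0; split; [exact Ez|split; [rewrite E; ring|now apply edge_height_branch_point]]. }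
  assert (NS : forall w, w <> z0 -> (2 - s * w)%C <> RtoC 0).
  { intros w N E; apply N. apply (Cmult_eq_l s); [exact S0|]. rewrite Ez.
    replace (s * w)%C with (2 - (2 - s * w))%C by ring; rewrite E; ring. }
  destruct (Csqrt_exists (z0 * z0 - 1)) as [r Er].
  assert (B0 : brk G 0 = 0) by apply brk_first. assert (B1 : brk G 1 = 1) by apply (brk_last 0 G).
  destruct HO as [Hray|[t0 [Ht0 Et0]]].
  - (* On the ray the side is followed from -1. *)
    set (x0 := Re z0). assert (Zx : z0 = RtoC x0).
    { destruct z0 as [a b]; destruct Hray as [I _]; unfold x0; simpl in *; now subst b. }
    destruct (Req_dec x0 (-1)) as [E1|N1].
    { apply EDGE. rewrite Zx, E1, <- RtoC_mult; f_equal; lra. }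
    assert (Hx : x0 < -1) by (destruct Hray as [_ Hx]; fold x0 in Hx; lra).
    exists r; split; [exact Ez|split; [exact Er|]].
    apply (edge_transport G s h RtoC (fun _ => RtoC 1) x0 (-1) (RtoC (-1)) z0 r REG).
    + intros t _; apply continuous_C_eps; intros eps Heps; exists eps; split; [exact Heps|].
      intros u Hu; rewrite <- RtoC_minus, Cmod_R; exact Hu.
    + intros t _; apply continuous_const.
    + intros t Ht; apply ray_collar; lra.
    + intros t Ht; apply NS; rewrite Zx; RtoC_neq.
    + rewrite <- RtoC_mult; f_equal; lra.
    + intros eps Heps; exists (Rmax ((x0 - 1) / 2) (-1 - eps / 2)); split.
      * split; [eapply Rlt_le_trans; [|apply Rmax_l]; lra|apply Rmax_lub_lt; lra].
      * pose proof (Rmax_r ((x0 - 1) / 2) (-1 - eps / 2)).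
        assert (Rmax ((x0 - 1) / 2) (-1 - eps / 2) < -1) by (apply Rmax_lub_lt; lra).
        rewrite <- RtoC_minus, Cmod_R, Rabs_left1; lra.
    + apply (hard_edge_vanishes s 0 G h); [exact HF|now right].
    + intros eps Heps; exists (Rmin ((x0 - 1) / 2) (x0 + eps / 2)); split.
      * split; [apply Rmin_glb_lt; lra|eapply Rle_lt_trans; [apply Rmin_l|lra]].
      * pose proof (Rmin_r ((x0 - 1) / 2) (x0 + eps / 2)).
        assert (x0 < Rmin ((x0 - 1) / 2) (x0 + eps / 2)) by (apply Rmin_glb_lt; lra).
        rewrite Zx, <- RtoC_minus, Cmod_R, Rabs_pos_eq; lra.
    + exact R0.
    + exact Er.
  - (* On Sigma it is followed backwards from 1. *)
    destruct (Req_dec t0 1) as [E1|N1].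
    { apply EDGE. rewrite Et0, E1, sg_last; ring. }
    exists r; split; [exact Ez|split; [exact Er|]].
    assert (APP : forall t eps, t0 <= t <= 1 -> 0 < eps ->
      exists u, t0 < u < 1 /\ Cmod (sg G u - sg G t) < eps).
    { intros t eps Ht Heps.
      assert (CS : path_continuous (sg G) t) by (apply sg_cont; lra).
      destruct (proj1 (continuous_C_eps _ t) CS _ Heps) as [d [Hd K]].
      pose proof (Rmin_l (d / 2) ((1 - t0) / 4)). pose proof (Rmin_r (d / 2) ((1 - t0) / 4)).
      assert (0 < Rmin (d / 2) ((1 - t0) / 4)) by (apply Rmin_pos; lra).
      destruct (Rle_dec t ((t0 + 1) / 2)).
      - exists (t + Rmin (d / 2) ((1 - t0) / 4)); split; [lra|apply K, Rabs_def1; lra].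
      - exists (t - Rmin (d / 2) ((1 - t0) / 4)); split; [lra|apply K, Rabs_def1; lra]. }
    apply (edge_transport G s h (sg G) (dsg G 0) t0 1 1 z0 r REG).
    + intros t Ht; apply sg_cont; lra.
    + intros t Ht; apply dsg_cont; [lia|rewrite B0, B1; lra].
    + intros t Ht; apply sg_piece_collar; [lia|rewrite B0, B1; lra].
    + intros t Ht; apply NS; rewrite Et0; intros E; apply (sg_inj 0 G) in E; lra.
    + ring.
    + intros eps Heps. rewrite <- (sg_last 0 G). apply APP; [lra|exact Heps].
    + apply (hard_edge_vanishes s 0 G h); [exact HF|now left].
    + intros eps Heps. rewrite Et0. apply APP; [lra|exact Heps].
    + exact R0.
    + exact Er.
Qed.

Lemma critical_necessary (s : C) : critical_breaking_point s -> s = RtoC 2 \/ s = RtoC (-2).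
Proof.
  intros [L [G [h [z0 [k [[HF [HS _]] HC]]]]]].
  destruct (saddle_unique s L G h z0 k HF HS) as [EL [Ez Ek]].
  destruct HC as [BP|[Hk|[z1 [k1 [N HS1]]]]].
  - apply (branch_point_edges G z0 EL) in BP.
    destruct BP as [->| ->].
    + left; rewrite <- Ez; ring.
    + right; rewrite RtoC_m1 in Ez. transitivity (- (s * - (1)))%C; [ring|].
      rewrite Ez, <- RtoC_opp; reflexivity.
  - lia.
  - exfalso; apply N. destruct (saddle_unique s L G h z1 k1 HF HS1) as [_ [Ez1 _]].
    apply (Cmult_eq_l s); [|now rewrite Ez, Ez1].
    intros ->. assert (Z : RtoC 0 = RtoC 2) by (rewrite <- Ez; ring). apply RtoC_inj in Z; lra.
Qed.

(** * Exponential, logarithm and square root *)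

Lemma Cderiv_of_eps (f : C -> C) (z l : C) :
  (forall eps, 0 < eps -> exists d, 0 < d /\ forall w, Cmod (w - z) < d ->
    Cmod (f w - f z - l * (w - z)) <= eps * Cmod (w - z)) -> Cderiv f z l.
Proof.
  intros H; apply Cderiv_is_derive; split; [apply @is_linear_scal_l|].
  intros x Hx.
  apply (@is_filter_lim_locally_unique C_AbsRing (AbsRing_NormedModule C_AbsRing)) in Hx; subst x.
  intros eps; destruct (H eps (cond_pos eps)) as [d [Hd K]].
  exists (mkposreal d Hd); intros w Hw.
  change (Cmod (f w - f z - (w - z) * l) <= eps * Cmod (w - z)).
  replace ((w - z) * l)%C with (l * (w - z))%C by ring. now apply K.
Qed.

Definition Cexp (z : C) : C := (exp (Re z) * cos (Im z), exp (Re z) * sin (Im z)).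

Lemma Cexp_plus (z w : C) : Cexp (z + w) = (Cexp z * Cexp w)%C.
Proof.
  destruct z as [a b], w as [c d]; unfold Cexp, Cmult, Re, Im; simpl.
  rewrite exp_plus, cos_plus, sin_plus; f_equal; ring.
Qed.

Lemma Cexp_0 : Cexp 0 = 1.
Proof. unfold Cexp; simpl; rewrite exp_0, cos_0, sin_0; unfold RtoC; f_equal; ring. Qed.

Lemma Cexp_opp (z : C) : (Cexp z * Cexp (- z) = 1)%C.
Proof. rewrite <- Cexp_plus; replace (z + - z)%C with (RtoC 0) by ring; apply Cexp_0. Qed.

Lemma Cmod_Cexp (z : C) : Cmod (Cexp z) = exp (Re z).
Proof.
  unfold Cmod, Cexp; simpl. rewrite !Rmult_1_r.
  replace (exp (Re z) * cos (Im z) * (exp (Re z) * cos (Im z)) +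
    exp (Re z) * sin (Im z) * (exp (Re z) * sin (Im z))) with (exp (Re z) * exp (Re z)).
  - apply sqrt_square, Rlt_le, exp_pos.
  - pose proof (sin2_cos2 (Im z)) as E; unfold Rsqr in E.
    transitivity (exp (Re z) * exp (Re z) * (sin (Im z) * sin (Im z) + cos (Im z) * cos (Im z)));
      [rewrite E; ring|ring].
Qed.

Lemma first_order_bound (f : R -> R) (l eps : R) : is_derive f 0 l -> 0 < eps ->
  exists d, 0 < d /\ forall x, Rabs x < d -> Rabs (f x - f 0 - l * x) <= eps * Rabs x.
Proof.
  intros H He; apply is_derive_Reals in H; destruct (H eps He) as [d K].
  exists d; split; [apply cond_pos|]; intros x Hx.
  destruct (Req_dec x 0) as [->|N].
  - replace (f 0 - f 0 - l * 0) with 0 by ring. rewrite Rabs_R0; lra.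
  - specialize (K x N Hx). rewrite Rplus_0_l in K.
    replace (f x - f 0 - l * x) with (((f x - f 0) / x - l) * x) by (field; exact N).
    rewrite Rabs_mult; apply Rmult_le_compat_r; [apply Rabs_pos|lra].
Qed.

Lemma Cexp_derive_0 : Cderiv Cexp 0 1.
Proof.
  apply Cderiv_of_eps; intros eps Heps.
  set (e := Rmin 1 (eps / 10)).
  assert (He : 0 < e) by (apply Rmin_pos; lra).
  assert (E1 : e <= 1) by apply Rmin_l. assert (E2 : e <= eps / 10) by apply Rmin_r.
  clearbody e.
  destruct (first_order_bound exp 1 e) as [d1 [Hd1 H1]]; [|exact He|].
  { replace 1 with (exp 0) by apply exp_0. apply is_derive_exp. }
  destruct (first_order_bound sin 1 e) as [d2 [Hd2 H2]]; [|exact He|].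
  { replace 1 with (cos 0) by apply cos_0. apply is_derive_sin. }
  destruct (first_order_bound cos 0 e) as [d3 [Hd3 H3]]; [|exact He|].
  { replace 0 with (- sin 0) at 2 by (rewrite sin_0; ring). apply is_derive_cos. }
  exists (Rmin (Rmin d1 d2) (Rmin d3 e)); split; [repeat apply Rmin_pos; assumption|].
  intros w Hw; rewrite Cexp_0.
  replace (w - 0)%C with w in * by ring.
  apply Rmin_lt in Hw as [[W1 W2]%Rmin_lt [W3 W4]%Rmin_lt].
  pose proof (re_le_Cmod w) as A; pose proof (Im_le_Cmod w) as B.
  set (m := Cmod w) in *. set (a := Re w) in *. set (b := Im w) in *.
  specialize (H1 a ltac:(lra)). specialize (H2 b ltac:(lra)). specialize (H3 b ltac:(lra)).
  rewrite exp_0 in H1; rewrite sin_0 in H2; rewrite cos_0 in H3.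
  set (X := exp a) in *. set (S := sin b) in *. set (K := cos b) in *.
  assert (Q1 : Rabs (X - 1 - 1 * a) <= e * m) by nra.
  assert (Q2 : Rabs (S - 0 - 1 * b) <= e * m) by nra.
  assert (Q3 : Rabs (K - 1 - 0 * b) <= e * m) by nra.
  assert (M0 : 0 <= m) by apply Cmod_ge_0.
  apply Rabs_le_between in Q1; apply Rabs_le_between in Q2; apply Rabs_le_between in Q3.
  apply Rabs_le_between in A; apply Rabs_le_between in B.
  assert (X0 : 0 < X) by apply exp_pos.
  assert (X1 : -2 * m <= X - 1 <= 2 * m) by nra.
  assert (X3 : X <= 3) by lra.
  eapply Rle_trans; [apply Cmod_le_Re_Im|].
  replace (Re (Cexp w - 1 - 1 * w)) with ((X - 1 - 1 * a) + X * (K - 1 - 0 * b))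
    by (unfold Cexp, X, K, a, b; simpl; unfold Re; ring).
  replace (Im (Cexp w - 1 - 1 * w)) with (X * (S - 0 - 1 * b) + (X - 1) * b)
    by (unfold Cexp, X, S, a, b; simpl; unfold Im; ring).
  assert (T1 : Rabs ((X - 1 - 1 * a) + X * (K - 1 - 0 * b)) <= 4 * e * m).
  { apply Rabs_le; nra. }
  assert (T2 : Rabs (X * (S - 0 - 1 * b) + (X - 1) * b) <= 3 * e * m + 2 * m * m).
  { apply Rabs_le; nra. }
  nra.
Qed.

Lemma Cexp_derive (z : C) : Cderiv Cexp z (Cexp z).
Proof.
  apply (Cderiv_ext_loc (fun w => Cexp z * Cexp (w - z))%C).
  - apply filter_forall; intros w; rewrite <- Cexp_plus; f_equal; ring.
  - assert (K : Cderiv (fun w => Cexp z * Cexp (w - z))%C z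
      (0 * Cexp (z - z) + Cexp z * (1 * (1 - 0)))%C).
    { apply (Cderiv_mult (fun _ => Cexp z) (fun w => Cexp (w - z))); [apply Cderiv_const|].
      apply (Cderiv_comp (fun w => w - z)%C Cexp).
      + apply Cderiv_minus; [apply Cderiv_id|apply Cderiv_const].
      + replace (z - z)%C with (RtoC 0) by ring. apply Cexp_derive_0. }
    now replace (0 * Cexp (z - z) + Cexp z * (1 * (1 - 0)))%C with (Cexp z) in K by ring.
Qed.

Definition slit (z : C) : Prop := 0 < Cmod z + Re z.

Lemma slit_iff (z : C) : slit z <-> ~ (Im z = 0 /\ Re z <= 0).
Proof.
  unfold slit; split.
  - intros H [I R]. assert (E : Cmod z = - Re z); [|lra].
    replace z with (RtoC (Re z)) at 1.
    + rewrite Cmod_R; now rewrite Rabs_left1.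
    + destruct z as [a b]; simpl in *; now subst b.
  - intros H; pose proof (re_le_Cmod z) as B; pose proof (Cmod2_alt z) as E.
    pose proof (Cmod_ge_0 z).
    destruct (Rle_lt_dec (Re z) 0) as [R|R].
    + rewrite Rabs_left1 in B by exact R.
      destruct (Req_dec (Cmod z) (- Re z)) as [F|F]; [|lra].
      exfalso; apply H; split; [|exact R].
      rewrite F in E. assert (Im z ^ 2 = 0) by nra. nra.
    + lra.
Qed.

Lemma slit_neq_0 (z : C) : slit z -> z <> RtoC 0.
Proof. intros H ->; apply slit_iff in H; apply H; simpl; lra. Qed.

Lemma slit_Re_pos (z : C) : 0 < Re z -> slit z.
Proof. intros H; apply slit_iff; lra. Qed.

Lemma slit_Im (z : C) : Im z <> 0 -> slit z.
Proof. intros H; apply slit_iff; tauto. Qed.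

Lemma Clim_near_C_Cmod (z : C) : filterlim Cmod (near_C z) (locally (Cmod z)).
Proof. apply (Clim_Cmod (fun w => w)), Ccont_id. Qed.

Lemma slit_filterlim (z : C) : filterlim (fun w => Cmod w + Re w) (near_C z) (locally (Cmod z + Re z)).
Proof.
  apply (filterlim_comp_2 (G := locally (Cmod z)) (H := locally (Re z)) Cmod Re Rplus).
  - apply Clim_near_C_Cmod.
  - apply (Clim_Re (fun w => w)), Ccont_id.
  - apply (filterlim_plus (Cmod z) (Re z)).
Qed.

Lemma slit_open (z : C) : slit z -> near_C z slit.
Proof. intros H; apply (slit_filterlim z (fun y => 0 < y)), (open_gt 0), H. Qed.

Lemma Clog_cont (z : C) : slit z -> Ccont Clog z.
Proof.
  intros H; unfold Ccont, Clog; apply Clim_pair.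
  - apply (filterlim_comp _ _ _ Cmod ln _ (locally (Cmod z))); [apply Clim_near_C_Cmod|].
    apply (ex_derive_continuous ln). exists (/ Cmod z). apply is_derive_ln, Cmod_gt_0, slit_neq_0, H.
  - apply (filterlim_comp _ _ _ (fun w => Im w / (Cmod w + Re w)) (fun y => 2 * atan y) _
      (locally (Im z / (Cmod z + Re z)))).
    + apply (filterlim_comp_2 (G := locally (Im z)) (H := locally (/ (Cmod z + Re z))) Im
        (fun w => / (Cmod w + Re w)) Rmult).
      * assert (K : filterlim (fun w => Re (- Ci * w)%C) (near_C z) (locally (Re (- Ci * z)%C))).
        { apply Clim_Re, Clim_mult; [apply Clim_const|apply Ccont_id]. }
        replace (Im z) with (Re (- Ci * z)%C) by re_im_ring.
        revert K; apply filterlim_ext; intros w; re_im_ring.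
      * apply (filterlim_comp _ _ _ (fun w => Cmod w + Re w) Rinv _ (locally (Cmod z + Re z)));
          [apply slit_filterlim|].
        apply (ex_derive_continuous (fun y => / y)); auto_derive; unfold slit in H; lra.
      * apply (filterlim_mult (Im z) (/ (Cmod z + Re z))).
    + apply (ex_derive_continuous (fun y => 2 * atan y)); auto_derive; auto.
Qed.

Lemma Arg_range (z : C) : - PI < Im (Clog z) < PI.
Proof.
  simpl; pose proof (atan_bound (Im z / (Cmod z + Re z))); lra.
Qed.

Lemma Arg_Re_pos (z : C) : 0 < Re z -> - (PI / 2) < Im (Clog z) < PI / 2.
Proof.
  intros H; simpl.
  assert (B : Rabs (Im z) <= Cmod z) by apply Im_le_Cmod. apply Rabs_le_between in B.
  assert (D : 0 < Cmod z + Re z) by (pose proof (Cmod_ge_0 z); lra).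
  set (y := Im z / (Cmod z + Re z)).
  assert (Y : -1 < y < 1).
  { unfold y; split; (apply Rmult_lt_reg_r with (Cmod z + Re z); [exact D|]);
    unfold Rdiv; rewrite Rmult_assoc, Rinv_l; lra. }
  pose proof (atan_increasing y 1 (proj2 Y)) as U; pose proof (atan_increasing (-1) y (proj1 Y)) as V.
  rewrite atan_1 in U. replace (-1) with (- (1)) in V by ring. rewrite atan_opp, atan_1 in V. lra.
Qed.

Lemma Arg_Im_pos (z : C) : 0 < Im z -> 0 < Im (Clog z).
Proof.
  intros H; simpl.
  assert (D : 0 < Cmod z + Re z) by (apply slit_Im; lra).
  assert (0 < Im z / (Cmod z + Re z)) by (now apply Rdiv_lt_0_compat).
  pose proof (atan_increasing 0 _ H0) as U; rewrite atan_0 in U; lra.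
Qed.

Lemma Arg_Im_neg (z : C) : Im z < 0 -> Im (Clog z) < 0.
Proof.
  intros H; simpl.
  assert (D : 0 < Cmod z + Re z) by (apply slit_Im; lra).
  assert (Im z / (Cmod z + Re z) < 0).
  { apply Rmult_lt_reg_r with (Cmod z + Re z); [exact D|].
    unfold Rdiv; rewrite Rmult_assoc, Rinv_l; lra. }
  pose proof (atan_increasing _ 0 H0) as U; rewrite atan_0 in U; lra.
Qed.

Lemma Cexp_Clog (z : C) : slit z -> Cexp (Clog z) = z.
Proof.
  intros H; pose proof (slit_neq_0 z H) as N; apply Cmod_gt_0 in N.
  unfold Cexp, Clog, Re at 1 3, Im at 1 3; simpl.
  rewrite exp_ln by exact N.
  pose proof (Cmod2_alt z) as E.
  unfold slit in H.
  set (m := Cmod z) in *. set (d := m + Re z) in *.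
  set (th := atan (Im z / d)).
  assert (CT : 0 < cos th).
  { apply cos_gt_0; unfold th; pose proof (atan_bound (Im z / d)); lra. }
  assert (TT : sin th = Im z / d * cos th).
  { assert (T : tan th = Im z / d) by apply tan_atan.
    rewrite <- T; unfold tan; field; lra. }
  pose proof (sin2_cos2 th) as SC; unfold Rsqr in SC. rewrite TT in SC.
  assert (K : cos th * cos th * (d * d + Im z * Im z) = d * d).
  { transitivity ((Im z / d * cos th * (Im z / d * cos th) + cos th * cos th) * (d * d)); [field; lra|].
    rewrite SC; ring. }
  assert (K2 : d * d + Im z * Im z = 2 * m * d) by (unfold d; nra).
  assert (K3 : 2 * m * (cos th * cos th) = d).
  { apply Rmult_eq_reg_r with d; [|lra]. rewrite K2 in K. lra. }
  assert (C2 : m * cos (2 * th) = Re z).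
  { rewrite cos_2a, TT.
    transitivity (2 * m * (cos th * cos th) - m * (Im z / d * cos th * (Im z / d * cos th) + cos th * cos th));
      [ring|]. rewrite SC, K3; unfold d; ring. }
  assert (S2 : m * sin (2 * th) = Im z).
  { rewrite sin_2a, TT.
    transitivity (Im z / d * (2 * m * (cos th * cos th))); [ring|]. rewrite K3; field; lra. }
  apply injective_projections; assumption.
Qed.

Lemma Cexp_inj (z w : C) : Cexp z = Cexp w -> Rabs (Im z - Im w) < 2 * PI -> z = w.
Proof.
  intros E H.
  assert (ER : Re z = Re w).
  { apply exp_inv. rewrite <- !Cmod_Cexp; now rewrite E. }
  assert (EI : cos (Im z - Im w) = 1).
  { assert (X : Cexp (z - w) = 1).
    { unfold Cminus; rewrite Cexp_plus, E; apply Cexp_opp. }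
    unfold Cexp in X. replace (Re (z - w)) with 0 in X.
    - rewrite exp_0, !Rmult_1_l in X. injection X; intros _ X1. exact X1.
    - replace (Re (z - w)) with (Re z - Re w) by re_im_ring. rewrite ER; ring. }
  assert (E0 : Im z - Im w = 0).
  { set (y := Im z - Im w) in *.
    assert (S2 : sin (y / 2) = 0).
    { replace y with (2 * (y / 2)) in EI by lra. rewrite cos_2a_sin in EI. nra. }
    apply Rabs_def2 in H.
    destruct (Rtotal_order y 0) as [Hn|[H0|Hp]]; [|exact H0|].
    - assert (0 < sin (- (y / 2))) by (apply sin_gt_0; lra). rewrite sin_neg in H0; lra.
    - assert (0 < sin (y / 2)) by (apply sin_gt_0; lra). lra. }
  destruct z, w; simpl in *; f_equal; lra.
Qed.

Lemma Clog_unique (z L : C) : slit z -> Cexp L = z -> Rabs (Im (Clog z) - Im L) < 2 * PI -> Clog z = L.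
Proof. intros H E B; apply Cexp_inj; [now rewrite Cexp_Clog|exact B]. Qed.

(** The logarithm is differentiable as a continuous right inverse of exp. *)
Lemma Clog_derive (z : C) : slit z -> Cderiv Clog z (/ z).
Proof.
  intros H; pose proof (Clog_cont z H) as CL.
  pose proof (slit_neq_0 z H) as N.
  destruct (Cexp_derive (Clog z)) as [phi [P0 [CP EP]]].
  rewrite Cexp_Clog in P0, EP by exact H.
  assert (CC : Ccont (fun w => phi (Clog w)) z) by (now apply Ccont_comp).
  assert (NP : phi (Clog z) <> RtoC 0) by (rewrite P0; exact N).
  apply (Cderiv_ext_loc (fun w => if Ceq_dec (phi (Clog w)) 0 then Clog z else Clog z + / phi (Clog w) * (w - z))%C).
  - generalize (filter_and _ _ (slit_open z H) (Ccont_near_neq _ _ _ CC NP)).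
    apply filter_imp; intros w [Sw Nw]; destruct (Ceq_dec (phi (Clog w)) 0) as [|_]; [contradiction|].
    specialize (EP (Clog w)); rewrite Cexp_Clog in EP by exact Sw.
    replace (w - z)%C with (phi (Clog w) * (Clog w - Clog z))%C.
    + field; exact Nw.
    + replace (w - z)%C with (z + phi (Clog w) * (Clog w - Clog z) - z)%C by (rewrite <- EP; ring). ring.
  - exists (fun w => if Ceq_dec (phi (Clog w)) 0 then RtoC 0 else / phi (Clog w))%C; split; [|split].
    + destruct (Ceq_dec (phi (Clog z)) 0); [contradiction|now rewrite P0].
    + apply (Clim_ext_loc (fun w => / phi (Clog w))%C).
      * generalize (Ccont_near_neq _ _ _ CC NP); apply filter_imp; intros w Nw.
        destruct (Ceq_dec (phi (Clog w)) 0); [contradiction|reflexivity].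
      * destruct (Ceq_dec (phi (Clog z)) 0); [contradiction|]. now apply Clim_inv.
    + intros w; destruct (Ceq_dec (phi (Clog z)) 0); [contradiction|].
      destruct (Ceq_dec (phi (Clog w)) 0); ring.
Qed.

Lemma Clog_inv (z : C) : slit z -> slit (/ z) -> Clog (/ z) = (- Clog z)%C.
Proof.
  intros H H'; apply Clog_unique; [exact H'| |].
  - pose proof (Cexp_opp (Clog z)) as E; rewrite Cexp_Clog in E by exact H.
    apply (Cmult_eq_l z); [now apply slit_neq_0|]. rewrite E; field; now apply slit_neq_0.
  - pose proof (Arg_range z); pose proof (Arg_range (/ z)).
    replace (Im (- Clog z)) with (- Im (Clog z)) by reflexivity. apply Rabs_def1; lra.
Qed.

Definition iPI2 : C := (0, PI / 2).

Lemma Cexp_i_PI2 : Cexp iPI2 = Ci.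
Proof. unfold Cexp, iPI2; simpl; rewrite exp_0, cos_PI2, sin_PI2; unfold Ci; f_equal; ring. Qed.

Lemma Cexp_mi_PI2 : Cexp (- iPI2) = (- Ci)%C.
Proof.
  unfold Cexp, iPI2; simpl; rewrite Ropp_0, exp_0, cos_neg, sin_neg, cos_PI2, sin_PI2.
  unfold Ci, Copp; simpl; f_equal; ring.
Qed.

(** A quarter turn moves the cut away: the right-hand side continues the
    logarithm across the negative axis from above. *)
Lemma Clog_upper (z : C) : 0 < Im z -> Clog z = (Clog (- Ci * z) + iPI2)%C.
Proof.
  intros H.
  assert (P : 0 < Re (- Ci * z)) by (replace (Re (- Ci * z)) with (Im z) by re_im_ring; exact H).
  pose proof (Arg_Re_pos _ P). pose proof (Arg_range z). pose proof (Arg_Im_pos z H).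
  apply Clog_unique; [apply slit_Im; lra| |].
  - rewrite Cexp_plus, Cexp_i_PI2, Cexp_Clog by now apply slit_Re_pos.
    transitivity (- (Ci * Ci) * z)%C; [ring|].
    replace (Ci * Ci)%C with (- RtoC 1)%C; [ring|]. unfold Ci; apply injective_projections; simpl; ring.
  - rewrite im_plus; change (Im iPI2) with (PI / 2). apply Rabs_def1; lra.
Qed.

Lemma Clog_lower (z : C) : Im z < 0 -> Clog z = (Clog (Ci * z) - iPI2)%C.
Proof.
  intros H.
  assert (P : 0 < Re (Ci * z)) by (replace (Re (Ci * z)) with (- Im z) by re_im_ring; lra).
  pose proof (Arg_Re_pos _ P). pose proof (Arg_range z). pose proof (Arg_Im_neg z H).
  apply Clog_unique; [apply slit_Im; lra| |].
  - unfold Cminus; rewrite Cexp_plus, Cexp_mi_PI2, Cexp_Clog by now apply slit_Re_pos.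
    transitivity (- (Ci * Ci) * z)%C; [ring|].
    replace (Ci * Ci)%C with (- RtoC 1)%C; [ring|]. unfold Ci; apply injective_projections; simpl; ring.
  - unfold Cminus; rewrite im_plus; change (Im (- iPI2)) with (- (PI / 2)). apply Rabs_def1; lra.
Qed.

(** The principal square root, with values in the right half-plane. *)
Definition Csqrt (z : C) : C := ((z + RtoC (Cmod z)) / RtoC (sqrt (2 * (Cmod z + Re z))))%C.

Lemma Csqrt_parts (z : C) : slit z ->
  Re (Csqrt z) = (Cmod z + Re z) / sqrt (2 * (Cmod z + Re z)) /\
  Im (Csqrt z) = Im z / sqrt (2 * (Cmod z + Re z)) /\ 0 < sqrt (2 * (Cmod z + Re z)).
Proof.
  unfold slit; intros H.
  assert (S : 0 < sqrt (2 * (Cmod z + Re z))) by (apply sqrt_lt_R0; lra).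
  set (q := sqrt (2 * (Cmod z + Re z))) in *.
  assert (E : Csqrt z = ((Cmod z + Re z) / q, Im z / q)).
  { unfold Csqrt; fold q. rewrite <- (Cmult_1_r (_ / _)).
    apply injective_projections; simpl; change (fst z) with (Re z); change (snd z) with (Im z);
    field; lra. }
  rewrite E; simpl; auto.
Qed.

Lemma Csqrt_Re_pos (z : C) : slit z -> 0 < Re (Csqrt z).
Proof.
  intros H; destruct (Csqrt_parts z H) as [-> [_ S]]. now apply Rdiv_lt_0_compat.
Qed.

Lemma Csqrt_square (z : C) : slit z -> (Csqrt z * Csqrt z = z)%C.
Proof.
  intros H; destruct (Csqrt_parts z H) as [HR [HI S]]. unfold slit in H.
  set (q := sqrt (2 * (Cmod z + Re z))) in *.
  assert (Q : q * q = 2 * (Cmod z + Re z)) by (apply sqrt_sqrt; lra).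
  pose proof (Cmod2_alt z) as E.
  revert HR HI; generalize (Csqrt z); intros [a b] HR HI.
  change (a = (Cmod z + Re z) / q) in HR; change (b = Im z / q) in HI.
  apply injective_projections; unfold Cmult; simpl;
  change (fst z) with (Re z); change (snd z) with (Im z); rewrite HR, HI.
  - transitivity (((Cmod z + Re z) * (Cmod z + Re z) - Im z * Im z) / (q * q)); [field; lra|].
    rewrite Q. replace ((Cmod z + Re z) * (Cmod z + Re z) - Im z * Im z) with
      (2 * (Cmod z + Re z) * Re z) by nra. field; lra.
  - transitivity (2 * (Cmod z + Re z) * Im z / (q * q)); [field; lra|]. rewrite Q; field; lra.
Qed.

Lemma Csqrt_unique (z r : C) : slit z -> (r * r = z)%C -> 0 < Re r -> r = Csqrt z.
Proof.
  intros H E P; pose proof (Csqrt_Re_pos z H) as Q; pose proof (Csqrt_square z H) as F.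
  destruct (Ceq_dec (r - Csqrt z) 0) as [Z|Z].
  - transitivity (r - Csqrt z + Csqrt z)%C; [ring|rewrite Z; ring].
  - exfalso. assert (N : (r + Csqrt z)%C <> RtoC 0).
    { intros K. assert (Re (r + Csqrt z) = 0) by (rewrite K; reflexivity).
      rewrite re_plus in H0; lra. }
    apply (Cmult_neq_0 _ _ Z N). transitivity (r * r - Csqrt z * Csqrt z)%C; [ring|].
    rewrite E, F; ring.
Qed.

Lemma Csqrt_cont (z : C) : slit z -> Ccont Csqrt z.
Proof.
  intros H; destruct (Csqrt_parts z H) as [_ [_ S]]. unfold slit in H.
  unfold Csqrt; apply Clim_div.
  - RtoC_neq.
  - apply Clim_plus; [apply Ccont_id|apply Clim_RtoC, Clim_near_C_Cmod].
  - apply Clim_RtoC.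
    apply (filterlim_comp _ _ _ (fun w => Cmod w + Re w) (fun y => sqrt (2 * y)) _
      (locally (Cmod z + Re z))); [apply slit_filterlim|].
    apply (ex_derive_continuous (fun y => sqrt (2 * y))); auto_derive; lra.
Qed.

Lemma Csqrt_derive (z : C) : slit z -> Cderiv Csqrt z (1 / (2 * Csqrt z))%C.
Proof.
  intros H; apply Cderiv_of_square.
  - intros E; pose proof (Csqrt_Re_pos z H) as P; rewrite E in P; simpl in P; lra.
  - now apply Csqrt_cont.
  - apply (Cderiv_ext_loc (fun w => w)); [|apply Cderiv_id].
    generalize (slit_open z H); apply filter_imp; intros w Hw; symmetry; now apply Csqrt_square.
Qed.

Lemma Ci_square : (Ci * Ci = - RtoC 1)%C.
Proof. unfold Ci; apply injective_projections; simpl; ring. Qed.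

Lemma Csqrt_upper (z : C) : 0 < Im z -> Csqrt z = (Ci * Csqrt (- z))%C.
Proof.
  intros H; symmetry; apply Csqrt_unique; [apply slit_Im; lra| |].
  - assert (S : slit (- z)) by (apply slit_Im; simpl; unfold Im in H; lra).
    transitivity (Ci * Ci * (Csqrt (- z) * Csqrt (- z)))%C; [ring|].
    rewrite Csqrt_square by exact S. rewrite Ci_square; ring.
  - assert (S : slit (- z)) by (apply slit_Im; simpl; unfold Im in H; lra).
    destruct (Csqrt_parts _ S) as [_ [HI Q]].
    replace (Re (Ci * Csqrt (- z))) with (- Im (Csqrt (- z))) by re_im_ring.
    rewrite HI. change (Im (- z)) with (- Im z). unfold Rdiv.
    pose proof (Rinv_0_lt_compat _ Q). nra.
Qed.

Lemma Csqrt_lower (z : C) : Im z < 0 -> Csqrt z = (- Ci * Csqrt (- z))%C.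
Proof.
  intros H; symmetry; apply Csqrt_unique; [apply slit_Im; lra| |].
  - assert (S : slit (- z)) by (apply slit_Im; simpl; unfold Im in H; lra).
    transitivity (Ci * Ci * (Csqrt (- z) * Csqrt (- z)))%C; [ring|].
    rewrite Csqrt_square by exact S. rewrite Ci_square; ring.
  - assert (S : slit (- z)) by (apply slit_Im; simpl; unfold Im in H; lra).
    destruct (Csqrt_parts _ S) as [_ [HI Q]].
    replace (Re (- Ci * Csqrt (- z))) with (Im (Csqrt (- z))) by re_im_ring.
    rewrite HI. change (Im (- z)) with (- Im z). unfold Rdiv.
    pose proof (Rinv_0_lt_compat _ Q). nra.
Qed.

(** * Boundary values from one-sided extensions *)

Lemma filter_collar (P : R * R -> Prop) (t : R) :
  (exists delta, 0 < delta /\ forall u e, Rabs (u - t) < delta -> 0 < e < delta -> P (u, e)) ->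
  filter_prod (locally t) (at_right 0) P.
Proof.
  intros [d [Hd H]].
  apply (Filter_prod _ _ _ (fun u => Rabs (u - t) < d) (fun e => 0 < e < d)).
  - exists (mkposreal d Hd); intros u Hu; exact Hu.
  - exists (mkposreal d Hd); intros e He Hp; change (Rabs (e - 0) < d) in He.
    rewrite Rminus_0_r, Rabs_pos_eq in He by lra; lra.
  - auto.
Qed.

Lemma collar_close_neg (g dg : R -> C) (t eps : R) :
  path_continuous g t ->
  path_continuous dg t -> 0 < eps ->
  exists delta, 0 < delta /\ forall u e, Rabs (u - t) < delta -> 0 < e < delta ->
    Cmod (collar g dg u (- e) - g t) < eps.
Proof.
  intros Cg Cd He.
  assert (Cd' : path_continuous (fun u => - dg u)%C t).
  { apply Clim_filterlim; [apply locally_filter|]. apply Clim_opp.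
    now apply Clim_filterlim; [apply locally_filter|]. }
  destruct (collar_close g (fun u => - dg u)%C t eps Cg Cd' He) as [d [Hd H]].
  exists d; split; [exact Hd|]; intros u e Hu Hue.
  replace (collar g dg u (- e)) with (collar g (fun u => - dg u)%C u e); [now apply H|].
  unfold collar; rewrite RtoC_opp; ring.
Qed.

(** A boundary value from the left is the value of any function that is
    continuous at the point and agrees with f to the left of the arc. *)
Lemma left_value_intro (g dg : R -> C) (f phi : C -> C) (t : R) :
  path_continuous g t ->
  path_continuous dg t ->
  Ccont phi (g t) ->
  (exists delta, 0 < delta /\ forall u e, Rabs (u - t) < delta -> 0 < e < delta ->
    f (collar g dg u e) = phi (collar g dg u e)) ->
  left_value g dg f t (phi (g t)).
Proof.
  intros Cg Cd Cp H. unfold left_value. apply Clim_filterlim; [typeclasses eauto|].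
  apply (Clim_ext_loc (fun p => phi (collar g dg (fst p) (snd p)))).
  - apply filter_collar. destruct H as [d [Hd H]]; exists d; split; [exact Hd|].
    intros u e Hu He; symmetry; now apply H.
  - apply (Clim_comp (fun p => collar g dg (fst p) (snd p))); [|exact Cp].
    intros eps Heps; apply filter_collar; now apply collar_close.
Qed.

Lemma right_value_intro (g dg : R -> C) (f phi : C -> C) (t : R) :
  path_continuous g t ->
  path_continuous dg t ->
  Ccont phi (g t) ->
  (exists delta, 0 < delta /\ forall u e, Rabs (u - t) < delta -> 0 < e < delta ->
    f (collar g dg u (- e)) = phi (collar g dg u (- e))) ->
  right_value g dg f t (phi (g t)).
Proof.
  intros Cg Cd Cp H. unfold right_value. apply Clim_filterlim; [typeclasses eauto|].
  apply (Clim_ext_loc (fun p => phi (collar g dg (fst p) (- snd p)))).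
  - apply filter_collar. destruct H as [d [Hd H]]; exists d; split; [exact Hd|].
    intros u e Hu He; simpl; rewrite <- H by assumption.
    unfold collar; rewrite RtoC_opp; f_equal; ring.
  - apply (Clim_comp (fun p => collar g dg (fst p) (- snd p))); [|exact Cp].
    intros eps Heps; apply filter_collar; now apply collar_close_neg.
Qed.

(** * Circular arcs from -1 to 1 *)

Lemma is_derive_of_Cderiv (f : C -> C) (t : R) (l : C) :
  Cderiv f (RtoC t) l -> @is_derive R_AbsRing C_R_NormedModule (fun u => f (RtoC u)) t l.
Proof.
  intros [phi [P0 [CP EP]]]; split; [apply @is_linear_scal_l|].
  intros x Hx.
  apply (@is_filter_lim_locally_unique R_AbsRing R_NormedModule) in Hx; subst x.
  intros eps; destruct (CP eps (cond_pos eps)) as [d [Hd K]].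
  exists (mkposreal d Hd); intros u Hu; change (Rabs (u - t) < d) in Hu.
  assert (Hu' : Cmod (RtoC u - RtoC t) < d) by (now rewrite <- RtoC_minus, Cmod_R).
  specialize (K _ Hu').
  change (@norm R_AbsRing C_R_NormedModule (@minus C_R_NormedModule
    (@minus C_R_NormedModule (f (RtoC u)) (f (RtoC t)))
    (@scal R_AbsRing C_R_NormedModule (u - t) l)) <= eps * Rabs (u - t)).
  assert (E : @minus C_R_NormedModule (@minus C_R_NormedModule (f (RtoC u)) (f (RtoC t)))
    (@scal R_AbsRing C_R_NormedModule (u - t) l) =
    ((phi (RtoC u) - phi (RtoC t)) * (RtoC u - RtoC t))%C).
  { change (f (RtoC u) - f (RtoC t) - @scal R_AbsRing C_R_NormedModule (u - t)%R l =
    (phi (RtoC u) - phi (RtoC t)) * (RtoC u - RtoC t))%C.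
    replace (@scal R_AbsRing C_R_NormedModule (u - t) l) with (RtoC (u - t) * l)%C
      by (symmetry; apply scal_R_Cmult).
    rewrite (EP (RtoC u)), RtoC_minus, <- P0. ring. }
  rewrite E. rewrite <- Cmod_norm, Cmod_mult, <- RtoC_minus, Cmod_R.
  apply Rmult_le_compat_r; [apply Rabs_pos|lra].
Qed.

Lemma continuous_of_Ccont (f : C -> C) (t : R) :
  Ccont f (RtoC t) -> path_continuous (fun u => f (RtoC u)) t.
Proof.
  intros H; apply continuous_C_eps; intros eps Heps; destruct (H eps Heps) as [d [Hd K]].
  exists d; split; [exact Hd|]; intros u Hu; apply K. now rewrite <- RtoC_minus, Cmod_R.
Qed.

Section Arc.
Variable tau : R.

(* With tau = tan beta these are e^(- i beta) and e^(i beta) divided by cos beta. *)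
Let A : C := (1, - tau).
Let B : C := (1, tau).

Lemma A_neq_0 : A <> RtoC 0.
Proof. unfold A; intros E; injection E; lra. Qed.

Lemma B_neq_0 : B <> RtoC 0.
Proof. unfold B; intros E; injection E; lra. Qed.

Definition arc_num (t : C) : C := (t * A - (1 - t) * B)%C.
Definition arc_den (t : C) : C := (t * A + (1 - t) * B)%C.

(** On [0,1] this runs along a circular arc from -1 to 1: (z - 1) / (z + 1)
    runs along a half-line from infinity to 0. *)
Definition arc (t : C) : C := (arc_num t / arc_den t)%C.

Definition arc' (t : C) : C := ((1 + 1) * A * B / (arc_den t * arc_den t))%C.

Lemma arc_den_neq_0 (t : R) : arc_den (RtoC t) <> RtoC 0.
Proof.
  intros E. assert (R : Re (arc_den (RtoC t)) = 1) by (unfold arc_den, A, B; simpl; ring).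
  rewrite E in R; simpl in R; lra.
Qed.

Lemma Cderiv_arc_num (t : C) : Cderiv arc_num t (A + B)%C.
Proof.
  replace (A + B)%C with ((1 * A + t * 0) - ((0 - 1) * B + (1 - t) * 0))%C by ring.
  unfold arc_num. apply (Cderiv_minus (fun t => t * A)%C (fun t => (1 - t) * B)%C).
  - apply (Cderiv_mult (fun t => t) (fun _ => A)); [apply Cderiv_id|apply Cderiv_const].
  - apply (Cderiv_mult (fun t => 1 - t)%C (fun _ => B)); [|apply Cderiv_const].
    apply Cderiv_minus; [apply Cderiv_const|apply Cderiv_id].
Qed.

Lemma Cderiv_arc_den (t : C) : Cderiv arc_den t (A - B)%C.
Proof.
  replace (A - B)%C with ((1 * A + t * 0) + ((0 - 1) * B + (1 - t) * 0))%C by ring.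
  unfold arc_den. apply (Cderiv_plus (fun t => t * A)%C (fun t => (1 - t) * B)%C).
  - apply (Cderiv_mult (fun t => t) (fun _ => A)); [apply Cderiv_id|apply Cderiv_const].
  - apply (Cderiv_mult (fun t => 1 - t)%C (fun _ => B)); [|apply Cderiv_const].
    apply Cderiv_minus; [apply Cderiv_const|apply Cderiv_id].
Qed.

Lemma Cderiv_arc (t : C) : arc_den t <> RtoC 0 -> Cderiv arc t (arc' t).
Proof.
  intros N.
  replace (arc' t) with ((A + B) * / arc_den t + arc_num t * (- (A - B) / (arc_den t * arc_den t)))%C.
  - apply (Cderiv_mult arc_num (fun t => / arc_den t)%C); [apply Cderiv_arc_num|].
    apply Cderiv_inv; [exact N|apply Cderiv_arc_den].
  - unfold arc'. transitivity (((A + B) * arc_den t - arc_num t * (A - B)) / (arc_den t * arc_den t))%C.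
    + field; exact N.
    + f_equal. unfold arc_den, arc_num; ring.
Qed.

Lemma arc'_cont (t : C) : arc_den t <> RtoC 0 -> Ccont arc' t.
Proof.
  intros N; unfold arc'. pose proof (Cderiv_Ccont _ _ _ (Cderiv_arc_den t)) as CD.
  apply Clim_div; [now apply Cmult_neq_0|apply Clim_const|now apply Clim_mult].
Qed.

Lemma arc_plus_1 (t : R) : (arc (RtoC t) + 1 = (1 + 1) * RtoC t * A / arc_den (RtoC t))%C.
Proof.
  pose proof (arc_den_neq_0 t) as N. unfold arc.
  transitivity ((arc_num (RtoC t) + arc_den (RtoC t)) / arc_den (RtoC t))%C; [field; exact N|].
  f_equal; unfold arc_num, arc_den; ring.
Qed.

Lemma arc_minus_1 (t : R) : (arc (RtoC t) - 1 = - ((1 + 1) * (1 - RtoC t) * B) / arc_den (RtoC t))%C.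
Proof.
  pose proof (arc_den_neq_0 t) as N. unfold arc.
  transitivity ((arc_num (RtoC t) - arc_den (RtoC t)) / arc_den (RtoC t))%C; [field; exact N|].
  f_equal; unfold arc_num, arc_den; ring.
Qed.

Lemma arc_0 : arc (RtoC 0) = RtoC (-1).
Proof.
  unfold arc, arc_num, arc_den; rewrite RtoC_m1; pose proof B_neq_0.
  replace (RtoC 0 * A - (1 - RtoC 0) * B)%C with (- B)%C by ring.
  replace (RtoC 0 * A + (1 - RtoC 0) * B)%C with B by ring. field; assumption.
Qed.

Lemma arc_1 : arc (RtoC 1) = RtoC 1.
Proof.
  unfold arc, arc_num, arc_den; pose proof A_neq_0.
  replace (RtoC 1 * A - (1 - RtoC 1) * B)%C with A by ring.
  replace (RtoC 1 * A + (1 - RtoC 1) * B)%C with A by ring. field; assumption.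
Qed.

Lemma Cdiv_eq_cross (a b c d : C) : b <> RtoC 0 -> d <> RtoC 0 -> (a / b = c / d)%C -> (a * d = c * b)%C.
Proof.
  intros Hb Hd E. transitivity (a / b * (b * d))%C; [field; exact Hb|]. rewrite E; field; exact Hd.
Qed.

Lemma two_neq_0 : (1 + 1)%C <> RtoC 0.
Proof. rewrite <- RtoC_plus; RtoC_neq. Qed.

Lemma arc_inj (t u : R) : arc (RtoC t) = arc (RtoC u) -> t = u.
Proof.
  intros E; apply Cdiv_eq_cross in E; [|apply arc_den_neq_0|apply arc_den_neq_0].
  assert (K : ((1 + 1) * A * B * (RtoC t - RtoC u) = 0)%C).
  { transitivity (arc_num (RtoC t) * arc_den (RtoC u) - arc_num (RtoC u) * arc_den (RtoC t))%C.
    - unfold arc_num, arc_den; ring.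
    - rewrite E; ring. }
  destruct (Req_dec t u) as [|N]; [assumption|exfalso].
  apply (Cmult_neq_0 ((1 + 1) * A * B) (RtoC t - RtoC u)); [| |exact K].
  - apply Cmult_neq_0; [apply Cmult_neq_0; [apply two_neq_0|apply A_neq_0]|apply B_neq_0].
  - rewrite <- RtoC_minus; RtoC_neq.
Qed.

Lemma arc_off_ray (t : R) : 0 < t <= 1 -> ~ ray (arc (RtoC t)).
Proof.
  intros Ht [HI HR].
  assert (X : arc (RtoC t) = RtoC (Re (arc (RtoC t)))).
  { destruct (arc (RtoC t)) as [a b]; simpl in *; now subst b. }
  assert (K : (arc_num (RtoC t) = RtoC (Re (arc (RtoC t))) * arc_den (RtoC t))%C).
  { rewrite <- X; unfold arc; field; apply arc_den_neq_0. }
  apply (f_equal Re) in K. rewrite re_scal_l in K.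
  replace (Re (arc_num (RtoC t))) with (2 * t - 1) in K by (unfold arc_num, A, B; simpl; ring).
  replace (Re (arc_den (RtoC t))) with 1 in K by (unfold arc_den, A, B; simpl; ring).
  lra.
Qed.

Lemma arc'_neq_0 (t : R) : arc' (RtoC t) <> RtoC 0.
Proof.
  unfold arc'. pose proof (arc_den_neq_0 t) as N.
  apply Cmult_neq_0.
  - apply Cmult_neq_0; [apply Cmult_neq_0; [apply two_neq_0|apply A_neq_0]|apply B_neq_0].
  - intros E. assert (K : (arc_den (RtoC t) * arc_den (RtoC t))%C <> RtoC 0) by now apply Cmult_neq_0.
    apply C1_nz. rewrite <- (Cinv_l _ K), E; ring.
Qed.

Definition arc_contour : contour 0.
Proof.
  refine {| sg := fun t => arc (RtoC t); dsg := fun _ t => arc' (RtoC t); brk := INR |}.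
  - reflexivity.
  - reflexivity.
  - intros k _; rewrite S_INR; lra.
  - exact arc_0.
  - exact arc_1.
  - intros t u _ _; apply arc_inj.
  - apply arc_off_ray.
  - intros t _; eapply continuous_of_Ccont, Cderiv_Ccont, Cderiv_arc, arc_den_neq_0.
  - intros k t _ _; apply is_derive_of_Cderiv, Cderiv_arc, arc_den_neq_0.
  - intros k t _ _; apply continuous_of_Ccont, arc'_cont, arc_den_neq_0.
  - intros k t _ _; apply arc'_neq_0.
Defined.

Let G := arc_contour.

(** * The genus 0 h-function with its cut along a circular arc *)

(** (z - 1) / (z + 1), rotated so that the cut becomes the negative half-line.
    *)
Definition xi (z : C) : C := (A / B * ((z - 1) / (z + 1)))%C.

Lemma xi_arc (t : R) : t <> 0 -> xi (arc (RtoC t)) = RtoC (- ((1 - t) / t)).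
Proof.
  intros Ht; unfold xi; rewrite arc_plus_1, arc_minus_1.
  assert (T : RtoC t <> RtoC 0) by RtoC_neq.
  pose proof A_neq_0; pose proof B_neq_0; pose proof (arc_den_neq_0 t).
  rewrite RtoC_opp, RtoC_div, RtoC_minus by exact Ht.
  field. repeat split; assumption.
Qed.

Lemma plus_1_neq_0 (z : C) : z <> RtoC (-1) -> (z + 1)%C <> RtoC 0.
Proof. intros H E; apply H; rewrite RtoC_m1; transitivity (z + 1 - 1)%C; [ring|rewrite E; ring]. Qed.

Lemma minus_1_neq_0 (z : C) : z <> RtoC 1 -> (z - 1)%C <> RtoC 0.
Proof. apply Cminus_eq_contra. Qed.

Lemma xi_inv (z x : C) : z <> RtoC (-1) -> (1 - B / A * x)%C <> RtoC 0 -> xi z = x ->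
  z = ((1 + B / A * x) / (1 - B / A * x))%C.
Proof.
  intros Hz N E. pose proof A_neq_0; pose proof B_neq_0.
  pose proof (plus_1_neq_0 z Hz) as Z1.
  assert (K : (B / A * x = (z - 1) / (z + 1))%C) by (rewrite <- E; unfold xi; field; auto).
  rewrite K in *. field. split; [exact Z1|].
  replace (z + 1 - (z - 1))%C with (1 + 1)%C by ring. apply two_neq_0.
Qed.

Definition off_cut (z : C) : Prop := forall t, 0 <= t <= 1 -> arc (RtoC t) <> z.

Lemma off_cut_edges (z : C) : off_cut z -> z <> RtoC (-1) /\ z <> RtoC 1.
Proof.
  intros H; split; intros ->; [apply (H 0)|apply (H 1)]; try lra; [apply arc_0|apply arc_1].
Qed.

Lemma off_Omega_cut (z : C) : ~ Omega G z -> off_cut z.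
Proof. intros H t Ht E; apply H; right; exists t; auto. Qed.

Lemma xi_slit (z : C) : off_cut z -> slit (xi z).
Proof.
  intros H; apply slit_iff; intros [HI HR].
  destruct (off_cut_edges z H) as [Hm _].
  set (rho := - Re (xi z)). assert (X : xi z = RtoC (- rho)).
  { unfold rho; rewrite Ropp_involutive; destruct (xi z) as [a b]; simpl in *; now subst b. }
  assert (R0 : 0 <= rho) by (unfold rho; lra).
  apply (H (/ (1 + rho))).
  - split; [apply Rlt_le, Rinv_0_lt_compat; lra|]. rewrite <- Rinv_1. apply Rinv_le_contravar; lra.
  - pose proof A_neq_0 as A0; pose proof B_neq_0 as B0.
    assert (N1 : RtoC (1 + rho) <> RtoC 0) by RtoC_neq.
    rewrite RtoC_plus in N1.
    assert (N2 : (A + RtoC rho * B)%C <> RtoC 0).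
    { intros E. apply (f_equal Re) in E. unfold A, B in E; simpl in E; lra. }
    symmetry; rewrite (xi_inv z (RtoC (- rho)) Hm).
    + unfold arc, arc_num, arc_den. rewrite RtoC_inv, RtoC_plus, RtoC_opp by lra.
      field. repeat split; try assumption; intros E; apply N2; rewrite <- E; ring.
    + rewrite RtoC_opp; intros E; apply N2.
      transitivity (A * (1 - B / A * - RtoC rho))%C; [field; exact A0|rewrite E; ring].
    + exact X.
Qed.

(** * Uniformization by q = ((z - 1) / (z + 1))^(1/2) *)

Definition v_of (q : C) : C := ((1 + q) / (1 - q))%C.
Definition r_of (q : C) : C := ((1 + 1) * q / ((1 - q) * (1 + q)))%C.

Lemma q_facts (q z : C) : z <> RtoC (-1) -> z <> RtoC 1 -> (q * q = (z - 1) / (z + 1))%C ->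
  (1 - q)%C <> RtoC 0 /\ (1 + q)%C <> RtoC 0 /\ q <> RtoC 0 /\
  (z + 1 = (1 + 1) / ((1 - q) * (1 + q)))%C.
Proof.
  intros H1 H2 E.
  pose proof (plus_1_neq_0 z H1) as Z1; pose proof (minus_1_neq_0 z H2) as Z2.
  assert (K : ((1 - q) * (1 + q) * (z + 1) = 1 + 1)%C).
  { transitivity ((1 - q * q) * (z + 1))%C; [ring|]. rewrite E; field; exact Z1. }
  assert (N : ((1 - q) * (1 + q))%C <> RtoC 0).
  { intros Z; apply two_neq_0; rewrite <- K, Z; ring. }
  assert (N1 : (1 - q)%C <> RtoC 0) by (intros Z; apply N; rewrite Z; ring).
  assert (N2 : (1 + q)%C <> RtoC 0) by (intros Z; apply N; rewrite Z; ring).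
  split; [exact N1|split; [exact N2|split]].
  - intros Z; apply Z2. transitivity ((z - 1) / (z + 1) * (z + 1))%C; [field; exact Z1|].
    rewrite <- E, Z; ring.
  - rewrite <- K; field; auto.
Qed.

Lemma r_of_eq (q z : C) : z <> RtoC (-1) -> z <> RtoC 1 -> (q * q = (z - 1) / (z + 1))%C ->
  r_of q = ((z + 1) * q)%C.
Proof.
  intros H1 H2 E; destruct (q_facts q z H1 H2 E) as [N1 [N2 [_ K]]].
  rewrite K; unfold r_of; field; auto.
Qed.

Lemma r_of_square (q z : C) : z <> RtoC (-1) -> z <> RtoC 1 -> (q * q = (z - 1) / (z + 1))%C ->
  (r_of q * r_of q = z * z - 1)%C.
Proof.
  intros H1 H2 E; rewrite (r_of_eq q z H1 H2 E).
  transitivity ((z + 1) * (z + 1) * (q * q))%C; [ring|]. rewrite E.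
  field. now apply plus_1_neq_0.
Qed.

Lemma v_of_eq (q z : C) : z <> RtoC (-1) -> z <> RtoC 1 -> (q * q = (z - 1) / (z + 1))%C ->
  v_of q = (z + r_of q)%C.
Proof.
  intros H1 H2 E; destruct (q_facts q z H1 H2 E) as [N1 [N2 [_ K]]].
  transitivity (z + 1 - 1 + r_of q)%C; [|ring]. rewrite K; unfold r_of, v_of; field; auto.
Qed.

Lemma v_of_Joukowski (q z : C) : z <> RtoC (-1) -> z <> RtoC 1 -> (q * q = (z - 1) / (z + 1))%C ->
  v_of q <> RtoC 0 /\ (z + z = v_of q + / v_of q)%C.
Proof.
  intros H1 H2 E; destruct (q_facts q z H1 H2 E) as [N1 [N2 [_ K]]].
  split.
  - unfold v_of; intros Z; apply N2. transitivity ((1 + q) / (1 - q) * (1 - q))%C; [field; exact N1|].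
    rewrite Z; ring.
  - transitivity (z + 1 + (z + 1) - (1 + 1))%C; [ring|]. rewrite K; unfold v_of; field; auto.
Qed.

(** The Joukowski map sends the negative axis onto the ray. *)
Lemma slit_off_ray (v z : C) : v <> RtoC 0 -> (z + z = v + / v)%C -> ~ ray z -> slit v.
Proof.
  intros V E HR; apply slit_iff; intros [HI HV]; apply HR.
  set (a := - Re v). assert (X : v = RtoC (- a)).
  { unfold a; rewrite Ropp_involutive; destruct v as [x y]; simpl in *; now subst y. }
  assert (Ha : 0 < a).
  { destruct (Req_dec a 0) as [Z|N]; [|unfold a in *; lra].
    exfalso; apply V; rewrite X, Z, Ropp_0; reflexivity. }
  rewrite X, <- RtoC_inv, <- RtoC_plus in E by lra.
  pose proof (f_equal Re E) as E1; pose proof (f_equal Im E) as E2.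
  rewrite re_plus in E1; rewrite im_plus in E2; simpl in E1, E2.
  change (fst z) with (Re z) in E1; change (snd z) with (Im z) in E2.
  split; [lra|].
  assert (I : 1 <= a * / a) by (rewrite Rinv_r; lra).
  replace (/ - a) with (- / a) in E1 by (field; lra).
  assert (0 < / a) by now apply Rinv_0_lt_compat.
  assert (2 <= a + / a).
  { assert (0 <= (a - 1) * (a - 1) * / a) by (apply Rmult_le_pos; [apply (Rle_0_sqr (a - 1))|lra]).
    replace ((a - 1) * (a - 1) * / a) with (a + / a - 2) in H0 by (field; lra). lra. }
  lra.
Qed.

(** The genus 0 h-function in the coordinate q; it is odd in q. *)
Definition h_of (s q : C) : C := ((1 + 1) * Clog (v_of q) - s * r_of q)%C.

Lemma v_of_opp (q : C) : (1 - q)%C <> RtoC 0 -> (1 + q)%C <> RtoC 0 -> v_of (- q) = (/ v_of q)%C.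
Proof.
  intros N1 N2; unfold v_of.
  replace (1 - - q)%C with (1 + q)%C by ring. field; auto.
Qed.

Lemma r_of_opp (q : C) : (1 - q)%C <> RtoC 0 -> (1 + q)%C <> RtoC 0 -> r_of (- q) = (- r_of q)%C.
Proof.
  intros N1 N2; unfold r_of.
  replace (1 - - q)%C with (1 + q)%C by ring. replace (1 + - q)%C with (1 - q)%C by ring. field; auto.
Qed.

Lemma h_of_opp (s q : C) : (1 - q)%C <> RtoC 0 -> (1 + q)%C <> RtoC 0 ->
  slit (v_of q) -> slit (v_of (- q)) -> h_of s (- q) = (- h_of s q)%C.
Proof.
  intros N1 N2 S1 S2; unfold h_of; rewrite r_of_opp by assumption.
  rewrite v_of_opp in * by assumption. rewrite Clog_inv by assumption. ring.
Qed.

Lemma Re_h_of (s q z : C) : z <> RtoC (-1) -> z <> RtoC 1 -> (q * q = (z - 1) / (z + 1))%C ->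
  Re (h_of s q) = edge_height s z (r_of q).
Proof.
  intros H1 H2 E; unfold h_of, edge_height; rewrite <- (v_of_eq q z H1 H2 E).
  unfold Clog, Re; simpl; ring.
Qed.

Lemma v_of_cont (q : C) : (1 - q)%C <> RtoC 0 -> Ccont v_of q.
Proof.
  intros N; apply Clim_div; [exact N| |].
  - apply Clim_plus; [apply Clim_const|apply Ccont_id].
  - apply Clim_minus; [apply Clim_const|apply Ccont_id].
Qed.

Lemma r_of_cont (q : C) : (1 - q)%C <> RtoC 0 -> (1 + q)%C <> RtoC 0 -> Ccont r_of q.
Proof.
  intros N1 N2; apply Clim_div; [now apply Cmult_neq_0| |].
  - apply Clim_mult; [apply Clim_const|apply Ccont_id].
  - apply Clim_mult; [apply Clim_minus|apply Clim_plus]; try apply Clim_const; apply Ccont_id.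
Qed.

Lemma h_of_cont (s q : C) : (1 - q)%C <> RtoC 0 -> (1 + q)%C <> RtoC 0 -> slit (v_of q) -> Ccont (h_of s) q.
Proof.
  intros N1 N2 S; apply Clim_minus.
  - apply Clim_mult; [apply Clim_const|].
    apply (Ccont_comp v_of Clog); [now apply v_of_cont|now apply Clog_cont].
  - apply Clim_mult; [apply Clim_const|now apply r_of_cont].
Qed.

Lemma h_of_derive (s q : C) : (1 - q)%C <> RtoC 0 -> (1 + q)%C <> RtoC 0 -> slit (v_of q) ->
  Cderiv (h_of s) q ((1 + 1) / ((1 - q) * (1 + q)) *
    ((1 + 1) - s * ((1 + q * q) / ((1 - q) * (1 + q)))))%C.
Proof.
  intros N1 N2 S.
  pose proof (slit_neq_0 _ S) as V0.
  assert (D1 : Cderiv (fun q => 1 - q)%C q (0 - 1)%C)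
    by (apply Cderiv_minus; [apply Cderiv_const|apply Cderiv_id]).
  assert (D2 : Cderiv (fun q => 1 + q)%C q (0 + 1)%C)
    by (apply Cderiv_plus; [apply Cderiv_const|apply Cderiv_id]).
  assert (DV : Cderiv v_of q ((0 + 1) * / (1 - q) + (1 + q) * (- (0 - 1) / ((1 - q) * (1 - q))))%C).
  { apply (Cderiv_mult (fun q => 1 + q)%C (fun q => / (1 - q))%C); [exact D2|now apply Cderiv_inv]. }
  assert (DP : Cderiv (fun q => (1 - q) * (1 + q))%C q ((0 - 1) * (1 + q) + (1 - q) * (0 + 1))%C)
    by (apply Cderiv_mult; assumption).
  assert (NP : ((1 - q) * (1 + q))%C <> RtoC 0) by now apply Cmult_neq_0.
  assert (DR : Cderiv r_of q ((0 * q + (1 + 1) * 1) * / ((1 - q) * (1 + q)) + (1 + 1) * q *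
    (- ((0 - 1) * (1 + q) + (1 - q) * (0 + 1)) / ((1 - q) * (1 + q) * ((1 - q) * (1 + q)))))%C).
  { apply (Cderiv_mult (fun q => (1 + 1) * q)%C (fun q => / ((1 - q) * (1 + q)))%C).
    - apply (Cderiv_mult (fun _ => (1 + 1)%C) (fun q => q)); [apply Cderiv_const|apply Cderiv_id].
    - now apply (Cderiv_inv (fun q => (1 - q) * (1 + q))%C). }
  assert (DL : Cderiv (fun q => Clog (v_of q)) q (/ v_of q *
    ((0 + 1) * / (1 - q) + (1 + q) * (- (0 - 1) / ((1 - q) * (1 - q)))))%C)
    by (apply (Cderiv_comp v_of Clog); [exact DV|now apply Clog_derive]).
  assert (D : Cderiv (h_of s) q
    ((0 * Clog (v_of q) + (1 + 1) * (/ v_of q *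
    ((0 + 1) * / (1 - q) + (1 + q) * (- (0 - 1) / ((1 - q) * (1 - q)))))) -
    (0 * r_of q + s * ((0 * q + (1 + 1) * 1) * / ((1 - q) * (1 + q)) + (1 + 1) * q *
    (- ((0 - 1) * (1 + q) + (1 - q) * (0 + 1)) / ((1 - q) * (1 + q) * ((1 - q) * (1 + q)))))))%C).
  { apply (Cderiv_minus (fun q => (1 + 1) * Clog (v_of q))%C (fun q => s * r_of q)%C).
    - apply (Cderiv_mult (fun _ => (1 + 1)%C) (fun q => Clog (v_of q))); [apply Cderiv_const|exact DL].
    - apply (Cderiv_mult (fun _ => s) r_of); [apply Cderiv_const|exact DR]. }
  match type of D with Cderiv _ _ ?x => match goal with |- Cderiv _ _ ?y =>
    replace y with x; [exact D|] end end.
  unfold v_of; field; auto.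
Qed.

(** The unit vector e^(i beta), where tau = tan beta. *)
Definition kap : C := (B / RtoC (sqrt (1 + tau * tau)))%C.

Lemma sqrt_tau_pos : 0 < sqrt (1 + tau * tau).
Proof. apply sqrt_lt_R0; nra. Qed.

Lemma kap_square : (kap * kap = B / A)%C.
Proof.
  pose proof sqrt_tau_pos as S.
  assert (Q : (RtoC (sqrt (1 + tau * tau)) * RtoC (sqrt (1 + tau * tau)) = A * B)%C).
  { rewrite <- RtoC_mult, sqrt_sqrt by nra. unfold A, B; apply injective_projections; simpl; ring. }
  assert (N : RtoC (sqrt (1 + tau * tau)) <> RtoC 0) by RtoC_neq.
  unfold kap. transitivity (B * B / (RtoC (sqrt (1 + tau * tau)) * RtoC (sqrt (1 + tau * tau))))%C;
    [field; exact N|].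
  rewrite Q; field; repeat split; first [apply A_neq_0|apply B_neq_0].
Qed.

Lemma kap_neq_0 : kap <> RtoC 0.
Proof.
  intros E; pose proof kap_square as K; rewrite E in K.
  apply B_neq_0; transitivity (B / A * A)%C; [field; apply A_neq_0|]. rewrite <- K; ring.
Qed.

Definition q_of (z : C) : C := (kap * Csqrt (xi z))%C.

Lemma sq_scaled (z p : C) : z <> RtoC (-1) -> (p * p = xi z)%C ->
  (kap * p * (kap * p) = (z - 1) / (z + 1))%C.
Proof.
  intros Hz E. transitivity (kap * kap * (p * p))%C; [ring|].
  rewrite kap_square, E; unfold xi; field.
  repeat split; first [now apply plus_1_neq_0|apply A_neq_0|apply B_neq_0].
Qed.

Lemma q_of_square (z : C) : off_cut z -> (q_of z * q_of z = (z - 1) / (z + 1))%C.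
Proof.
  intros H; destruct (off_cut_edges z H) as [H1 _].
  apply sq_scaled; [exact H1|]. now apply Csqrt_square, xi_slit.
Qed.

Lemma off_ray (z : C) : ~ Omega G z -> ~ ray z.
Proof. intros H K; apply H; now left. Qed.

Lemma Cderiv_xi (z : C) : z <> RtoC (-1) -> Cderiv xi z (A / B * ((1 + 1) / ((z + 1) * (z + 1))))%C.
Proof.
  intros Hz; pose proof (plus_1_neq_0 z Hz) as N.
  assert (D : Cderiv xi z (0 * ((z - 1) / (z + 1)) + A / B *
    ((1 - 0) * / (z + 1) + (z - 1) * (- (1 + 0) / ((z + 1) * (z + 1)))))%C).
  { apply (Cderiv_mult (fun _ => A / B)%C (fun z => (z - 1) / (z + 1))%C); [apply Cderiv_const|].
    apply (Cderiv_mult (fun z => z - 1)%C (fun z => / (z + 1))%C).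
    - apply Cderiv_minus; [apply Cderiv_id|apply Cderiv_const].
    - apply (Cderiv_inv (fun z => z + 1)%C); [exact N|].
      apply Cderiv_plus; [apply Cderiv_id|apply Cderiv_const]. }
  match type of D with Cderiv _ _ ?x => match goal with |- Cderiv _ _ ?y =>
    replace y with x; [exact D|] end end.
  field; repeat split; first [exact N|apply B_neq_0].
Qed.

Definition h_arc (s z : C) : C := h_of s (q_of z).

Lemma h_arc_derive (s z : C) : ~ Omega G z ->
  Cderiv (h_arc s) z ((2 - s * z) / r_of (q_of z))%C.
Proof.
  intros HO; pose proof (off_Omega_cut z HO) as H.
  destruct (off_cut_edges z H) as [H1 H2].
  pose proof (q_of_square z H) as E.
  destruct (q_facts _ z H1 H2 E) as [N1 [N2 [N3 K]]].
  destruct (v_of_Joukowski _ z H1 H2 E) as [V0 VJ].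
  pose proof (slit_off_ray _ z V0 VJ (off_ray z HO)) as SV.
  pose proof (xi_slit z H) as SX.
  assert (P0 : Csqrt (xi z) <> RtoC 0).
  { intros Z; apply N3; unfold q_of; rewrite Z; ring. }
  pose proof (plus_1_neq_0 z H1) as Z1.
  assert (DQ : Cderiv q_of z (0 * Csqrt (xi z) + kap * (1 / (2 * Csqrt (xi z)) *
    (A / B * ((1 + 1) / ((z + 1) * (z + 1))))))%C).
  { apply (Cderiv_mult (fun _ => kap) (fun z => Csqrt (xi z))); [apply Cderiv_const|].
    apply (Cderiv_comp xi Csqrt); [now apply Cderiv_xi|now apply Csqrt_derive]. }
  pose proof (Cderiv_comp q_of (h_of s) z _ _ DQ (h_of_derive s (q_of z) N1 N2 SV)) as D.
  match type of D with Cderiv _ _ ?x => match goal with |- Cderiv _ _ ?y =>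
    replace y with x; [exact D|] end end.
  rewrite (r_of_eq _ z H1 H2 E).
  assert (Q1 : (0 * Csqrt (xi z) + kap * (1 / (2 * Csqrt (xi z)) *
    (A / B * ((1 + 1) / ((z + 1) * (z + 1))))) = 1 / (q_of z * ((z + 1) * (z + 1))))%C).
  { assert (KK : (A / B = 1 / (kap * kap))%C).
    { rewrite kap_square; field; repeat split; first [apply A_neq_0|apply B_neq_0]. }
    rewrite KK, RtoC_2; unfold q_of. field.
    pose proof kap_neq_0; pose proof two_neq_0; repeat split; assumption. }
  rewrite Q1.
  assert (Q2 : ((1 + q_of z * q_of z) / ((1 - q_of z) * (1 + q_of z)) = z)%C).
  { transitivity ((1 + 1) / ((1 - q_of z) * (1 + q_of z)) - 1)%C; [field; auto|]. rewrite <- K; ring. }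
  rewrite Q2, <- K, RtoC_2. field; auto.
Qed.

(** * Jumps of h across its cut and the ray *)

Lemma Joukowski_Im (v z : C) : v <> RtoC 0 -> (z + z = v + / v)%C -> 1 < Cmod v ->
  (0 < Im z -> 0 < Im v) /\ (Im z < 0 -> Im v < 0).
Proof.
  intros V E H.
  assert (M : Cmod v * Cmod v = Re v * Re v + Im v * Im v).
  { pose proof (Cmod2_alt v); simpl in *; lra. }
  assert (K : 2 * Im z * (Cmod v * Cmod v) = Im v * (Cmod v * Cmod v - 1)).
  { assert (X : ((z + z) * RtoC (Cmod v * Cmod v) = v * RtoC (Cmod v * Cmod v) + Cconj v)%C).
    { rewrite E. replace (RtoC (Cmod v * Cmod v)) with (v * Cconj v)%C; [field; exact V|].
      rewrite <- Cmod2_conj; f_equal; ring. }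
    apply (f_equal Im) in X. rewrite im_plus, !im_scal_r, im_plus, im_conj in X. lra. }
  assert (P : 0 < Cmod v * Cmod v - 1) by nra.
  split; intros Z; nra.
Qed.

Lemma v_of_gt_1 (q : C) : (1 - q)%C <> RtoC 0 -> 0 < Re q -> 1 < Cmod (v_of q).
Proof.
  intros N P; unfold v_of; rewrite Cmod_div by exact N.
  assert (N' : 0 < Cmod (1 - q)) by now apply Cmod_gt_0.
  apply Rmult_lt_reg_r with (Cmod (1 - q)); [exact N'|].
  unfold Rdiv; rewrite Rmult_assoc, Rinv_l, Rmult_1_l, Rmult_1_r by lra.
  pose proof (Cmod2_alt (1 - q)) as E1; pose proof (Cmod2_alt (1 + q)) as E2.
  replace (Re (1 - q)) with (1 - Re q) in E1 by re_im_ring. replace (Im (1 - q)) with (- Im q) in E1 by re_im_ring.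
  replace (Re (1 + q)) with (1 + Re q) in E2 by re_im_ring. replace (Im (1 + q)) with (Im q) in E2 by re_im_ring.
  pose proof (Cmod_ge_0 (1 + q)). nra.
Qed.

(** The branch of q is the one in the half-plane bounded by the two sides of
    the cut; this half-plane contains 1, the image of infinity. *)
Lemma q_of_side (z : C) : slit (xi z) -> 0 < Re (A * q_of z).
Proof.
  intros H; pose proof (Csqrt_Re_pos _ H) as P; pose proof sqrt_tau_pos as S.
  assert (N : RtoC (sqrt (1 + tau * tau)) <> RtoC 0) by RtoC_neq.
  assert (E : (A * q_of z = RtoC (sqrt (1 + tau * tau)) * Csqrt (xi z))%C).
  { assert (Q : (A * B = RtoC (sqrt (1 + tau * tau)) * RtoC (sqrt (1 + tau * tau)))%C).
    { rewrite <- RtoC_mult, sqrt_sqrt by nra. unfold A, B; apply injective_projections; simpl; ring. }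
    unfold q_of, kap.
    transitivity (A * B * Csqrt (xi z) / RtoC (sqrt (1 + tau * tau)))%C; [field; exact N|].
    rewrite Q; field; exact N. }
  rewrite E, re_scal_l; nra.
Qed.

Lemma xi_cont (z : C) : z <> RtoC (-1) -> Ccont xi z.
Proof. intros H; eapply Cderiv_Ccont, Cderiv_xi, H. Qed.

Lemma q_of_cont (z : C) : off_cut z -> Ccont q_of z.
Proof.
  intros H; apply Clim_mult; [apply Clim_const|].
  apply (Ccont_comp xi Csqrt); [now apply xi_cont, off_cut_edges|now apply Csqrt_cont, xi_slit].
Qed.

Lemma slit_v_of (z q : C) : z <> RtoC (-1) -> z <> RtoC 1 -> (q * q = (z - 1) / (z + 1))%C ->
  ~ ray z -> slit (v_of q).
Proof.
  intros H1 H2 E HR; destruct (v_of_Joukowski _ _ H1 H2 E) as [V0 VJ].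
  now apply (slit_off_ray _ z).
Qed.

Lemma ray_off_cut (x : R) : x < -1 -> off_cut (RtoC x).
Proof.
  intros Hx t Ht E; destruct (Rle_lt_or_eq_dec 0 t) as [Hp|H0]; [lra| |].
  - apply (arc_off_ray t); [lra|rewrite E; split; simpl; lra].
  - subst t; rewrite arc_0 in E; apply RtoC_inj in E; lra.
Qed.

(** On the ray q^2 is real and positive, and the half-plane of q contains the
    positive root; since v + 1/v = 2 x is negative, so is the real number v.
    *)
Lemma v_of_on_ray (x : R) : x < -1 ->
  0 < Re (q_of (RtoC x)) /\ exists a, 0 < a /\ v_of (q_of (RtoC x)) = RtoC (- a).
Proof.
  intros Hx; pose proof (ray_off_cut x Hx) as HC.
  destruct (off_cut_edges _ HC) as [H1 H2].
  pose proof (q_of_square _ HC) as E.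
  destruct (v_of_Joukowski _ _ H1 H2 E) as [V0 VJ].
  destruct (q_facts _ _ H1 H2 E) as [N1 [N2 _]].
  pose proof (q_of_side _ (xi_slit _ HC)) as P.
  set (q := q_of (RtoC x)) in *.
  assert (K : Im q = 0).
  { assert (QQ : (q * q)%C = RtoC ((x - 1) / (x + 1))).
    { rewrite E, RtoC_div, RtoC_minus, RtoC_plus by lra; reflexivity. }
    assert (Pos : 0 < (x - 1) / (x + 1)).
    { replace ((x - 1) / (x + 1)) with ((1 - x) / (- x - 1)) by (field; lra). apply Rdiv_lt_0_compat; lra. }
    pose proof (f_equal Re QQ) as Q1; pose proof (f_equal Im QQ) as Q2.
    replace (Re (q * q)) with (Re q * Re q - Im q * Im q) in Q1 by re_im_ring.
    replace (Im (q * q)) with (2 * (Re q * Im q)) in Q2 by re_im_ring.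
    rewrite re_RtoC in Q1; rewrite im_RtoC in Q2.
    assert (Re q * Im q = 0) by lra. apply Rmult_integral in H; destruct H as [H|H]; [|exact H].
    rewrite H in Q1; nra. }
  assert (X : q = RtoC (Re q)) by (now apply RtoC_Re).
  assert (Q0 : 0 < Re q).
  { replace (Re (A * q)) with (Re q) in P; [exact P|]. unfold A; rewrite X; simpl; ring. }
  split; [exact Q0|].
  assert (N1' : 1 - Re q <> 0).
  { intros Z; apply N1; rewrite X, <- RtoC_minus, Z; reflexivity. }
  assert (V : v_of q = RtoC ((1 + Re q) / (1 - Re q))).
  { rewrite RtoC_div, RtoC_plus, RtoC_minus by exact N1'. unfold v_of; now rewrite <- X. }
  exists (- ((1 + Re q) / (1 - Re q))); split; [|now rewrite Ropp_involutive].
  set (y := (1 + Re q) / (1 - Re q)) in *.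
  assert (Y0 : y <> 0) by (intros Z; apply V0; rewrite V, Z; reflexivity).
  rewrite V, <- RtoC_inv, <- !RtoC_plus in VJ by exact Y0. apply RtoC_inj in VJ.
  destruct (Rlt_dec y 0) as [|Hy]; [lra|exfalso].
  assert (0 < / y) by (apply Rinv_0_lt_compat; lra). lra.
Qed.

(** Across the negative v-axis the argument of v jumps by 2 pi, and h contains
    log v twice. *)
Lemma h_arc_ray_jump (s : C) (x : R) : x < -1 ->
  difference_jump RtoC (fun _ => RtoC 1) (h_arc s) x (RtoC (4 * PI * 1) * Ci)%C.
Proof.
  intros Hx; pose proof (ray_off_cut x Hx) as HC.
  destruct (v_of_on_ray x Hx) as [Q0 [a [Ha V]]].
  destruct (off_cut_edges _ HC) as [H1 H2].
  destruct (q_facts _ _ H1 H2 (q_of_square _ HC)) as [N1 [N2 _]].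
  set (fL := fun z => ((1 + 1) * (Clog (- Ci * v_of (q_of z)) + iPI2) - s * r_of (q_of z))%C).
  set (fR := fun z => ((1 + 1) * (Clog (Ci * v_of (q_of z)) - iPI2) - s * r_of (q_of z))%C).
  assert (CG : path_continuous RtoC x).
  { apply (continuous_of_Ccont (fun z => z)), Ccont_id. }
  assert (CD : path_continuous (fun _ => RtoC 1) x) by apply continuous_const.
  assert (CV : Ccont (fun z => v_of (q_of z)) (RtoC x)).
  { apply (Ccont_comp q_of v_of); [now apply q_of_cont|now apply v_of_cont]. }
  assert (CR : Ccont (fun z => r_of (q_of z)) (RtoC x)).
  { apply (Ccont_comp q_of r_of); [now apply q_of_cont|now apply r_of_cont]. }
  assert (IM1 : Im (- Ci * v_of (q_of (RtoC x))) = a) by (rewrite V; simpl; ring).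
  assert (IM2 : Im (Ci * v_of (q_of (RtoC x))) = - a) by (rewrite V; simpl; ring).
  assert (NEAR : near_C (RtoC x) (fun z =>
    (0 < Im z -> h_arc s z = fL z) /\ (Im z < 0 -> h_arc s z = fR z))).
  { assert (K1 : near_C (RtoC x) off_cut).
    { generalize (Sigma_closed G (RtoC x) HC); apply filter_imp; intros z Hz t Ht; now apply (Hz t Ht). }
    assert (K2 : near_C (RtoC x) (fun z => 0 < Re (q_of z))).
    { apply (Clim_Re q_of _ (q_of_cont _ HC) (fun y => 0 < y)), (open_gt 0), Q0. }
    generalize (filter_and _ _ K1 K2); apply filter_imp; intros z [Z1 Z2].
    destruct (off_cut_edges _ Z1) as [E1 E2].
    pose proof (q_of_square _ Z1) as SQ.
    destruct (q_facts _ _ E1 E2 SQ) as [M1 _].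
    destruct (v_of_Joukowski _ _ E1 E2 SQ) as [V0 VJ].
    destruct (Joukowski_Im _ _ V0 VJ (v_of_gt_1 _ M1 Z2)) as [J1 J2].
    unfold h_arc, h_of, fL, fR; split; intros HI.
    - now rewrite (Clog_upper (v_of (q_of z))) by auto.
    - now rewrite (Clog_lower (v_of (q_of z))) by auto. }
  destruct NEAR as [d [Hd NEAR]].
  exists (fL (RtoC x)), (fR (RtoC x)); split; [|split].
  - apply (left_value_intro RtoC (fun _ => RtoC 1) (h_arc s) fL x CG CD).
    + unfold fL; apply Clim_minus; [|apply Clim_mult; [apply Clim_const|exact CR]].
      apply Clim_mult; [apply Clim_const|apply Clim_plus; [|apply Clim_const]].
      apply (Ccont_comp (fun z => - Ci * v_of (q_of z))%C Clog); [|apply Clog_cont, slit_Im; rewrite IM1; lra].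
      apply Clim_mult; [apply Clim_const|exact CV].
    + destruct (collar_close RtoC (fun _ => RtoC 1) x d CG CD Hd) as [d' [Hd' K]].
      exists d'; split; [exact Hd'|]; intros u e Hu He.
      apply NEAR; [now apply K|]. unfold collar; simpl; lra.
  - apply (right_value_intro RtoC (fun _ => RtoC 1) (h_arc s) fR x CG CD).
    + unfold fR; apply Clim_minus; [|apply Clim_mult; [apply Clim_const|exact CR]].
      apply Clim_mult; [apply Clim_const|apply Clim_minus; [|apply Clim_const]].
      apply (Ccont_comp (fun z => Ci * v_of (q_of z))%C Clog); [|apply Clog_cont, slit_Im; rewrite IM2; lra].
      apply Clim_mult; [apply Clim_const|exact CV].
    + destruct (collar_close_neg RtoC (fun _ => RtoC 1) x d CG CD Hd) as [d' [Hd' K]].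
      exists d'; split; [exact Hd'|]; intros u e Hu He.
      apply NEAR; [now apply K|]. unfold collar; simpl; lra.
  - unfold fL, fR; rewrite V.
    assert (L1 : Clog (- Ci * RtoC (- a)) = (Clog (RtoC a) + iPI2)%C).
    { rewrite Clog_upper by (rewrite <- V, IM1; exact Ha).
      f_equal; f_equal. rewrite RtoC_opp. transitivity (- (Ci * Ci) * RtoC a)%C; [|rewrite Ci_square]; ring. }
    assert (L2 : Clog (Ci * RtoC (- a)) = (Clog (RtoC a) - iPI2)%C).
    { rewrite Clog_lower by (rewrite <- V, IM2; lra).
      f_equal; f_equal. rewrite RtoC_opp. transitivity (- (Ci * Ci) * RtoC a)%C; [|rewrite Ci_square]; ring. }
    rewrite L1, L2.
    transitivity ((1 + 1) * ((1 + 1) * ((1 + 1) * iPI2)))%C; [ring|].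
    unfold iPI2; apply injective_projections; simpl; field.
Qed.

(** Along the arc xi is real with derivative 1 / t^2, so the displacement by i
    e times the tangent changes Im xi by about e / t^2. *)
Lemma xi_collar_side (t : R) : 0 < t -> exists delta, 0 < delta /\ forall u e,
  Rabs (u - t) < delta -> Rabs e < delta ->
  Im (xi (collar (fun t => arc (RtoC t)) (fun t => arc' (RtoC t)) u e)) = 0 /\ e = 0 \/
  0 < e * Im (xi (collar (fun t => arc (RtoC t)) (fun t => arc' (RtoC t)) u e)).
Proof.
  intros Ht.
  set (g := fun t => arc (RtoC t)). set (dg := fun t => arc' (RtoC t)).
  set (FF := filter_prod (locally t) (locally 0)).
  assert (Cg : Clim FF (fun p => g (fst p)) (g t)).
  { apply Clim_filterlim; [typeclasses eauto|].
    apply (filterlim_comp _ _ _ fst g FF (locally t)); [apply filterlim_fst|].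
    apply (continuous_of_Ccont arc). eapply Cderiv_Ccont, Cderiv_arc, arc_den_neq_0. }
  assert (Cdg : Clim FF (fun p => dg (fst p)) (dg t)).
  { apply Clim_filterlim; [typeclasses eauto|].
    apply (filterlim_comp _ _ _ fst dg FF (locally t)); [apply filterlim_fst|].
    apply (continuous_of_Ccont arc'). apply arc'_cont, arc_den_neq_0. }
  assert (Ce : Clim FF (fun p => RtoC (snd p)) 0) by (apply Clim_RtoC, filterlim_snd).
  assert (Cc : Clim FF (fun p => collar g dg (fst p) (snd p)) (g t)).
  { unfold collar. replace (g t) with (g t + Ci * 0 * dg t)%C at 1 by ring.
    apply Clim_plus; [exact Cg|]. apply Clim_mult; [|exact Cdg].
    apply Clim_mult; [apply Clim_const|exact Ce]. }
  pose proof A_neq_0 as A0; pose proof B_neq_0 as B0; pose proof (arc_den_neq_0 t) as D0.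
  assert (T0 : RtoC t <> RtoC 0) by RtoC_neq.
  assert (G1 : (g t + 1)%C <> RtoC 0).
  { unfold g; rewrite arc_plus_1. intros E.
    apply (Cmult_neq_0 ((1 + 1) * RtoC t) A); [apply Cmult_neq_0; [apply two_neq_0|exact T0]|exact A0|].
    transitivity ((1 + 1) * RtoC t * A / arc_den (RtoC t) * arc_den (RtoC t))%C; [field; exact D0|].
    rewrite E; ring. }
  set (K := fun p : R * R => (A / B * ((1 + 1) * dg (fst p) /
    ((g (fst p) + 1) * (collar g dg (fst p) (snd p) + 1))))%C).
  assert (CK : Clim FF K (A / B * ((1 + 1) * dg t / ((g t + 1) * (g t + 1))))%C).
  { apply Clim_mult; [apply Clim_const|]. apply Clim_div; [now apply Cmult_neq_0| |].
    - apply Clim_mult; [apply Clim_const|exact Cdg].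
    - apply Clim_mult; (apply Clim_plus; [assumption|apply Clim_const]). }
  assert (VK : (A / B * ((1 + 1) * dg t / ((g t + 1) * (g t + 1))))%C = RtoC (1 / (t * t))).
  { unfold dg, g. rewrite arc_plus_1. unfold arc'.
    rewrite RtoC_div, RtoC_mult by nra. field. repeat split; assumption. }
  rewrite VK in CK.
  assert (EV : FF (fun p => (0 < Re (K p) /\ 0 < fst p) /\
    ((g (fst p) + 1)%C <> RtoC 0 /\ (collar g dg (fst p) (snd p) + 1)%C <> RtoC 0))).
  { apply filter_and; [apply filter_and|].
    - apply (Clim_Re K _ CK (fun y => 0 < y)), (open_gt 0). simpl.
      apply Rdiv_lt_0_compat; nra.
    - assert (FL : filterlim fst FF (locally t)) by apply filterlim_fst.
      apply (FL (fun y => 0 < y)), (open_gt 0), Ht.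
    - destruct (near_C_neq _ _ G1) as [d [Hd Kd]].
      apply filter_and.
      + assert (CL : Clim FF (fun p => g (fst p) + 1)%C (g t + 1)%C) by (apply Clim_plus; [exact Cg|apply Clim_const]).
        generalize (CL d Hd); apply filter_imp; intros p; apply Kd.
      + assert (CL : Clim FF (fun p => collar g dg (fst p) (snd p) + 1)%C (g t + 1)%C) by (apply Clim_plus; [exact Cc|apply Clim_const]).
        generalize (CL d Hd); apply filter_imp; intros p; apply Kd. }
  destruct EV as [Q1 Q2 [d1 H1] [d2 H2] HQ].
  exists (Rmin d1 d2); split; [apply Rmin_pos; apply cond_pos|].
  intros u e Hu He.
  destruct (HQ u e) as [[K1 K2] [K3 K4]].
  { apply H1. change (Rabs (u - t) < d1). eapply Rlt_le_trans; [exact Hu|apply Rmin_l]. }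
  { apply H2. change (Rabs (e - 0) < d2). rewrite Rminus_0_r. eapply Rlt_le_trans; [exact He|apply Rmin_r]. }
  change (fst (u, e)) with u in *; change (snd (u, e)) with e in *. set (z := collar g dg u e) in *.
  assert (X : xi z = (RtoC (- ((1 - u) / u)) + Ci * RtoC e * K (u, e))%C).
  { rewrite <- (xi_arc u) by lra. unfold K, xi; simpl. fold z. change (arc (RtoC u)) with (g u).
    assert (Z : z = (g u + Ci * RtoC e * dg u)%C) by reflexivity.
    transitivity (A / B * ((g u - 1) / (g u + 1)) + A / B * ((1 + 1) * (z - g u) / ((g u + 1) * (z + 1))))%C.
    - field. repeat split; assumption.
    - rewrite Z at 1. unfold Cdiv; ring. }
  assert (I : Im (xi z) = e * Re (K (u, e))).
  { rewrite X; generalize (K (u, e)); intros [k1 k2]; simpl; ring. }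
  rewrite I. destruct (Req_dec e 0) as [->|N]; [left; lra|right].
  rewrite <- Rmult_assoc. apply Rmult_lt_0_compat; [apply (Rsqr_pos_lt e N)|exact K1].
Qed.

(** The two sides of the cut carry opposite values of q, and h is odd in q. *)
Lemma h_arc_main_jump (s : C) (t : R) : 0 < t < 1 ->
  sum_jump (fun t => arc (RtoC t)) (fun t => arc' (RtoC t)) (h_arc s) t 0.
Proof.
  intros Ht. set (g := fun t => arc (RtoC t)). set (dg := fun t => arc' (RtoC t)).
  assert (CG : path_continuous g t).
  { apply (continuous_of_Ccont arc). eapply Cderiv_Ccont, Cderiv_arc, arc_den_neq_0. }
  assert (CD : path_continuous dg t).
  { apply (continuous_of_Ccont arc'). apply arc'_cont, arc_den_neq_0. }
  set (z0 := arc (RtoC t)).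
  assert (E1 : z0 <> RtoC (-1)) by (unfold z0; rewrite <- arc_0; intros E; apply arc_inj in E; lra).
  assert (E2 : z0 <> RtoC 1) by (unfold z0; rewrite <- arc_1; intros E; apply arc_inj in E; lra).
  assert (NR : ~ ray z0) by (apply arc_off_ray; lra).
  assert (X0 : (- xi z0)%C = RtoC ((1 - t) / t)).
  { unfold z0; rewrite xi_arc, RtoC_opp by lra; ring. }
  assert (S0 : slit (- xi z0)).
  { apply slit_Re_pos; rewrite X0; simpl; apply Rdiv_lt_0_compat; lra. }
  set (qL := fun z => (kap * (Ci * Csqrt (- xi z)))%C).
  assert (CX : Ccont (fun z => - xi z)%C z0) by (apply Clim_opp; now apply xi_cont).
  assert (CQ : Ccont qL z0).
  { apply Clim_mult; [apply Clim_const|apply Clim_mult; [apply Clim_const|]].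
    apply (Ccont_comp (fun z => - xi z)%C Csqrt); [exact CX|now apply Csqrt_cont]. }
  assert (SQ : (qL z0 * qL z0 = (z0 - 1) / (z0 + 1))%C).
  { apply sq_scaled; [exact E1|].
    transitivity (Ci * Ci * (Csqrt (- xi z0) * Csqrt (- xi z0)))%C; [ring|].
    rewrite Csqrt_square by exact S0. rewrite Ci_square; ring. }
  assert (SQ' : (- qL z0 * - qL z0 = (z0 - 1) / (z0 + 1))%C) by (rewrite <- SQ; ring).
  destruct (q_facts _ _ E1 E2 SQ) as [N1 [N2 _]].
  destruct (q_facts _ _ E1 E2 SQ') as [N1' [N2' _]].
  pose proof (slit_v_of _ _ E1 E2 SQ NR) as V1.
  pose proof (slit_v_of _ _ E1 E2 SQ' NR) as V2.
  destruct (xi_collar_side t (proj1 Ht)) as [d [Hd SIDE]].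
  exists (h_of s (qL z0)), (h_of s (- qL z0)); split; [|split].
  - apply (left_value_intro g dg (h_arc s) (fun z => h_of s (qL z)) t CG CD).
    + apply (Ccont_comp qL (h_of s)); [exact CQ|now apply h_of_cont].
    + exists d; split; [exact Hd|]; intros u e Hu He.
      destruct (SIDE u e Hu) as [[_ Z]|P]; [rewrite Rabs_pos_eq; lra|lra|].
      fold g dg in P. unfold h_arc, q_of, qL. rewrite Csqrt_upper; [reflexivity|].
      apply Rmult_lt_reg_l with e; lra.
  - apply (right_value_intro g dg (h_arc s) (fun z => h_of s (- qL z)%C) t CG CD).
    + apply (Ccont_comp (fun z => - qL z)%C (h_of s)); [now apply Clim_opp|now apply h_of_cont].
    + exists d; split; [exact Hd|]; intros u e Hu He.
      destruct (SIDE u (- e) Hu) as [[_ Z]|P]; [rewrite Rabs_Ropp, Rabs_pos_eq; lra|lra|].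
      fold g dg in P. unfold h_arc, q_of, qL. rewrite Csqrt_lower; [f_equal; ring|].
      apply Rmult_lt_reg_l with e; lra.
  - rewrite h_of_opp by assumption. ring.
Qed.

(** * Asymptotics of h at infinity *)

Lemma Clog_1 : Clog 1 = 0.
Proof. rewrite Clog_pos by lra; now rewrite ln_1. Qed.

Lemma Clog_near_1 : exists d, 0 < d /\ forall w, Cmod (w - 1) < d -> Cmod (Clog w) <= 2 * Cmod (w - 1).
Proof.
  destruct (Clog_derive 1) as [phi [P0 [CP EP]]]; [apply slit_Re_pos; simpl; lra|].
  destruct (CP 1 Rlt_0_1) as [d [Hd K]]; exists d; split; [exact Hd|]; intros w Hw.
  specialize (K w Hw); rewrite (EP w), Clog_1, Cplus_0_l, Cmod_mult.
  apply Rmult_le_compat_r; [apply Cmod_ge_0|].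
  pose proof (Cmod_triangle (phi w - phi 1) (phi 1)) as T.
  replace (phi w - phi 1 + phi 1)%C with (phi w) in T by ring.
  assert (Cmod (phi 1) = 1).
  { rewrite P0. replace (/ 1)%C with (RtoC 1) by (field; apply C1_nz). apply Cmod_1. }
  lra.
Qed.

(** At infinity q^2 tends to 1, while q keeps away from -1 since A q and A
    both have positive real part. So q tends to 1, whence |v| > 1, and 2 z = v
    + 1/v bounds |z| by |v|. *)
Lemma far_v_of : exists r, 1 < r /\ forall z, ~ Omega G z -> r < Cmod z ->
  Cmod z <= Cmod (v_of (q_of z)) /\ 1 < Cmod (v_of (q_of z)).
Proof.
  pose proof (Cmod_ge_0 A) as A0.
  exists (2 * Cmod A + 2); split; [lra|]; intros z HO Hz.
  pose proof (off_Omega_cut z HO) as HC.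
  destruct (off_cut_edges _ HC) as [H1 H2].
  pose proof (q_of_square _ HC) as SQ.
  destruct (q_facts _ _ H1 H2 SQ) as [N1 [N2 _]].
  destruct (v_of_Joukowski _ _ H1 H2 SQ) as [V0 VJ].
  pose proof (q_of_side _ (xi_slit _ HC)) as P.
  set (q := q_of z) in *.
  assert (B1 : 1 <= Cmod A * Cmod (1 + q)).
  { rewrite <- Cmod_mult. pose proof (re_le_Cmod (A * (1 + q))) as R.
    replace (Re (A * (1 + q))) with (1 + Re (A * q)) in R by (unfold A; re_im_ring).
    rewrite Rabs_pos_eq in R; lra. }
  pose proof (plus_1_neq_0 z H1) as Z1.
  assert (Zm : Cmod z - 1 <= Cmod (z + 1)).
  { pose proof (Cmod_triangle (z + 1) (- (1))) as T. rewrite Cmod_opp, Cmod_1 in T.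
    replace (z + 1 + - (1))%C with z in T by ring. lra. }
  assert (K : Cmod (1 - q) * Cmod (1 + q) * Cmod (z + 1) = 2).
  { rewrite <- !Cmod_mult. replace ((1 - q) * (1 + q) * (z + 1))%C with (RtoC 2).
    - rewrite Cmod_R, Rabs_pos_eq; lra.
    - rewrite RtoC_2. transitivity ((1 - q * q) * (z + 1))%C; [rewrite SQ; field; exact Z1|ring]. }
  assert (B2 : Cmod (1 - q) < 1).
  { pose proof (Cmod_ge_0 (1 - q)) as X0. pose proof (Cmod_ge_0 (1 + q)) as Y0.
    set (x := Cmod (1 - q)) in *. set (y := Cmod (1 + q)) in *. set (w := Cmod (z + 1)) in *.
    assert (Wa : 2 * Cmod A < w) by lra.
    apply Rnot_le_lt; intros Hx.
    assert (y * w <= 2) by (assert (0 <= y * w) by (apply Rmult_le_pos; lra); nra).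
    assert (0 < y) by nra.
    assert (y * (2 * Cmod A) < y * w) by (apply Rmult_lt_compat_l; lra). nra. }
  assert (Q0 : 0 < Re q).
  { pose proof (re_le_Cmod (1 - q)) as R. replace (Re (1 - q)) with (1 - Re q) in R by re_im_ring.
    apply (Rle_lt_trans _ _ _ R), Rabs_def2 in B2; lra. }
  pose proof (v_of_gt_1 q N1 Q0) as V1.
  split; [|exact V1].
  assert (X : 2 * Cmod z <= Cmod (v_of q) + / Cmod (v_of q)).
  { rewrite <- Cmod_inv by exact V0. replace (2 * Cmod z) with (Cmod (z + z)).
    - rewrite VJ; apply Cmod_triangle.
    - replace (z + z)%C with (RtoC 2 * z)%C by (rewrite RtoC_2; ring).
      rewrite Cmod_mult, Cmod_R, Rabs_pos_eq; lra. }
  assert (/ Cmod (v_of q) <= 1) by (rewrite <- Rinv_1; apply Rinv_le_contravar; lra). lra.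
Qed.

(** v (1 + 1/v^2) = 2 z, and passing to logarithms costs no multiple of 2 pi i
    because Im v and Im z have the same sign. *)
Lemma Clog_far : exists r, 1 < r /\ forall z, ~ Omega G z -> r < Cmod z ->
  Cmod (Clog (v_of (q_of z)) - (Clog z + RtoC (ln 2))) <= 2 / Cmod z.
Proof.
  destruct far_v_of as [r1 [Hr1 FV]].
  destruct Clog_near_1 as [d [Hd LN]].
  exists (Rmax r1 (Rmax (1 + / d) 1)); split; [pose proof (Rmax_l r1 (Rmax (1 + / d) 1)); lra|].
  intros z HO Hz.
  assert (Z1 : r1 < Cmod z) by (eapply Rle_lt_trans; [apply Rmax_l|exact Hz]).
  assert (Zd : 1 + / d < Cmod z) by (eapply Rle_lt_trans; [eapply Rle_trans; [apply Rmax_l|apply Rmax_r]|exact Hz]).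
  destruct (FV z HO Z1) as [VZ V1].
  pose proof (off_Omega_cut z HO) as HC.
  destruct (off_cut_edges _ HC) as [H1 H2].
  pose proof (q_of_square _ HC) as SQ.
  destruct (v_of_Joukowski _ _ H1 H2 SQ) as [V0 VJ].
  pose proof (slit_v_of _ _ H1 H2 SQ (off_ray z HO)) as SV.
  set (v := v_of (q_of z)) in *.
  set (w := (1 + / (v * v))%C).
  assert (WM : Cmod (w - 1) = / (Cmod v * Cmod v)).
  { unfold w; replace (1 + / (v * v) - 1)%C with (/ (v * v))%C by ring.
    rewrite Cmod_inv, Cmod_mult by now apply Cmult_neq_0. reflexivity. }
  assert (W1 : / (Cmod v * Cmod v) <= / Cmod z) by (apply Rinv_le_contravar; nra).
  assert (Dp : 0 < / d) by now apply Rinv_0_lt_compat.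
  assert (W2 : / Cmod z < d).
  { rewrite <- (Rinv_inv d). apply Rinv_lt_contravar; nra. }
  assert (W3 : / (Cmod v * Cmod v) < 1).
  { rewrite <- Rinv_1; apply Rinv_lt_contravar; nra. }
  assert (WR : 0 < Re w).
  { pose proof (re_le_Cmod (w - 1)) as R. rewrite re_minus, re_RtoC, WM in R. apply Rabs_le_between in R. lra. }
  pose proof (slit_Re_pos w WR) as SW.
  assert (SZ : slit z).
  { apply slit_iff; intros [I R]; apply HO; left; split; [exact I|].
    assert (C1 : Cmod z = - Re z) by (rewrite (RtoC_Re z I) at 1; rewrite Cmod_R; now apply Rabs_left1).
    lra. }
  assert (EQ : Clog v = (Clog z + RtoC (ln 2) - Clog w)%C).
  { apply Clog_unique; [exact SV| |].
    - unfold Cminus. rewrite !Cexp_plus, Cexp_Clog by exact SZ.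
      assert (E2 : Cexp (RtoC (ln 2)) = RtoC 2).
      { rewrite <- Clog_pos by lra. apply Cexp_Clog, slit_Re_pos; simpl; lra. }
      assert (EW : Cexp (- Clog w) = (/ w)%C).
      { pose proof (Cexp_opp (Clog w)) as E; rewrite Cexp_Clog in E by exact SW.
        apply (Cmult_eq_l w); [now apply slit_neq_0|]. rewrite E; field; now apply slit_neq_0. }
      rewrite E2, EW.
      assert (W0 : w <> RtoC 0) by now apply slit_neq_0.
      replace (z * RtoC 2)%C with (v * w)%C; [field; exact W0|].
      unfold w; rewrite RtoC_2. transitivity (v + / v)%C; [field; exact V0|rewrite <- VJ; ring].
    - pose proof (Arg_range v) as Av; pose proof (Arg_range z) as Az; pose proof (Arg_Re_pos w WR) as Aw.
      replace (Im (Clog z + RtoC (ln 2) - Clog w)) with (Im (Clog z) - Im (Clog w))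
        by (unfold Cminus; rewrite !im_plus, im_opp, im_RtoC; ring).
      destruct (Joukowski_Im v z V0 VJ V1) as [J1 J2].
      destruct (Rtotal_order (Im z) 0) as [L|[E|L]].
      + pose proof (Arg_Im_neg _ L); pose proof (Arg_Im_neg _ (J2 L)). apply Rabs_def1; lra.
      + assert (I0 : Im (Clog z) = 0).
        { assert (R0 : 0 < Re z).
          { apply Rnot_le_lt; intros R; apply slit_iff in SZ; tauto. }
          rewrite (RtoC_Re z E), Clog_pos by exact R0. apply im_RtoC. }
        apply Rabs_def1; lra.
      + pose proof (Arg_Im_pos _ L); pose proof (Arg_Im_pos _ (J1 L)). apply Rabs_def1; lra. }
  rewrite EQ. replace (Clog z + RtoC (ln 2) - Clog w - (Clog z + RtoC (ln 2)))%C with (- Clog w)%C by ring.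
  rewrite Cmod_opp. eapply Rle_trans; [apply LN; rewrite WM; lra|]. rewrite WM. unfold Rdiv; lra.
Qed.

Lemma v_of_r_of_inverse (z : C) : ~ Omega G z ->
  (z - r_of (q_of z) = / v_of (q_of z))%C /\ (r_of (q_of z) + r_of (q_of z) = v_of (q_of z) - / v_of (q_of z))%C.
Proof.
  intros HO. pose proof (off_Omega_cut z HO) as HC.
  destruct (off_cut_edges _ HC) as [H1 H2].
  pose proof (q_of_square _ HC) as SQ.
  destruct (v_of_Joukowski _ _ H1 H2 SQ) as [V0 VJ].
  pose proof (v_of_eq _ _ H1 H2 SQ) as VE.
  assert (E : (z - r_of (q_of z) = / v_of (q_of z))%C).
  { transitivity (z + z - v_of (q_of z))%C; [rewrite VE; ring|rewrite VJ; ring]. }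
  split; [exact E|]. rewrite <- E, VE; ring.
Qed.

Lemma h_arc_infinity (s : C) : exists (ell : C) (M r : R), 0 < r /\
  forall z, ~ Omega G z -> r < Cmod z ->
    Cmod (h_arc s z - (- s * z - ell + 2 * Clog z)) <= M / Cmod z.
Proof.
  destruct far_v_of as [r1 [Hr1 FV]]. destruct Clog_far as [r2 [Hr2 CF]].
  exists (RtoC (- (2 * ln 2))), (4 + Cmod s), (Rmax r1 r2).
  split; [pose proof (Rmax_l r1 r2); lra|]; intros z HO Hz.
  assert (Z1 : r1 < Cmod z) by (eapply Rle_lt_trans; [apply Rmax_l|exact Hz]).
  assert (Z2 : r2 < Cmod z) by (eapply Rle_lt_trans; [apply Rmax_r|exact Hz]).
  destruct (FV z HO Z1) as [VZ V1]. specialize (CF z HO Z2).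
  destruct (v_of_r_of_inverse z HO) as [VR _].
  unfold h_arc, h_of. rewrite RtoC_opp, RtoC_mult, RtoC_2.
  set (v := v_of (q_of z)) in *.
  replace ((1 + 1) * Clog v - s * r_of (q_of z) - (- s * z - - ((1 + 1) * RtoC (ln 2)) + (1 + 1) * Clog z))%C
    with ((1 + 1) * (Clog v - (Clog z + RtoC (ln 2))) + s * (z - r_of (q_of z)))%C by ring.
  rewrite VR. eapply Rle_trans; [apply Cmod_triangle|].
  assert (V0 : v <> RtoC 0) by (apply Cmod_gt_0; lra).
  rewrite !Cmod_mult, Cmod_inv, <- RtoC_2, Cmod_R, Rabs_pos_eq by (exact V0 || lra).
  assert (/ Cmod v <= / Cmod z) by (apply Rinv_le_contravar; lra).
  pose proof (Cmod_ge_0 s).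
  assert (Cmod s * / Cmod v <= Cmod s * / Cmod z) by (apply Rmult_le_compat_l; lra).
  unfold Rdiv in *; lra.
Qed.

Lemma h_arc_derive_infinity (s : C) : exists M r, 0 < r /\
  forall z, ~ Omega G z -> r < Cmod z -> Cmod (C_derive (h_arc s) z + s) <= M / Cmod z.
Proof.
  destruct far_v_of as [r1 [Hr1 FV]].
  exists (8 + 4 * Cmod s), (r1 + 1); split; [lra|]; intros z HO Hz.
  destruct (FV z HO ltac:(lra)) as [VZ V1].
  destruct (v_of_r_of_inverse z HO) as [VR RR].
  rewrite (Cderiv_C_derive _ _ _ (h_arc_derive s z HO)).
  set (v := v_of (q_of z)) in *. set (R := r_of (q_of z)) in *.
  assert (V0 : v <> RtoC 0) by (apply Cmod_gt_0; lra).
  assert (Vi : / Cmod v <= 1) by (rewrite <- Rinv_1; apply Rinv_le_contravar; lra).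
  assert (RM : Cmod z / 4 <= Cmod R).
  { pose proof (Cmod_triangle (R + R) (/ v)) as T. rewrite Cmod_inv in T by exact V0.
    replace (R + R + / v)%C with v in T by (rewrite RR; ring).
    replace (R + R)%C with (RtoC 2 * R)%C in T by (rewrite RtoC_2; ring).
    rewrite Cmod_mult, Cmod_R, Rabs_pos_eq in T by lra. lra. }
  assert (R0 : R <> RtoC 0) by (apply Cmod_gt_0; lra).
  replace ((2 - s * z) / R + s)%C with ((2 - s * (z - R)) / R)%C by (field; exact R0).
  rewrite VR, Cmod_div by exact R0.
  assert (NM : Cmod (2 - s * / v) <= 2 + Cmod s).
  { unfold Cminus. eapply Rle_trans; [apply Cmod_triangle|].
    rewrite Cmod_opp, Cmod_mult, Cmod_inv, Cmod_R, Rabs_pos_eq by (exact V0 || lra).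
    pose proof (Cmod_ge_0 s). assert (Cmod s * / Cmod v <= Cmod s * 1) by (apply Rmult_le_compat_l; lra). lra. }
  assert (RI : / Cmod R <= 4 * / Cmod z).
  { replace (4 * / Cmod z) with (/ (Cmod z / 4)) by (field; lra). apply Rinv_le_contravar; lra. }
  pose proof (Cmod_ge_0 (2 - s * / v)). pose proof (Cmod_ge_0 s).
  assert (0 < / Cmod R) by (apply Rinv_0_lt_compat; lra).
  unfold Rdiv. apply Rle_trans with ((2 + Cmod s) * (4 * / Cmod z)); [|lra].
  apply Rmult_le_compat; lra.
Qed.

(** * Hard edges *)

Lemma ln_bound (x e : R) : 0 <= e <= / 2 -> 1 - e <= x <= 1 + e -> Rabs (ln x) <= 2 * e.
Proof.
  intros He Hx. assert (X : 0 < x) by lra.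
  assert (U : forall y, 0 < y -> ln y <= y - 1).
  { intros y Hy. pose proof (exp_ineq1_le (ln y)) as K. rewrite exp_ln in K by exact Hy. lra. }
  apply Rabs_le; split.
  - pose proof (U (/ x) (Rinv_0_lt_compat _ X)) as K. rewrite ln_Rinv in K by exact X.
    assert (/ x <= 1 + 2 * e).
    { apply Rmult_le_reg_l with x; [exact X|]. rewrite Rinv_r by lra. nra. }
    lra.
  - pose proof (U x X). lra.
Qed.

Lemma Re_h_of_small (s q : C) : Cmod q <= / 2 ->
  Rabs (2 * ln (Cmod (v_of q)) - Re (s * r_of q)) <= (8 + 8 * Cmod s) * Cmod q.
Proof.
  intros H. set (e := Cmod q) in *. assert (E0 : 0 <= e) by apply Cmod_ge_0.
  assert (M1 : 1 - e <= Cmod (1 - q) <= 1 + e).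
  { pose proof (Cmod_triangle (1 - q) q) as T1. replace (1 - q + q)%C with (RtoC 1) in T1 by ring.
    pose proof (Cmod_triangle 1 (- q)) as T3. rewrite Cmod_opp in T3. rewrite Cmod_1 in *. fold e in T1, T3.
    unfold Cminus in *; lra. }
  assert (M2 : 1 - e <= Cmod (1 + q) <= 1 + e).
  { pose proof (Cmod_triangle (1 + q) (- q)) as T1. replace (1 + q + - q)%C with (RtoC 1) in T1 by ring.
    pose proof (Cmod_triangle 1 q) as T3. rewrite Cmod_opp in T1. rewrite Cmod_1 in *. fold e in T1, T3. lra. }
  assert (N1 : (1 - q)%C <> RtoC 0) by (apply Cmod_gt_0; lra).
  assert (N2 : (1 + q)%C <> RtoC 0) by (apply Cmod_gt_0; lra).
  assert (L : Rabs (2 * ln (Cmod (v_of q))) <= 8 * e).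
  { unfold v_of; rewrite Cmod_div by exact N1. rewrite ln_div by lra.
    pose proof (ln_bound _ e (conj E0 H) M1) as L1. pose proof (ln_bound _ e (conj E0 H) M2) as L2.
    apply Rabs_le_between in L1; apply Rabs_le_between in L2. apply Rabs_le; lra. }
  assert (RB : Cmod (r_of q) <= 8 * e).
  { unfold r_of. rewrite Cmod_div, !Cmod_mult, <- RtoC_2, Cmod_R, Rabs_pos_eq by (lra || now apply Cmult_neq_0).
    fold e. apply Rmult_le_reg_r with (Cmod (1 - q) * Cmod (1 + q)); [nra|].
    unfold Rdiv; rewrite Rmult_assoc, Rinv_l by nra.
    assert (/ 4 <= Cmod (1 - q) * Cmod (1 + q)) by nra. nra. }
  assert (SB : Rabs (Re (s * r_of q)) <= 8 * Cmod s * e).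
  { eapply Rle_trans; [apply re_le_Cmod|]. rewrite Cmod_mult. pose proof (Cmod_ge_0 s). nra. }
  unfold Rminus. eapply Rle_trans; [apply Rabs_triang|]. rewrite Rabs_Ropp. lra.
Qed.

Lemma Re_h_arc (s z : C) : Re (h_arc s z) = 2 * ln (Cmod (v_of (q_of z))) - Re (s * r_of (q_of z)).
Proof. unfold h_arc, h_of; rewrite re_minus, <- RtoC_2, re_scal_l; reflexivity. Qed.

Lemma sqrt_half_bound (x y : R) : 0 <= x < / 4 -> 1 <= y -> sqrt (x / y) <= sqrt x /\ sqrt x <= / 2.
Proof.
  intros Hx Hy; split.
  - apply sqrt_le_1_alt. apply Rmult_le_reg_r with y; [lra|].
    unfold Rdiv; rewrite Rmult_assoc, Rinv_l by lra. nra.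
  - replace (/ 2) with (sqrt (/ 4)).
    + apply sqrt_le_1_alt; lra.
    + replace (/ 4) with (/ 2 * / 2) by lra. apply sqrt_square; lra.
Qed.

Lemma Cmod_of_square (q w : C) : (q * q = w)%C -> Cmod q = sqrt (Cmod w).
Proof. intros <-; rewrite Cmod_mult. symmetry; apply sqrt_square, Cmod_ge_0. Qed.

(** h is of first order in q at the image q = 0 of the edge 1, and of first
    order in 1/q at the image of -1, while |q|^2 = |z - 1| / |z + 1|: this is
    the exponent 1/2. *)
Lemma h_arc_hard_edge (s e : C) : e = RtoC 1 \/ e = RtoC (-1) ->
  exists M r, 0 < r /\ forall z, ~ Omega G z -> Cmod (z - e) < r ->
    Rabs (Re (h_arc s z)) <= M * Rpower (Cmod (z - e)) (1 / 2).
Proof.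
  intros He; exists (8 + 8 * Cmod s), (/ 4); split; [lra|]; intros z HO Hz.
  pose proof (Cmod_ge_0 s) as S0.
  pose proof (off_Omega_cut z HO) as HC.
  destruct (off_cut_edges _ HC) as [H1 H2].
  pose proof (q_of_square _ HC) as SQ.
  destruct (q_facts _ _ H1 H2 SQ) as [N1 [N2 [N3 _]]].
  pose proof (plus_1_neq_0 z H1) as Z1. pose proof (minus_1_neq_0 z H2) as Z2.
  assert (P1 : 0 < Cmod (z + 1)) by now apply Cmod_gt_0.
  assert (P2 : 0 < Cmod (z - 1)) by now apply Cmod_gt_0.
  assert (TT : 2 <= Cmod (z + 1) + Cmod (z - 1)).
  { pose proof (Cmod_triangle (z + 1) (- (z - 1))) as T. rewrite Cmod_opp in T.
    replace (z + 1 + - (z - 1))%C with (RtoC 2) in T by (rewrite RtoC_2; ring).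
    rewrite Cmod_R, Rabs_pos_eq in T; lra. }
  rewrite Re_h_arc. set (q := q_of z) in *.
  replace (1 / 2) with (/ 2) by lra.
  destruct He as [->| ->].
  - rewrite Rpower_sqrt by exact P2.
    assert (MQ : Cmod q = sqrt (Cmod (z - 1) / Cmod (z + 1))).
    { rewrite (Cmod_of_square q _ SQ), Cmod_div by exact Z1. reflexivity. }
    destruct (sqrt_half_bound (Cmod (z - 1)) (Cmod (z + 1))) as [B1 B2]; [lra|lra|].
    rewrite <- MQ in B1.
    eapply Rle_trans; [apply Re_h_of_small; lra|]. apply Rmult_le_compat_l; lra.
  - replace (z - RtoC (-1))%C with (z + 1)%C in * by (rewrite RtoC_m1; ring).
    rewrite Rpower_sqrt by exact P1.
    set (p := (/ q)%C).
    assert (MP : Cmod p = sqrt (Cmod (z + 1) / Cmod (z - 1))).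
    { rewrite <- Cmod_div by exact Z2. apply Cmod_of_square.
      unfold p. transitivity (/ (q * q))%C; [field; exact N3|]. rewrite SQ; field; auto. }
    destruct (sqrt_half_bound (Cmod (z + 1)) (Cmod (z - 1))) as [B1 B2]; [lra|lra|].
    rewrite <- MP in B1.
    (* Passing from q to 1/q changes the sign of z + r and of r. *)
    assert (V : v_of q = (- v_of p)%C).
    { unfold v_of, p. field. repeat split; try assumption;
      intros E; apply N1; transitivity (- (q - 1))%C; [ring|rewrite E; ring]. }
    assert (RR : (s * r_of q = (- s) * r_of p)%C).
    { unfold r_of, p. field. repeat split; try assumption;
      try (intros E; apply N1; transitivity (- (q - 1))%C; [ring|rewrite E; ring]);
      try (intros E; apply N2; rewrite <- E; ring). }
    rewrite V, RR, Cmod_opp.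
    eapply Rle_trans; [apply Re_h_of_small; lra|]. rewrite Cmod_opp. apply Rmult_le_compat_l; lra.
Qed.

(** * Existence of h-functions and their saddle points *)

Lemma h_arc_derive_square (s z : C) : ~ Omega G z ->
  (C_derive (h_arc s) z * C_derive (h_arc s) z * (z * z - 1) = (2 - s * z) * (2 - s * z))%C.
Proof.
  intros HO; rewrite (Cderiv_C_derive _ _ _ (h_arc_derive s z HO)).
  pose proof (off_Omega_cut z HO) as HC.
  destruct (off_cut_edges _ HC) as [H1 H2].
  pose proof (r_of_square _ _ H1 H2 (q_of_square _ HC)) as RS.
  pose proof (off_Omega_edges G z HO) as N.
  assert (R0 : r_of (q_of z) <> RtoC 0).
  { intros E; apply N; rewrite <- RS, E; ring. }
  rewrite <- RS; field; exact R0.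
Qed.

Lemma h_arc_h_function (s : C) : h_function s 0 G (h_arc s).
Proof.
  split.
  - lia.
  - intros z Hz; eapply Cderiv_holomorphic, h_arc_derive, Hz.
  - exists (fun _ => 1); split; [reflexivity|split].
    + intros x Hx; now apply h_arc_ray_jump.
    + intros j t Hj; lia.
  - exists (fun _ => 0); split; [reflexivity|].
    intros j t Hj Ht; replace j with 0%nat in * by lia.
    replace (RtoC (4 * PI * 0) * Ci)%C with (RtoC 0) by (rewrite Rmult_0_r; ring).
    apply h_arc_main_jump. simpl in Ht; lra.
  - apply h_arc_infinity.
  - apply h_arc_hard_edge.
  - intros j Hj; lia.
  - exists (fun k => match k with O => RtoC 2 | _ => (- s)%C end); intros z HO.
    simpl (1 - 0)%nat; rewrite Cpoly_1; simpl (Cprod _ _). rewrite !Cpow_2.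
    pose proof (off_Omega_edges G z HO) as N.
    apply (Cmult_eq_l (z * z - 1)); [exact N|].
    transitivity (C_derive (h_arc s) z * C_derive (h_arc s) z * (z * z - 1))%C; [ring|].
    rewrite h_arc_derive_square by exact HO. field; exact N.
  - apply h_arc_derive_infinity.
Qed.

(** Near z0 the function r is, up to sign, the analytic function r0 ((z^2 - 1)
    / r0^2)^(1/2), and 2 - s z = - s (z - z0). *)
Lemma saddle_order_off_edges (s z0 r0 : C) : (s * z0 = 2)%C -> (r0 * r0 = z0 * z0 - 1)%C ->
  z0 <> RtoC 1 -> z0 <> RtoC (-1) -> derive_zero_order G (h_arc s) z0 1.
Proof.
  intros Es Er N1 N2.
  assert (S0 : s <> RtoC 0).
  { intros ->; assert (Z : RtoC 0 = RtoC 2) by (rewrite <- Es; ring). apply RtoC_inj in Z; lra. }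
  assert (R0 : r0 <> RtoC 0).
  { intros ->. apply (Cmult_neq_0 (z0 - 1) (z0 + 1)); [now apply minus_1_neq_0|now apply plus_1_neq_0|].
    transitivity (z0 * z0 - 1)%C; [ring|]. rewrite <- Er; ring. }
  assert (RR : (r0 * r0)%C <> RtoC 0) by now apply Cmult_neq_0.
  set (w := fun z => ((z * z - 1) / (r0 * r0))%C).
  assert (W0 : w z0 = RtoC 1) by (unfold w; rewrite <- Er; field; exact R0).
  assert (DW : forall z, Cderiv w z ((1 * z + z * 1 - 0) * / (r0 * r0) + (z * z - 1) * 0)%C).
  { intros z. apply (Cderiv_mult (fun z => z * z - 1)%C (fun _ => / (r0 * r0))%C); [|apply Cderiv_const].
    apply (Cderiv_minus (fun z => z * z)%C (fun _ => RtoC 1)); [|apply Cderiv_const].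
    apply Cderiv_mult; apply Cderiv_id. }
  assert (NS : near_C z0 (fun z => slit (w z))).
  { assert (S1 : slit (w z0)) by (rewrite W0; apply slit_Re_pos; simpl; lra).
    destruct (slit_open _ S1) as [d [Hd K]].
    generalize (Cderiv_Ccont _ _ _ (DW z0) d Hd); apply filter_imp; intros z; apply K. }
  destruct NS as [r [Hr NS]].
  assert (CS : forall z, slit (w z) -> (r0 * Csqrt (w z))%C <> RtoC 0).
  { intros z Hz; apply Cmult_neq_0; [exact R0|]. intros E; pose proof (Csqrt_Re_pos _ Hz) as P.
    rewrite E in P; simpl in P; lra. }
  exists r, (fun z => (- s) * / (r0 * Csqrt (w z)))%C; split; [exact Hr|split; [|split]].
  - intros z Hz; specialize (NS z Hz).
    eapply Cderiv_holomorphic.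
    apply (Cderiv_mult (fun _ => - s)%C (fun z => / (r0 * Csqrt (w z)))%C); [apply Cderiv_const|].
    apply (Cderiv_inv (fun z => r0 * Csqrt (w z))%C); [now apply CS|].
    apply (Cderiv_mult (fun _ => r0) (fun z => Csqrt (w z))); [apply Cderiv_const|].
    apply (Cderiv_comp w Csqrt); [apply DW|now apply Csqrt_derive].
  - intros E. apply (Cmult_neq_0 (- s) (/ (r0 * Csqrt (w z0)))%C); [| |exact E].
    + intros Z; apply S0; transitivity (- - s)%C; [ring|rewrite Z; ring].
    + assert (Hs : slit (w z0)) by (apply NS; replace (z0 - z0)%C with (RtoC 0) by ring; rewrite Cmod_0; exact Hr).
      intros Z; apply C1_nz. rewrite <- (Cinv_l _ (CS z0 Hs)), Z; ring.
  - intros z Hz HO; specialize (NS z Hz); split; [|split].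
    + intros _. rewrite (Cderiv_C_derive _ _ _ (h_arc_derive s z HO)).
      pose proof (off_Omega_cut z HO) as HC.
      destruct (off_cut_edges _ HC) as [H1 H2].
      pose proof (r_of_square _ _ H1 H2 (q_of_square _ HC)) as RS.
      set (R := r_of (q_of z)) in *. set (T := (r0 * Csqrt (w z))%C).
      assert (TS : (T * T = R * R)%C).
      { rewrite RS. unfold T. transitivity (r0 * r0 * (Csqrt (w z) * Csqrt (w z)))%C; [ring|].
        rewrite Csqrt_square by exact NS. unfold w; field; exact R0. }
      pose proof (CS z NS) as T0. fold T in T0.
      replace (2 - s * z)%C with (- s * (z - z0))%C by (rewrite <- Es; ring).
      rewrite Cpow_1_r.
      destruct (Ceq_dec (R - T) 0) as [E|E].
      * left. replace R with T by (transitivity (R - (R - T))%C; [ring|rewrite E; ring]).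
        field; exact T0.
      * right. assert (E' : R = (- T)%C).
        { destruct (Ceq_dec (R + T) 0) as [F|F].
          - transitivity (R + T - T)%C; [ring|rewrite F; ring].
          - exfalso; apply (Cmult_neq_0 _ _ E F). transitivity (R * R - T * T)%C; [ring|rewrite TS; ring]. }
        rewrite E'; field; exact T0.
    + intros [K|K]; contradiction.
    + intros K; apply (branch_point_edges G z0 eq_refl) in K; tauto.
Qed.

(** Here z0^2 = 1, so that h'^2 (z - z0) = s^2 (z - z0)^2 / (z + z0). *)
Lemma saddle_order_at_edges (s z0 : C) : (s * z0 = 2)%C -> z0 = RtoC 1 \/ z0 = RtoC (-1) ->
  derive_zero_order G (h_arc s) z0 1.
Proof.
  intros Es Hz0.
  assert (E1 : (z0 * z0 = 1)%C) by (destruct Hz0 as [->| ->]; rewrite <- RtoC_mult; f_equal; lra).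
  assert (S0 : s <> RtoC 0).
  { intros ->; assert (Z : RtoC 0 = RtoC 2) by (rewrite <- Es; ring). apply RtoC_inj in Z; lra. }
  assert (M0 : Cmod z0 = 1).
  { destruct Hz0 as [->| ->]; rewrite Cmod_R; [apply Rabs_pos_eq; lra|rewrite Rabs_left; lra]. }
  assert (NZ : forall z, Cmod (z - z0) < 1 -> (z + z0)%C <> RtoC 0).
  { intros z Hz E. replace (z - z0)%C with ((z + z0) - (1 + 1) * z0)%C in Hz by ring.
    rewrite E, <- RtoC_2 in Hz. replace (RtoC 0 - RtoC 2 * z0)%C with (- (RtoC 2 * z0))%C in Hz by ring.
    rewrite Cmod_opp, Cmod_mult, M0, Cmod_R, Rabs_pos_eq in Hz; lra. }
  exists 1, (fun z => (s * s) * / (z + z0))%C; split; [lra|split; [|split]].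
  - intros z Hz. eapply Cderiv_holomorphic.
    apply (Cderiv_mult (fun _ => s * s)%C (fun z => / (z + z0))%C); [apply Cderiv_const|].
    apply (Cderiv_inv (fun z => z + z0)%C); [now apply NZ|].
    apply Cderiv_plus; [apply Cderiv_id|apply Cderiv_const].
  - assert (N : (z0 + z0)%C <> RtoC 0).
    { apply NZ; replace (z0 - z0)%C with (RtoC 0) by ring; rewrite Cmod_0; lra. }
    intros E. apply (Cmult_neq_0 (s * s) (/ (z0 + z0))%C); [now apply Cmult_neq_0| |exact E].
    intros Z; apply C1_nz; rewrite <- (Cinv_l _ N), Z; ring.
  - intros z Hz HO; split; [|split].
    + intros K; exfalso; apply K, edges_branch_point, Hz0.
    + intros _. pose proof (h_arc_derive_square s z HO) as SQ.
      pose proof (off_Omega_edges G z HO) as N. pose proof (NZ z Hz) as N'.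
      apply (Cmult_eq_l (z + z0)); [exact N'|].
      rewrite Cpow_1_r, !Cpow_2.
      transitivity (C_derive (h_arc s) z * C_derive (h_arc s) z * (z * z - z0 * z0))%C; [ring|].
      rewrite E1, SQ. replace (2 - s * z)%C with (- s * (z - z0))%C by (rewrite <- Es; ring).
      field; exact N'.
    + intros _ K1 K2; destruct Hz0; contradiction.
Qed.

(** |Re h| is the absolute value of the height, a continuous function that
    vanishes at z0. *)
Lemma h_arc_breaking_datum (s z0 r0 : C) (t : R) :
  (s * z0 = 2)%C -> (r0 * r0 = z0 * z0 - 1)%C -> edge_height s z0 r0 = 0 ->
  0 <= t <= 1 -> z0 = arc (RtoC t) -> breaking_datum s 0 G (h_arc s) z0 1.
Proof.
  intros Es Er Eh Ht Ez; split; [apply h_arc_h_function|split].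
  - split; [|split; [lia|]].
    + right; exists t; auto.
    + destruct (Ceq_dec z0 1) as [E|N1]; [apply saddle_order_at_edges; auto|].
      destruct (Ceq_dec z0 (RtoC (-1))) as [E|N2]; [apply saddle_order_at_edges; auto|].
      now apply (saddle_order_off_edges s z0 r0).
  - apply Re_vanishes_eps; intros eps Heps.
    destruct (edge_height_continuous s z0 r0 eps Er Heps) as [d [Hd K]].
    exists d; split; [exact Hd|]; intros z Hz HO.
    pose proof (off_Omega_cut z HO) as HC.
    destruct (off_cut_edges _ HC) as [H1 H2].
    pose proof (q_of_square _ HC) as SQ.
    unfold h_arc; rewrite (Re_h_of s _ z H1 H2 SQ).
    assert (SS : Cmod (s - s) < d) by (replace (s - s)%C with (RtoC 0) by ring; now rewrite Cmod_0).
    specialize (K s z (r_of (q_of z)) SS Hz (r_of_square _ _ H1 H2 SQ)).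
    rewrite Eh, Rabs_R0, Rminus_0_r, Rabs_Rabsolu in K. exact K.
Qed.

End Arc.

(** * Smooth functions of a real variable *)

(** The derivatives are quantified existentially, which lets each closure
    property be proved by induction on the order. *)
Fixpoint smooth_upto (n : nat) (D : R -> Prop) (f : R -> R) : Prop :=
  match n with
  | O => True
  | S m => exists f', (forall x, D x -> is_derive f x (f' x)) /\ smooth_upto m D f'
  end.

Definition smooth_on (D : R -> Prop) (f : R -> R) : Prop := forall n, smooth_upto n D f.

Section Smooth.
Variable D : R -> Prop.

Lemma smooth_upto_pred (n : nat) : forall f, smooth_upto (S n) D f -> smooth_upto n D f.
Proof.
  induction n as [|n IH]; intros f [f' [H1 H2]]; [exact I|].
  exists f'; split; [exact H1|now apply IH].
Qed.

Lemma smooth_const (c : R) : smooth_on D (fun _ => c).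
Proof.
  intros n; revert c; induction n as [|n IH]; intros c; [exact I|].
  exists (fun _ => 0); split; [|apply IH]. intros x _; apply @is_derive_const.
Qed.

Lemma smooth_id : smooth_on D (fun x => x).
Proof.
  intros [|n]; [exact I|]. exists (fun _ => 1); split; [|apply smooth_const].
  intros x _; apply @is_derive_id.
Qed.

Lemma smooth_upto_plus (n : nat) : forall f g, smooth_upto n D f -> smooth_upto n D g ->
  smooth_upto n D (fun x => f x + g x).
Proof.
  induction n as [|n IH]; intros f g; [auto|]. intros [f' [F1 F2]] [g' [G1 G2]].
  exists (fun x => f' x + g' x); split; [|now apply IH].
  intros x Hx; apply (is_derive_plus (V := R_NormedModule)); auto.
Qed.

Lemma is_derive_mult_R (f g : R -> R) (x a b : R) : is_derive f x a -> is_derive g x b ->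
  is_derive (fun x => f x * g x) x (a * g x + f x * b).
Proof.
  intros H1 H2; apply is_derive_Reals, derivable_pt_lim_mult; now apply is_derive_Reals.
Qed.

Lemma smooth_upto_mult (n : nat) : forall f g, smooth_upto n D f -> smooth_upto n D g ->
  smooth_upto n D (fun x => f x * g x).
Proof.
  induction n as [|n IH]; intros f g; [auto|]. intros HF HG.
  pose proof (smooth_upto_pred _ _ HF) as PF; pose proof (smooth_upto_pred _ _ HG) as PG.
  destruct HF as [f' [F1 F2]], HG as [g' [G1 G2]].
  exists (fun x => f' x * g x + f x * g' x); split.
  - intros x Hx; apply is_derive_mult_R; auto.
  - apply smooth_upto_plus; now apply IH.
Qed.

Lemma is_derive_inv_R (f : R -> R) (x a : R) : f x <> 0 -> is_derive f x a ->
  is_derive (fun x => / f x) x (- 1 * (a * (/ f x * / f x))).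
Proof.
  intros N H. replace (- 1 * (a * (/ f x * / f x))) with (- a / f x ^ 2) by (field; exact N).
  now apply is_derive_inv.
Qed.

Lemma smooth_upto_inv (n : nat) : forall f, (forall x, D x -> f x <> 0) -> smooth_upto n D f ->
  smooth_upto n D (fun x => / f x).
Proof.
  induction n as [|n IH]; intros f N; [auto|]. intros HF.
  pose proof (smooth_upto_pred _ _ HF) as PF. destruct HF as [f' [F1 F2]].
  exists (fun x => - 1 * (f' x * (/ f x * / f x))); split.
  - intros x Hx; apply is_derive_inv_R; auto.
  - apply smooth_upto_mult; [apply smooth_const|]. apply smooth_upto_mult; [exact F2|].
    apply smooth_upto_mult; now apply IH.
Qed.

Lemma smooth_upto_comp (E : R -> Prop) (n : nat) : forall f g, (forall x, D x -> E (g x)) ->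
  smooth_upto n E f -> smooth_upto n D g -> smooth_upto n D (fun x => f (g x)).
Proof.
  induction n as [|n IH]; intros f g DE; [auto|]. intros [f' [F1 F2]] HG.
  pose proof (smooth_upto_pred _ _ HG) as PG. destruct HG as [g' [G1 G2]].
  exists (fun x => g' x * f' (g x)); split.
  - intros x Hx. apply (is_derive_comp f g); auto.
  - apply smooth_upto_mult; [exact G2|now apply IH].
Qed.

Lemma smooth_plus (f g : R -> R) : smooth_on D f -> smooth_on D g -> smooth_on D (fun x => f x + g x).
Proof. intros F G n; now apply smooth_upto_plus. Qed.

Lemma smooth_mult (f g : R -> R) : smooth_on D f -> smooth_on D g -> smooth_on D (fun x => f x * g x).
Proof. intros F G n; now apply smooth_upto_mult. Qed.

Lemma smooth_inv (f : R -> R) : (forall x, D x -> f x <> 0) -> smooth_on D f ->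
  smooth_on D (fun x => / f x).
Proof. intros N F n; now apply smooth_upto_inv. Qed.

Lemma smooth_comp (E : R -> Prop) (f g : R -> R) : (forall x, D x -> E (g x)) ->
  smooth_on E f -> smooth_on D g -> smooth_on D (fun x => f (g x)).
Proof. intros DE F G n; now apply (smooth_upto_comp E). Qed.

Lemma smooth_upto_ext (n : nat) (f g : R -> R) : (forall x, f x = g x) ->
  smooth_upto n D f -> smooth_upto n D g.
Proof.
  intros E; destruct n as [|n]; [auto|]. intros [f' [F1 F2]]; exists f'; split; [|exact F2].
  intros x Hx; apply (is_derive_ext f); [exact E|auto].
Qed.

(** The derivative phi o psi has as many derivatives as psi has, so each step
    of the induction gains one. *)
Lemma smooth_ode (E : R -> Prop) (phi psi : R -> R) : (forall x, D x -> E (psi x)) ->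
  smooth_on E phi -> (forall x, D x -> is_derive psi x (phi (psi x))) -> smooth_on D psi.
Proof.
  intros DE HP H n; induction n as [|n IH]; [exact I|].
  exists (fun x => phi (psi x)); split; [exact H|]. now apply (smooth_upto_comp E).
Qed.

Lemma smooth_ex_derive_n (f : R -> R) (n : nat) (x : R) :
  (forall x, D x -> locally x D) -> smooth_on D f -> D x -> ex_derive_n f n x.
Proof.
  intros HO HF Hx; specialize (HF n); revert f HF x Hx.
  induction n as [|n IH]; intros f HF x Hx; [exact I|].
  destruct HF as [f' [F1 F2]].
  destruct n as [|n]; [exists (f' x); now apply F1|].
  assert (K : ex_derive_n (Derive f) (S n) x).
  { apply (ex_derive_n_ext_loc f'); [|now apply IH].
    generalize (HO x Hx); apply filter_imp; intros y Hy; symmetry; now apply is_derive_unique, F1. }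
  unfold ex_derive_n in *.
  apply (ex_derive_ext (Derive_n (Derive f) n)); [|exact K].
  intros y. change (Derive f) with (Derive_n f 1).
  rewrite (Derive_n_comp f n 1 y). f_equal; lia.
Qed.

Lemma smooth_sin_cos : smooth_on D sin /\ smooth_on D cos.
Proof.
  assert (K : forall n, smooth_upto n D sin /\ smooth_upto n D cos).
  { induction n as [|n [IS IC]]; [split; exact I|split].
    - exists cos; split; [intros x _; apply is_derive_sin|exact IC].
    - exists (fun x => - 1 * sin x); split.
      + intros x _. replace (- 1 * sin x) with (- sin x) by ring. apply is_derive_cos.
      + apply smooth_upto_mult; [apply smooth_const|exact IS]. }
  split; intros n; apply K.
Qed.

Lemma is_derive_sinh (x : R) : is_derive sinh x (cosh x).
Proof. apply is_derive_Reals, derivable_pt_lim_sinh. Qed.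

Lemma is_derive_cosh (x : R) : is_derive cosh x (sinh x).
Proof. apply is_derive_Reals, derivable_pt_lim_cosh. Qed.

Lemma smooth_sinh_cosh : smooth_on D sinh /\ smooth_on D cosh.
Proof.
  assert (K : forall n, smooth_upto n D sinh /\ smooth_upto n D cosh).
  { induction n as [|n [IS IC]]; [split; exact I|split].
    - exists cosh; split; [intros x _; apply is_derive_sinh|exact IC].
    - exists sinh; split; [intros x _; apply is_derive_cosh|exact IS]. }
  split; intros n; apply K.
Qed.

End Smooth.

(** * Inverting the level-set equation *)

Lemma increasing_strict (f df : R -> R) (a b : R) : a < b ->
  (forall x, a <= x <= b -> is_derive f x (df x)) ->
  (forall x, a < x < b -> 0 < df x) -> f a < f b.
Proof.
  intros Hab HD HP.
  destruct (MVT_cor2 f df a b Hab) as [c [E Hc]].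
  - intros x Hx; apply is_derive_Reals, HD, Hx.
  - specialize (HP c Hc). nra.
Qed.

Lemma cosh_pos (x : R) : 0 < cosh x.
Proof. unfold cosh; pose proof (exp_pos x); pose proof (exp_pos (- x)); lra. Qed.

Lemma cosh2_sinh2 (x : R) : cosh x * cosh x - sinh x * sinh x = 1.
Proof.
  unfold cosh, sinh.
  assert (exp x * exp (- x) = 1) by (rewrite <- exp_plus, Rplus_opp_r; apply exp_0). nra.
Qed.

Lemma sinh_0 : sinh 0 = 0.
Proof. unfold sinh; rewrite Ropp_0; lra. Qed.

Lemma cosh_0 : cosh 0 = 1.
Proof. unfold cosh; rewrite Ropp_0, exp_0; lra. Qed.

Lemma sinh_increasing (x y : R) : x < y -> sinh x < sinh y.
Proof.
  intros H; apply (increasing_strict sinh cosh); [exact H| |].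
  - intros z _; apply is_derive_sinh.
  - intros z _; apply cosh_pos.
Qed.

Lemma sinh_pos (x : R) : 0 < x -> 0 < sinh x.
Proof. intros H; rewrite <- sinh_0; now apply sinh_increasing. Qed.

Lemma cosh_increasing (x y : R) : 0 <= x -> x < y -> cosh x < cosh y.
Proof.
  intros Hx H; apply (increasing_strict cosh sinh); [exact H| |].
  - intros z _; apply is_derive_cosh.
  - intros z Hz; apply sinh_pos; lra.
Qed.

Lemma sinh_gt_id (x : R) : 0 < x -> x < sinh x.
Proof.
  intros Hx.
  assert (K : sinh 0 - 0 < sinh x - x).
  { apply (increasing_strict (fun y => sinh y - y) (fun y => cosh y - 1)); [exact Hx| |].
    - intros y _; apply (is_derive_minus (V := R_NormedModule)); [apply is_derive_sinh|apply @is_derive_id].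
    - intros y Hy. assert (cosh 0 < cosh y) by (apply cosh_increasing; lra). rewrite cosh_0 in H; lra. }
  rewrite sinh_0 in K; lra.
Qed.

Definition sin2_factor (a : R) : R := cosh a - sinh a * / a.
Definition dsin2_factor (a : R) : R := sinh a - (cosh a * / a + sinh a * (- 1 * (1 * (/ a * / a)))).

(** The points a + i th at which a = Re tanh (a + i th) are those with sin^2
    th = [sin2_fun a]. *)
Definition sin2_fun (a : R) : R := cosh a * sin2_factor a.
Definition dsin2_fun (a : R) : R := sinh a * sin2_factor a + cosh a * dsin2_factor a.

Lemma sin2_factor_derive (a : R) : 0 < a -> is_derive sin2_factor a (dsin2_factor a).
Proof.
  intros Ha; apply (is_derive_minus (V := R_NormedModule)); [apply is_derive_cosh|].
  apply (is_derive_mult_R sinh (fun a => / a)); [apply is_derive_sinh|].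
  apply (is_derive_inv_R (fun a => a)); [lra|apply @is_derive_id].
Qed.

Lemma sin2_fun_derive (a : R) : 0 < a -> is_derive sin2_fun a (dsin2_fun a).
Proof.
  intros Ha; apply (is_derive_mult_R cosh sin2_factor); [apply is_derive_cosh|now apply sin2_factor_derive].
Qed.

Lemma sin2_factor_pos (a : R) : 0 < a -> 0 < sin2_factor a.
Proof.
  intros Ha.
  assert (P : 0 * cosh 0 - sinh 0 < a * cosh a - sinh a).
  { apply (increasing_strict (fun x => x * cosh x - sinh x) (fun x => (1 * cosh x + x * sinh x) - cosh x)); [exact Ha| |].
    - intros x _; apply (is_derive_minus (V := R_NormedModule)); [|apply is_derive_sinh].
      apply (is_derive_mult_R (fun x => x) cosh); [apply @is_derive_id|apply is_derive_cosh].
    - intros x Hx; assert (0 < sinh x) by (apply sinh_pos; lra). nra. }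
  rewrite sinh_0 in P. unfold sin2_factor.
  replace (cosh a - sinh a * / a) with ((a * cosh a - sinh a) * / a) by (field; lra).
  apply Rmult_lt_0_compat; [lra|now apply Rinv_0_lt_compat].
Qed.

Lemma dsin2_factor_pos (a : R) : 0 < a -> 0 < dsin2_factor a.
Proof.
  intros Ha.
  (* The numerator vanishes at 0 and has derivative x sinh x + x^2 cosh x. *)
  assert (P : 0 * 0 * sinh 0 - 0 * cosh 0 + sinh 0 < a * a * sinh a - a * cosh a + sinh a).
  { apply (increasing_strict (fun x => x * x * sinh x - x * cosh x + sinh x)
      (fun x => ((1 * x + x * 1) * sinh x + x * x * cosh x) - (1 * cosh x + x * sinh x) + cosh x)); [exact Ha| |].
    - intros x _.
      apply (is_derive_plus (V := R_NormedModule)); [|apply is_derive_sinh].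
      apply (is_derive_minus (V := R_NormedModule)).
      + apply (is_derive_mult_R (fun x => x * x) sinh); [|apply is_derive_sinh].
        apply (is_derive_mult_R (fun x => x) (fun x => x)); apply @is_derive_id.
      + apply (is_derive_mult_R (fun x => x) cosh); [apply @is_derive_id|apply is_derive_cosh].
    - intros x Hx; assert (0 < sinh x) by (apply sinh_pos; lra). pose proof (cosh_pos x).
      assert (0 < x * x) by nra. nra. }
  rewrite sinh_0 in P. unfold dsin2_factor.
  replace (sinh a - (cosh a * / a + sinh a * (- 1 * (1 * (/ a * / a)))))
    with ((a * a * sinh a - a * cosh a + sinh a) * (/ a * / a)) by (field; lra).
  assert (0 < / a) by now apply Rinv_0_lt_compat.
  apply Rmult_lt_0_compat; [lra|nra].
Qed.

Lemma dsin2_fun_pos (a : R) : 0 < a -> 0 < dsin2_fun a.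
Proof.
  intros Ha; unfold dsin2_fun.
  pose proof (sinh_pos a Ha); pose proof (sin2_factor_pos a Ha); pose proof (cosh_pos a); pose proof (dsin2_factor_pos a Ha).
  assert (0 < sinh a * sin2_factor a) by now apply Rmult_lt_0_compat.
  assert (0 < cosh a * dsin2_factor a) by now apply Rmult_lt_0_compat. lra.
Qed.

Lemma sin2_fun_pos (a : R) : 0 < a -> 0 < sin2_fun a.
Proof. intros Ha; apply Rmult_lt_0_compat; [apply cosh_pos|now apply sin2_factor_pos]. Qed.

Lemma sin2_fun_increasing (a b : R) : 0 < a -> a < b -> sin2_fun a < sin2_fun b.
Proof.
  intros Ha Hb; apply (increasing_strict sin2_fun dsin2_fun); [exact Hb| |].
  - intros x Hx; apply sin2_fun_derive; lra.
  - intros x Hx; apply dsin2_fun_pos; lra.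
Qed.

Lemma sin2_fun_inj (a b : R) : 0 < a -> 0 < b -> sin2_fun a = sin2_fun b -> a = b.
Proof.
  intros Ha Hb E; destruct (Rtotal_order a b) as [H|[H|H]]; [|exact H|].
  - pose proof (sin2_fun_increasing a b Ha H); lra.
  - pose proof (sin2_fun_increasing b a Hb H); lra.
Qed.

Lemma sin2_fun_small (eps : R) : 0 < eps -> exists a, 0 < a < 1 /\ sin2_fun a < eps.
Proof.
  intros He.
  assert (C : continuous (fun a => cosh a * (cosh a - 1)) 0).
  { apply (ex_derive_continuous (fun a => cosh a * (cosh a - 1))).
    exists (sinh 0 * (cosh 0 - 1) + cosh 0 * (sinh 0 - 0)).
    apply (is_derive_mult_R cosh (fun a => cosh a - 1)); [apply is_derive_cosh|].
    apply (is_derive_minus (V := R_NormedModule)); [apply is_derive_cosh|apply @is_derive_const]. }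
  assert (K : locally 0 (fun a => cosh a * (cosh a - 1) < eps)).
  { apply (C (fun y => y < eps)), (open_lt eps). rewrite cosh_0; lra. }
  destruct K as [d K]. pose proof (cond_pos d).
  set (a := Rmin (d / 2) (/ 2)).
  assert (A0 : 0 < a) by (apply Rmin_pos; lra).
  assert (A1 : a <= d / 2) by apply Rmin_l. assert (A2 : a <= / 2) by apply Rmin_r.
  exists a; split; [lra|].
  specialize (K a). change (Rabs (a - 0) < d -> cosh a * (cosh a - 1) < eps) in K.
  rewrite Rminus_0_r, Rabs_pos_eq in K by lra. specialize (K ltac:(lra)).
  eapply Rle_lt_trans; [|exact K]. unfold sin2_fun, sin2_factor.
  apply Rmult_le_compat_l; [apply Rlt_le, cosh_pos|].
  pose proof (sinh_gt_id a A0).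
  assert (1 <= sinh a * / a).
  { apply Rmult_le_reg_r with a; [exact A0|]. rewrite Rmult_assoc, Rinv_l; lra. }
  lra.
Qed.

Lemma sin2_fun_2 : 1 < sin2_fun 2.
Proof.
  unfold sin2_fun, sin2_factor. pose proof (sinh_gt_id 2 ltac:(lra)).
  assert (S : sinh 2 < cosh 2) by (unfold sinh, cosh; pose proof (exp_pos (- (2))); lra).
  assert (1 < cosh 2 - sinh 2 * / 2) by lra. nra.
Qed.

(** The interval (0, 2) suffices: the values of interest are squares of sines,
    and [sin2_fun 2] exceeds 1. *)
Lemma sin2_fun_surj (y : R) : 0 < y < sin2_fun 2 -> exists a, 0 < a < 2 /\ sin2_fun a = y.
Proof.
  intros Hy; destruct (sin2_fun_small y (proj1 Hy)) as [a0 [A1 A2]].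
  destruct (Ranalysis5.IVT_interv (fun a => sin2_fun a - y) a0 2) as [a [Ha E]]; try lra.
  - intros a Ha. apply (is_derive_continuity_pt _ _ (dsin2_fun a - 0)).
    apply (is_derive_minus (V := R_NormedModule)); [apply sin2_fun_derive; lra|apply @is_derive_const].
  - exists a; split; [|lra]. destruct (Req_dec a 2) as [->|]; lra.
Qed.

Lemma sin2_fun_inverse : exists psi : R -> R, forall y, 0 < y < sin2_fun 2 -> 0 < psi y < 2 /\ sin2_fun (psi y) = y.
Proof.
  exists (fun y => match Rlt_dec 0 y with
    | left H1 => match Rlt_dec y (sin2_fun 2) with
      | left H2 => proj1_sig (constructive_indefinite_description _ (sin2_fun_surj y (conj H1 H2)))
      | right _ => 0 end
    | right _ => 0 end).
  intros y [H1 H2]. destruct (Rlt_dec 0 y); [|contradiction]. destruct (Rlt_dec y (sin2_fun 2)); [|contradiction].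
  apply (proj2_sig (constructive_indefinite_description _ (sin2_fun_surj y (conj r r0)))).
Qed.

Section Inverse.
Variable psi : R -> R.
Hypothesis psi_spec : forall y, 0 < y < sin2_fun 2 -> 0 < psi y < 2 /\ sin2_fun (psi y) = y.

Lemma psi_sin2_fun (a : R) : 0 < a < 2 -> psi (sin2_fun a) = a.
Proof.
  intros Ha. assert (H : 0 < sin2_fun a < sin2_fun 2) by (split; [apply sin2_fun_pos; lra|apply sin2_fun_increasing; lra]).
  destruct (psi_spec _ H) as [P E]. apply sin2_fun_inj; lra.
Qed.

Lemma psi_increasing (x y : R) : 0 < x -> x < y -> y < sin2_fun 2 -> psi x < psi y.
Proof.
  intros Hx Hy H2. destruct (psi_spec x) as [P1 E1]; [lra|]. destruct (psi_spec y) as [P2 E2]; [lra|].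
  apply Rnot_le_lt; intros [K|K].
  - pose proof (sin2_fun_increasing _ _ (proj1 P2) K); lra.
  - rewrite K in E2; lra.
Qed.

Lemma psi_close (y eps : R) : 0 < y < sin2_fun 2 -> 0 < eps ->
  exists d, 0 < d /\ forall x, Rabs (x - y) < d -> 0 < x < sin2_fun 2 /\ Rabs (psi x - psi y) < eps.
Proof.
  intros Hy He; destruct (psi_spec y Hy) as [P E].
  set (e := Rmin (eps / 2) (Rmin (psi y / 2) ((2 - psi y) / 2))).
  assert (E0 : 0 < e) by (repeat apply Rmin_pos; lra).
  assert (E1 : e <= eps / 2) by apply Rmin_l.
  assert (E2 : e <= psi y / 2) by (eapply Rle_trans; [apply Rmin_r|apply Rmin_l]).
  assert (E3 : e <= (2 - psi y) / 2) by (eapply Rle_trans; [apply Rmin_r|apply Rmin_r]).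
  clearbody e.
  pose proof (sin2_fun_increasing (psi y - e) (psi y) ltac:(lra) ltac:(lra)) as L.
  pose proof (sin2_fun_increasing (psi y) (psi y + e) ltac:(lra) ltac:(lra)) as U.
  pose proof (sin2_fun_pos (psi y - e) ltac:(lra)) as L0.
  pose proof (sin2_fun_increasing (psi y + e) 2 ltac:(lra) ltac:(lra)) as U2.
  exists (Rmin (y - sin2_fun (psi y - e)) (sin2_fun (psi y + e) - y)); split; [apply Rmin_pos; lra|].
  intros x Hx. pose proof (Rmin_l (y - sin2_fun (psi y - e)) (sin2_fun (psi y + e) - y)).
  pose proof (Rmin_r (y - sin2_fun (psi y - e)) (sin2_fun (psi y + e) - y)).
  apply Rabs_def2 in Hx. assert (X : 0 < x < sin2_fun 2) by lra. split; [exact X|].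
  assert (psi (sin2_fun (psi y - e)) < psi x) by (apply psi_increasing; lra).
  assert (psi x < psi (sin2_fun (psi y + e))) by (apply psi_increasing; lra).
  rewrite psi_sin2_fun in H1, H2 by lra. apply Rabs_def1; lra.
Qed.

Lemma psi_derive (y : R) : 0 < y < sin2_fun 2 -> is_derive psi y (/ dsin2_fun (psi y)).
Proof.
  intros Hy; destruct (psi_spec y Hy) as [P E].
  set (a := psi y) in *. pose proof (dsin2_fun_pos a (proj1 P)) as D0.
  pose proof (proj1 (is_derive_Reals _ _ _) (sin2_fun_derive a (proj1 P))) as DG.
  apply is_derive_eps; intros eps He.
  set (eta := Rmin (dsin2_fun a / 2) (eps * (dsin2_fun a * dsin2_fun a) / 4)).
  assert (DD : 0 < dsin2_fun a * dsin2_fun a) by nra.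
  assert (Eta : 0 < eta) by (apply Rmin_pos; [lra|apply Rdiv_lt_0_compat; nra]).
  assert (Eta1 : eta <= dsin2_fun a / 2) by apply Rmin_l.
  assert (Eta2 : eta <= eps * (dsin2_fun a * dsin2_fun a) / 4) by apply Rmin_r.
  clearbody eta.
  destruct (DG eta Eta) as [d K].
  destruct (psi_close y d Hy (cond_pos d)) as [d' [Hd' K']].
  exists d'; split; [exact Hd'|]; intros u Hu.
  destruct (K' u Hu) as [U1 U2]. fold a in U2. destruct (psi_spec u U1) as [PU EU].
  destruct (Req_dec (psi u) a) as [Z|N].
  { assert (u = y) by (rewrite <- EU, Z; exact E). subst u. exists (/ dsin2_fun a); split.
    - fold a; ring.
    - rewrite Rminus_diag, Rabs_R0; exact He. }
  specialize (K (psi u - a) ltac:(lra) U2).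
  replace (a + (psi u - a)) with (psi u) in K by ring. rewrite EU, E in K.
  set (q := (u - y) / (psi u - a)) in *.
  apply Rabs_def2 in K.
  assert (Q0 : dsin2_fun a / 2 <= q) by lra.
  exists (/ q); split.
  - assert (N' : psi u - a <> 0) by lra.
    assert (UY : u - y = q * (psi u - a)) by (unfold q; field; exact N').
    fold a. rewrite UY; field; lra.
  - replace (/ q - / dsin2_fun a) with ((dsin2_fun a - q) * / (q * dsin2_fun a)) by (field; lra).
    rewrite Rabs_mult, (Rabs_pos_eq (/ (q * dsin2_fun a))) by (apply Rlt_le, Rinv_0_lt_compat; nra).
    assert (A1 : Rabs (dsin2_fun a - q) < eta) by (apply Rabs_def1; lra).
    assert (A2 : dsin2_fun a * dsin2_fun a / 2 <= q * dsin2_fun a) by nra.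
    apply Rmult_lt_reg_r with (q * dsin2_fun a); [nra|]. rewrite Rmult_assoc, Rinv_l by nra.
    rewrite Rmult_1_r. nra.
Qed.

Lemma smooth_psi : smooth_on (fun y => 0 < y < sin2_fun 2) psi.
Proof.
  set (E := fun a => 0 < a).
  assert (N : forall a, E a -> a <> 0) by (unfold E; intros; lra).
  destruct (smooth_sinh_cosh E) as [Sh Ch].
  pose proof (smooth_inv E (fun a => a) N (smooth_id E)) as Iv.
  assert (M1 : smooth_on E (fun a => - 1 * (1 * (/ a * / a)))).
  { apply smooth_mult; [apply smooth_const|]. apply smooth_mult; [apply smooth_const|now apply smooth_mult]. }
  assert (SK : smooth_on E sin2_factor).
  { intros n. assert (X : smooth_upto n E (fun a => cosh a + - 1 * (sinh a * / a))).
    { apply smooth_plus; [exact Ch|]. apply smooth_mult; [apply smooth_const|now apply smooth_mult]. }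
    revert X; apply smooth_upto_ext; intros a; unfold sin2_factor; ring. }
  assert (SdK : smooth_on E dsin2_factor).
  { intros n. assert (X : smooth_upto n E (fun a => sinh a + - 1 * (cosh a * / a + sinh a * (- 1 * (1 * (/ a * / a)))))).
    { apply smooth_plus; [exact Sh|]. apply smooth_mult; [apply smooth_const|].
      apply smooth_plus; now apply smooth_mult. }
    revert X; apply smooth_upto_ext; intros a; unfold dsin2_factor; ring. }
  apply (smooth_ode _ E (fun a => / dsin2_fun a)).
  - intros y Hy; apply psi_spec, Hy.
  - apply smooth_inv; [intros a Ha; pose proof (dsin2_fun_pos a Ha); lra|].
    apply smooth_plus; now apply smooth_mult.
  - intros y Hy; now apply psi_derive.
Qed.

End Inverse.

(** * Breaking points *)

(** Through every point off the real half-lines |x| > 1 there is a circular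
    arc from -1 to 1. *)
Lemma arc_through (z : C) : ~ (Im z = 0 /\ 1 < Rabs (Re z)) ->
  exists tau t, 0 <= t <= 1 /\ z = arc tau (RtoC t).
Proof.
  intros H.
  destruct (Ceq_dec z 1) as [->|H2]; [exists 0, 1; split; [lra|symmetry; apply arc_1]|].
  destruct (Ceq_dec z (RtoC (-1))) as [->|H1]; [exists 0, 0; split; [lra|symmetry; apply arc_0]|].
  pose proof (plus_1_neq_0 z H1) as Z1. pose proof (minus_1_neq_0 z H2) as Z2.
  set (w := (- ((z - 1) / (z + 1)))%C).
  assert (E1 : (z * (1 + w) = 1 - w)%C) by (unfold w; field; exact Z1).
  assert (SW : slit w).
  { apply slit_iff; intros [HI HR]. rewrite (RtoC_Re w HI) in E1.
    set (c := Re w) in *. rewrite <- RtoC_plus, <- RtoC_minus in E1.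
    pose proof (f_equal Re E1) as X1; pose proof (f_equal Im E1) as X2.
    rewrite re_scal_r, re_RtoC in X1; rewrite im_scal_r, im_RtoC in X2.
    assert (C1 : 1 + c <> 0) by (intros Z; nra).
    assert (C0 : c <> 0).
    { intros Z; rewrite Z in E1. apply H2. transitivity (z * RtoC (1 + 0))%C; [rewrite RtoC_plus; ring|].
      rewrite E1; f_equal; lra. }
    apply H; split.
    - apply Rmult_integral in X2; tauto.
    - apply Rnot_le_lt; intros B. apply Rabs_le_between in B.
      destruct (Rlt_dec 0 (1 + c)); nra. }
  pose proof (Csqrt_Re_pos w SW) as P. pose proof (Csqrt_square w SW) as Q.
  set (p := Csqrt w) in *. set (a := Re p) in *.
  (* The slope tau is chosen so that (1, tau) is parallel to p, a root of
     - (z - 1) / (z + 1); then xi z = - rho. *)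
  set (tau := Im p / a). set (rho := a * a * (1 + tau * tau)).
  set (A := (1, - tau) : C). set (B := (1, tau) : C).
  assert (R0 : 0 <= rho) by (unfold rho; nra).
  exists tau, (/ (1 + rho)); split.
  { split; [apply Rlt_le, Rinv_0_lt_compat; lra|]. rewrite <- Rinv_1. apply Rinv_le_contravar; lra. }
  assert (N1 : (1 + RtoC rho)%C <> RtoC 0) by (rewrite <- RtoC_plus; RtoC_neq).
  assert (HB : (B * RtoC a = p)%C).
  { assert (T : tau * a = Im p) by (unfold tau; field; lra).
    rewrite (surjective_pairing p); change (fst p) with a; change (snd p) with (Im p).
    rewrite <- T; unfold B; generalize a tau; intros x y; apply injective_projections; simpl; ring. }
  assert (HA : (RtoC rho = RtoC a * RtoC a * (A * B))%C).
  { unfold rho, A, B; generalize a tau; intros x y; apply injective_projections; simpl; ring. }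
  assert (A0 : A <> RtoC 0) by apply A_neq_0.
  unfold arc, arc_num, arc_den. fold A B. rewrite RtoC_inv, RtoC_plus by lra.
  transitivity ((A - RtoC rho * B) / (A + RtoC rho * B))%C.
  - assert (F1 : (A - RtoC rho * B = A * (1 - w))%C) by (rewrite <- Q, <- HB, HA; ring).
    assert (F2 : (A + RtoC rho * B = A * (1 + w))%C) by (rewrite <- Q, <- HB, HA; ring).
    rewrite F1, F2, <- E1.
    assert (W1 : (1 + w)%C <> RtoC 0).
    { intros E. rewrite E in E1. apply two_neq_0. transitivity ((1 - w) + (1 + w))%C; [ring|].
      rewrite <- E1, E; ring. }
    field; auto.
  - assert (D0 : (A + RtoC rho * B)%C <> RtoC 0).
    { intros E. apply (f_equal Re) in E. rewrite re_plus, re_scal_l in E. simpl in E; lra. }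
    field. repeat split; try assumption; intros E; apply D0; rewrite <- E; ring.
Qed.

Lemma atanh_gt (u : R) : 0 < u < 1 -> 2 * u < ln (1 + u) - ln (1 - u).
Proof.
  intros Hu.
  assert (K : (ln (1 + 0) - ln (1 - 0)) - 2 * 0 < (ln (1 + u) - ln (1 - u)) - 2 * u).
  { apply (increasing_strict (fun x => (ln (1 + x) - ln (1 - x)) - 2 * x)
      (fun x => (/ (1 + x) + / (1 - x)) - 2)); [lra| |].
    - intros x Hx. auto_derive; [lra|]. field; lra.
    - intros x Hx. replace (/ (1 + x) + / (1 - x) - 2) with (2 * (x * x) * / ((1 + x) * (1 - x))) by (field; lra).
      assert (0 < / ((1 + x) * (1 - x))) by (apply Rinv_0_lt_compat; nra).
      apply Rmult_lt_0_compat; [nra|assumption]. }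
  rewrite Rplus_0_r, Rminus_0_r in K. lra.
Qed.

(** With u = r / z, a nonzero real number of absolute value less than 1, the
    height is ln (1 + u) - ln (1 - u) - 2 u, which has the sign of u. *)
Lemma real_saddle_height (s r : C) (x : R) : 1 < Rabs x -> (s * RtoC x = 2)%C ->
  (r * r = RtoC x * RtoC x - 1)%C -> edge_height s (RtoC x) r <> 0.
Proof.
  intros Hx Es Er.
  assert (X0 : x <> 0) by (intros ->; rewrite Rabs_R0 in Hx; lra).
  assert (X2 : 1 < x * x).
  { replace (x * x) with (Rabs x * Rabs x) by (rewrite <- Rabs_mult, Rabs_pos_eq; nra). nra. }
  assert (R0 : r = RtoC (Re r)).
  { apply RtoC_Re. rewrite <- RtoC_mult, <- RtoC_minus in Er.
    pose proof (f_equal Re Er) as E1; pose proof (f_equal Im Er) as E2.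
    replace (Re (r * r)) with (Re r * Re r - Im r * Im r) in E1 by re_im_ring.
    replace (Im (r * r)) with (2 * (Re r * Im r)) in E2 by re_im_ring.
    rewrite re_RtoC in E1; rewrite im_RtoC in E2.
    assert (Re r * Im r = 0) by lra. apply Rmult_integral in H; destruct H as [H|H]; [|exact H].
    rewrite H in E1; nra. }
  destruct (ex_intro (fun y => r = RtoC y) _ R0) as [y Hy]; clear R0; subst r.
  rewrite <- !RtoC_mult, <- RtoC_minus in Er. apply RtoC_inj in Er.
  assert (S : s = RtoC (2 / x)).
  { assert (N : RtoC x <> RtoC 0) by RtoC_neq.
    apply (Cmult_eq_l (RtoC x)); [exact N|]. rewrite Cmult_comm, Es, <- RtoC_mult. f_equal; field; exact X0. }
  set (u := y / x).
  assert (U2 : u * u < 1).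
  { unfold u. replace (y / x * (y / x)) with ((x * x - 1) / (x * x)) by (rewrite <- Er; field; exact X0).
    apply Rmult_lt_reg_r with (x * x); [lra|]. unfold Rdiv; rewrite Rmult_assoc, Rinv_l; lra. }
  assert (U0 : u <> 0).
  { unfold u; intros E. assert (y = 0) by (replace y with (y / x * x) by (field; exact X0); rewrite E; ring).
    subst y; nra. }
  assert (U1 : -1 < u < 1) by nra.
  unfold edge_height. rewrite <- RtoC_plus, Cmod_R, S, <- RtoC_mult, re_RtoC.
  assert (P : 2 * ln (Rabs (x + y)) = ln (1 + u) - ln (1 - u)).
  { assert (XY : x + y = x * (1 + u)) by (unfold u; field; exact X0).
    assert (YX : x - y = x * (1 - u)) by (unfold u; field; exact X0).
    assert (PR : (x + y) * (x - y) = 1) by nra.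
    assert (A1 : Rabs (x + y) = Rabs x * (1 + u)) by (rewrite XY, Rabs_mult, (Rabs_pos_eq (1 + u)); lra).
    assert (A2 : Rabs (x - y) = Rabs x * (1 - u)) by (rewrite YX, Rabs_mult, (Rabs_pos_eq (1 - u)); lra).
    assert (A3 : ln (Rabs (x + y)) + ln (Rabs (x - y)) = 0).
    { rewrite <- ln_mult by (rewrite ?A1, ?A2; apply Rmult_lt_0_compat; lra).
      rewrite <- Rabs_mult, PR, Rabs_R1; apply ln_1. }
    assert (A4 : ln (Rabs (x + y)) - ln (Rabs (x - y)) = ln (1 + u) - ln (1 - u)).
    { rewrite A1, A2, !ln_mult by lra. ring. }
    lra. }
  rewrite P. replace (2 / x * y) with (2 * u) by (unfold u; field; exact X0).
  destruct (Rlt_dec 0 u) as [Hu|Hu].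
  - pose proof (atanh_gt u ltac:(lra)); lra.
  - pose proof (atanh_gt (- u) ltac:(lra)) as K.
    replace (1 - - u) with (1 + u) in K by ring. replace (1 + - u) with (1 - u) in K by ring. lra.
Qed.

Lemma saddle_height_breaking (s z r : C) : (s * z = 2)%C -> (r * r = z * z - 1)%C ->
  edge_height s z r = 0 ->
  exists (G : contour 0) h, breaking_datum s 0 G h z 1.
Proof.
  intros Es Er Eh.
  destruct (arc_through z) as [tau [t [Ht Ez]]].
  { intros [HI HR]. apply (real_saddle_height s r (Re z)); [exact HR| | |];
    rewrite <- (RtoC_Re z HI); assumption. }
  exists (arc_contour tau), (h_arc tau s). now apply (h_arc_breaking_datum tau s z r t).
Qed.

Lemma breaking_point_iff (s : C) : breaking_point s <-> saddle_height_zero s.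
Proof.
  split.
  - intros [L [G [h [z0 [k H]]]]]. eapply breaking_necessary, H.
  - intros [z [r [Es [Er Eh]]]]. destruct (saddle_height_breaking s z r Es Er Eh) as [G [h H]].
    now exists 0%nat, G, h, z, 1%nat.
Qed.

Lemma critical_iff (s : C) : critical_breaking_point s <-> s = RtoC 2 \/ s = RtoC (-2).
Proof.
  split; [apply critical_necessary|].
  assert (K : forall z, z = RtoC 1 \/ z = RtoC (-1) -> (s * z = 2)%C -> critical_breaking_point s).
  { intros z Hz Es.
    assert (E : (z * z = 1)%C) by (destruct Hz as [->| ->]; rewrite <- RtoC_mult; f_equal; lra).
    destruct (saddle_height_breaking s z 0 Es) as [G [h H]].
    - rewrite E; ring.
    - now apply edge_height_branch_point.
    - exists 0%nat, G, h, z, 1%nat; split; [exact H|left; now apply edges_branch_point]. }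
  intros [-> | ->].
  - apply (K 1); [now left|rewrite <- RtoC_mult; f_equal; lra].
  - apply (K (RtoC (-1))); [now right|rewrite <- RtoC_mult; f_equal; lra].
Qed.

(** * The level set in elliptic coordinates *)

(** The square of the modulus of cosh (a + i th). *)
Definition ell_den (a th : R) : R := sinh a * sinh a + cos th * cos th.

(** cosh (a + i th); the next definition is sinh (a + i th), so that z + r =
    e^(a + i th). *)
Definition z_ell (a th : R) : C := (cosh a * cos th, sinh a * sin th).
Definition r_ell (a th : R) : C := (sinh a * cos th, cosh a * sin th).

Lemma sin2_1 (th : R) : sin th * sin th = 1 - cos th * cos th.
Proof. pose proof (sin2_cos2 th) as E; unfold Rsqr in E; lra. Qed.

Lemma cosh2_1 (a : R) : cosh a * cosh a = 1 + sinh a * sinh a.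
Proof. pose proof (cosh2_sinh2 a); lra. Qed.

Lemma ell_square (a th : R) : (r_ell a th * r_ell a th = z_ell a th * z_ell a th - 1)%C.
Proof.
  pose proof (cosh2_1 a) as C2; pose proof (sin2_1 th) as S2.
  apply injective_projections; simpl; [|ring].
  transitivity (sinh a * sinh a * (cos th * cos th) - cosh a * cosh a * (sin th * sin th)); [ring|].
  transitivity (cosh a * cosh a * (cos th * cos th) - sinh a * sinh a * (sin th * sin th) - 1); [|ring].
  rewrite C2, S2; ring.
Qed.

Lemma ell_norm (a th : R) :
  cosh a * cos th * (cosh a * cos th) + sinh a * sin th * (sinh a * sin th) = ell_den a th.
Proof.
  pose proof (cosh2_1 a) as C2; pose proof (sin2_1 th) as S2. unfold ell_den.
  transitivity (cosh a * cosh a * (cos th * cos th) + sinh a * sinh a * (sin th * sin th)); [ring|].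
  rewrite C2, S2; ring.
Qed.

Lemma ell_sum (a th : R) : (z_ell a th + r_ell a th)%C = Cexp (a, th).
Proof. unfold Cexp, z_ell, r_ell, cosh, sinh; apply injective_projections; simpl; field. Qed.

(** 2 / cosh (a + i th). *)
Definition s_ell (a th : R) : C := (2 * (cosh a * cos th) / ell_den a th, - (2 * (sinh a * sin th) / ell_den a th)).

Lemma s_ell_spec (a th : R) : ell_den a th <> 0 -> (s_ell a th * z_ell a th = 2)%C.
Proof.
  intros N; pose proof (ell_norm a th) as E.
  apply injective_projections; simpl; [|field; exact N].
  transitivity (2 * (cosh a * cos th * (cosh a * cos th) + sinh a * sin th * (sinh a * sin th)) / ell_den a th);
    [field; exact N|]. rewrite E; field; exact N.
Qed.

Lemma s_ell_unique (s : C) (a th : R) : (s * z_ell a th = 2)%C -> ell_den a th <> 0 /\ s = s_ell a th.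
Proof.
  intros E.
  assert (Z : z_ell a th <> RtoC 0).
  { intros Z; rewrite Z in E. assert (F : RtoC 0 = RtoC 2) by (rewrite <- E; ring). apply RtoC_inj in F; lra. }
  assert (N : ell_den a th <> 0).
  { intros N; apply Z. rewrite <- ell_norm in N. unfold z_ell.
    assert (X : cosh a * cos th = 0) by nra. assert (Y : sinh a * sin th = 0) by nra. now rewrite X, Y. }
  split; [exact N|]. apply (Cmult_eq_l (z_ell a th)); [exact Z|].
  rewrite Cmult_comm, E, Cmult_comm. symmetry; now apply s_ell_spec.
Qed.

Lemma ell_height (a th : R) : ell_den a th <> 0 ->
  edge_height (s_ell a th) (z_ell a th) (r_ell a th) = 2 * a - 2 * (sinh a * cosh a) / ell_den a th.
Proof.
  intros N; unfold edge_height. rewrite ell_sum, Cmod_Cexp, ln_exp.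
  change (Re (a, th)) with a. f_equal. pose proof (sin2_1 th) as S2.
  unfold s_ell, r_ell, Re; simpl.
  transitivity (2 * (sinh a * cosh a) * (cos th * cos th + sin th * sin th) / ell_den a th); [field; exact N|].
  rewrite S2; field; exact N.
Qed.

(** The left-hand equation reads a = Re tanh (a + i th). *)
Lemma height_iff_sin2_fun (a th : R) : 0 < a ->
  2 * a - 2 * (sinh a * cosh a) / ell_den a th = 0 <-> sin th * sin th = sin2_fun a.
Proof.
  intros Ha. pose proof (sinh_pos a Ha) as S. pose proof (cosh2_1 a) as C2. pose proof (sin2_1 th) as S2.
  assert (N : 0 < ell_den a th) by (unfold ell_den; nra).
  assert (GE : sin2_fun a * a = a + a * (sinh a * sinh a) - sinh a * cosh a).
  { unfold sin2_fun, sin2_factor. transitivity (a * (cosh a * cosh a) - sinh a * cosh a); [field; lra|]. rewrite C2; ring. }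
  assert (DE : a * ell_den a th = a * (sinh a * sinh a) + a - a * (sin th * sin th)).
  { unfold ell_den; rewrite S2; ring. }
  split; intros H.
  - assert (K : a * ell_den a th = sinh a * cosh a).
    { replace a with (2 * (sinh a * cosh a) / ell_den a th / 2) at 1 by lra. field; lra. }
    apply Rmult_eq_reg_r with a; lra.
  - assert (K : a * ell_den a th = sinh a * cosh a) by (rewrite H in DE; lra).
    rewrite <- K; field; lra.
Qed.

Lemma polar_form (v : C) : v <> RtoC 0 -> exists th, - PI < th <= PI /\ v = Cexp (ln (Cmod v), th).
Proof.
  intros N; pose proof (proj1 (Cmod_gt_0 v) N) as P.
  destruct (Rlt_dec 0 (Cmod v + Re v)) as [S|S].
  - exists (Im (Clog v)); split; [pose proof (Arg_range v); lra|].
    symmetry; apply (Cexp_Clog v S).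
  - exists PI; split; [pose proof PI_RGT_0; lra|].
    assert (K : Im v = 0 /\ Re v <= 0).
    { destruct (Req_dec (Im v) 0) as [E|E].
      - split; [exact E|]. apply Rnot_lt_le; intros R; apply S; pose proof (Cmod_ge_0 v); lra.
      - exfalso; apply S, (slit_Im v E). }
    destruct K as [K1 K2].
    assert (M : Cmod v = - Re v) by (rewrite (RtoC_Re v K1) at 1; rewrite Cmod_R; now apply Rabs_left1).
    unfold Cexp; simpl. rewrite exp_ln by exact P. rewrite cos_PI, sin_PI, M.
    rewrite (RtoC_Re v K1) at 1. apply injective_projections; simpl; ring.
Qed.

Lemma ell_coordinates (z r : C) : (r * r = z * z - 1)%C -> 1 <= Cmod (z + r) ->
  exists a th, 0 <= a /\ - PI < th <= PI /\ z = z_ell a th /\ r = r_ell a th.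
Proof.
  intros E M.
  assert (V : (z + r)%C <> RtoC 0) by (apply Cmod_gt_0; lra).
  destruct (polar_form _ V) as [th [Ht P]].
  set (a := ln (Cmod (z + r))) in *.
  exists a, th; split; [|split; [exact Ht|]].
  { unfold a. rewrite <- ln_1. destruct M as [M|<-]; [|lra]. apply Rlt_le, ln_increasing; lra. }
  assert (Q : (z - r)%C = Cexp (- (a, th))).
  { apply (Cmult_eq_l (z + r)); [exact V|].
    transitivity (z * z - r * r)%C; [ring|]. rewrite P, Cexp_opp, E; ring. }
  assert (X1 : (z + r)%C = (z_ell a th + r_ell a th)%C) by (rewrite ell_sum; exact P).
  assert (X2 : (z - r)%C = (z_ell a th - r_ell a th)%C).
  { rewrite Q. unfold Cexp, z_ell, r_ell, cosh, sinh; simpl. rewrite cos_neg, sin_neg.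
    apply injective_projections; simpl; field. }
  split; (apply (Cmult_eq_l (1 + 1)); [apply two_neq_0|]).
  - transitivity ((z + r) + (z - r))%C; [ring|]. rewrite X1, X2; ring.
  - transitivity ((z + r) - (z - r))%C; [ring|]. rewrite X1, X2; ring.
Qed.

Lemma height_ell (s : C) : saddle_height_zero s -> exists a th, 0 <= a /\ - PI < th <= PI /\
  ell_den a th <> 0 /\ s = s_ell a th /\ 2 * a - 2 * (sinh a * cosh a) / ell_den a th = 0.
Proof.
  assert (MAIN : forall z r, (s * z = 2)%C -> (r * r = z * z - 1)%C -> edge_height s z r = 0 ->
    1 <= Cmod (z + r) -> exists a th, 0 <= a /\ - PI < th <= PI /\
    ell_den a th <> 0 /\ s = s_ell a th /\ 2 * a - 2 * (sinh a * cosh a) / ell_den a th = 0).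
  { intros z r Es Er Eh M.
    destruct (ell_coordinates z r Er M) as [a [th [Ha [Ht [-> ->]]]]].
    destruct (s_ell_unique s a th Es) as [N ->].
    exists a, th; repeat split; try assumption; try lra. now rewrite <- ell_height. }
  intros [z [r [Es [Er Eh]]]].
  (* The other root - r has the inverse modulus |z - r| and height 0 as well. *)
  destruct (Rle_dec 1 (Cmod (z + r))) as [M|M]; [now apply (MAIN z r)|].
  apply (MAIN z (- r)%C Es).
  - rewrite <- Er; ring.
  - rewrite edge_height_opp, Eh by exact Er; ring.
  - assert (P : Cmod (z + r) * Cmod (z + - r) = 1).
    { rewrite <- Cmod_mult. replace ((z + r) * (z + - r))%C with (RtoC 1); [apply Cmod_1|].
      transitivity (z * z - r * r)%C; [rewrite Er; ring|ring]. }
    pose proof (Cmod_ge_0 (z + r)). pose proof (Cmod_ge_0 (z + - r)). nra.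
Qed.

(** * The breaking curves *)

Section Curve.
Variable psi : R -> R.
Hypothesis psi_spec : forall y, 0 < y < sin2_fun 2 -> 0 < psi y < 2 /\ sin2_fun (psi y) = y.

(** The angle decreases from pi to 0, so that the curve runs from -2 to 2. *)
Definition angle (t : R) : R := PI + - 1 * (PI * t).
Definition radius (t : R) : R := psi (sin (angle t) * sin (angle t)).
Definition b_up (t : R) : C := Cconj (s_ell (radius t) (angle t)).
Definition b_down (t : R) : C := s_ell (radius t) (angle t).

Let unit_itv (t : R) : Prop := 0 < t < 1.

Lemma angle_range (t : R) : unit_itv t -> 0 < angle t < PI.
Proof. unfold unit_itv, angle; intros Ht; pose proof PI_RGT_0; nra. Qed.

Lemma sin2_range (th : R) : 0 < th < PI -> 0 < sin th * sin th < sin2_fun 2.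
Proof.
  intros H; assert (S : 0 < sin th) by (apply sin_gt_0; lra).
  pose proof (SIN_bound th); pose proof sin2_fun_2; nra.
Qed.

Lemma radius_spec (t : R) : unit_itv t -> 0 < radius t < 2 /\ sin2_fun (radius t) = sin (angle t) * sin (angle t).
Proof. intros Ht; apply psi_spec, sin2_range, angle_range, Ht. Qed.

Lemma den_pos (a th : R) : 0 < a -> 0 < ell_den a th.
Proof. intros H; pose proof (sinh_pos a H); unfold ell_den; nra. Qed.

Lemma b_down_height (t : R) : unit_itv t -> saddle_height_zero (b_down t).
Proof.
  intros Ht; destruct (radius_spec t Ht) as [Ra Rg].
  pose proof (den_pos (radius t) (angle t) (proj1 Ra)) as N.
  exists (z_ell (radius t) (angle t)), (r_ell (radius t) (angle t)); split; [|split].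
  - apply s_ell_spec; lra.
  - apply ell_square.
  - unfold b_down; rewrite ell_height by lra. apply height_iff_sin2_fun; [apply Ra|now symmetry].
Qed.

Lemma saddle_height_conj (s : C) : saddle_height_zero s -> saddle_height_zero (Cconj s).
Proof.
  intros [z [r [E1 [E2 E3]]]]; exists (Cconj z), (Cconj r); split; [|split].
  - rewrite <- Cmult_conj, E1. unfold Cconj, RtoC; simpl; f_equal; ring.
  - rewrite <- !Cmult_conj, E2, Cminus_conj. unfold Cconj, RtoC; simpl; do 2 f_equal; ring.
  - rewrite <- E3; unfold edge_height. rewrite <- Cplus_conj, <- Cmult_conj, Cmod_conj, re_conj; reflexivity.
Qed.

Lemma b_up_height (t : R) : unit_itv t -> saddle_height_zero (b_up t).
Proof. intros Ht; now apply saddle_height_conj, b_down_height. Qed.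

Lemma b_up_Im (t : R) : unit_itv t -> 0 < Im (b_up t).
Proof.
  intros Ht; destruct (radius_spec t Ht) as [Ra _]. pose proof (angle_range t Ht) as A.
  pose proof (den_pos (radius t) (angle t) (proj1 Ra)) as N.
  unfold b_up; rewrite im_conj; unfold s_ell; simpl. rewrite Ropp_involutive.
  assert (0 < sin (angle t)) by (apply sin_gt_0; lra). pose proof (sinh_pos _ (proj1 Ra)).
  apply Rdiv_lt_0_compat; nra.
Qed.

Lemma s_ell_neg (a th : R) : s_ell a (- th) = Cconj (s_ell a th).
Proof.
  unfold s_ell, ell_den, Cconj; simpl; rewrite cos_neg, sin_neg. f_equal. unfold Rdiv; ring.
Qed.

Lemma angle_onto (th : R) : 0 < th < PI -> exists t, unit_itv t /\ angle t = th.
Proof.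
  intros H; exists (1 - th / PI); pose proof PI_RGT_0 as P; split.
  - assert (0 < th / PI) by (apply Rdiv_lt_0_compat; lra).
    assert (th / PI < 1).
    { apply Rmult_lt_reg_r with PI; [exact P|]. unfold Rdiv; rewrite Rmult_assoc, Rinv_l; lra. }
    unfold unit_itv; lra.
  - unfold angle; field; lra.
Qed.

Lemma radius_of_sin2_fun (a th : R) : 0 < a -> 0 < th < PI -> sin2_fun a = sin th * sin th -> psi (sin th * sin th) = a.
Proof.
  intros Ha Ht E. pose proof (sin2_range th Ht) as S.
  destruct (psi_spec _ S) as [P1 P2]. apply sin2_fun_inj; lra.
Qed.

(** In coordinates z + r = e^(a + i th) with a >= 0: for a = 0 the saddle is a
    point of [-1, 1] and s is real; for a > 0 the argument th determines a,
    and the two signs of th give the two conjugate curves. *)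
Lemma height_zero_iff (s : C) : saddle_height_zero s <->
  (Im s = 0 /\ Re s < -2) \/ (Im s = 0 /\ 2 < Re s) \/ on_curve b_up s \/ on_curve b_up (Cconj s) \/
  s = RtoC 2 \/ s = RtoC (-2).
Proof.
  split.
  - intros H; destruct (height_ell s H) as [a [th [Ha [Ht [N [Es Eq]]]]]].
    destruct (Rle_lt_or_eq_dec 0 a Ha) as [Ha'|<-].
    + apply (height_iff_sin2_fun a th Ha') in Eq. pose proof (sin2_fun_pos a Ha') as G0.
      assert (T0 : th <> 0) by (intros ->; rewrite sin_0 in Eq; lra).
      assert (T1 : th <> PI) by (intros ->; rewrite sin_PI in Eq; lra).
      destruct (Rlt_dec 0 th) as [Hp|Hn].
      * right; right; right; left. destruct (angle_onto th) as [t [Ut At]]; [lra|].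
        exists t; split; [exact Ut|]. unfold b_up, radius; rewrite At.
        rewrite (radius_of_sin2_fun a th Ha') by (lra || now symmetry). now rewrite Es.
      * right; right; left. destruct (angle_onto (- th)) as [t [Ut At]]; [lra|].
        exists t; split; [exact Ut|]. unfold b_up, radius; rewrite At.
        rewrite (radius_of_sin2_fun a (- th) Ha') by (lra || (rewrite sin_neg; lra)).
        rewrite <- s_ell_neg, Ropp_involutive. exact Es.
    + (* For a = 0 the saddle is cos th, so s = 2 / cos th. *)
      unfold ell_den in N; rewrite sinh_0 in N.
      assert (C0 : cos th <> 0) by (intros Z; apply N; rewrite Z; ring).
      assert (S : s = RtoC (2 / cos th)).
      { rewrite Es. unfold s_ell, ell_den. rewrite sinh_0, cosh_0.
        apply injective_projections; simpl; field; exact C0. }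
      pose proof (COS_bound th) as B.
      destruct (Rlt_dec 0 (cos th)) as [P|P].
      * destruct (Req_dec (cos th) 1) as [E1|E1].
        -- right; right; right; right; left; rewrite S, E1; f_equal; field.
        -- right; left. rewrite S; simpl; split; [reflexivity|].
           apply Rmult_lt_reg_r with (cos th); [exact P|]. unfold Rdiv; rewrite Rmult_assoc, Rinv_l; lra.
      * destruct (Req_dec (cos th) (-1)) as [E1|E1].
        -- right; right; right; right; right; rewrite S, E1; f_equal; field.
        -- left. rewrite S; simpl; split; [reflexivity|].
           replace (2 / cos th) with (- (2 / - cos th)) by (field; exact C0).
           apply Ropp_lt_cancel. rewrite !Ropp_involutive.
           apply Rmult_lt_reg_r with (- cos th); [lra|]. unfold Rdiv; rewrite Rmult_assoc, Rinv_l; lra.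
  - assert (REAL : Im s = 0 -> 2 <= Rabs (Re s) -> saddle_height_zero s).
    { intros I R. set (x := Re s) in *.
      assert (X0 : x <> 0) by (intros Z; rewrite Z, Rabs_R0 in R; lra).
      assert (B : -1 <= 2 / x <= 1).
      { apply Rabs_le_between. unfold Rdiv; rewrite Rabs_mult, Rabs_inv, (Rabs_pos_eq 2) by lra.
        apply Rmult_le_reg_r with (Rabs x); [lra|]. rewrite Rmult_assoc, Rinv_l; lra. }
      set (th := acos (2 / x)). assert (CT : cos th = 2 / x) by (apply cos_acos; exact B).
      assert (N : ell_den 0 th <> 0).
      { unfold ell_den; rewrite sinh_0, CT. intros Z.
        assert (P : 0 < 2 / x * (2 / x)).
        { apply Rsqr_pos_lt. intros W. apply X0. assert (2 = 2 / x * x) by (field; exact X0). rewrite W in H; lra. }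
        lra. }
      assert (S : s = s_ell 0 th).
      { rewrite (RtoC_Re s I). fold x. unfold s_ell, ell_den. rewrite sinh_0, cosh_0, CT.
        apply injective_projections; simpl; field; exact X0. }
      rewrite S; exists (z_ell 0 th), (r_ell 0 th); split; [now apply s_ell_spec|split; [apply ell_square|]].
      rewrite ell_height by exact N. rewrite sinh_0; unfold Rdiv; ring. }
    intros [[I R]|[[I R]|[[t [Ht ->]]|[[t [Ht E]]|[->| ->]]]]].
    + apply REAL; [exact I|rewrite Rabs_left; lra].
    + apply REAL; [exact I|rewrite Rabs_pos_eq; lra].
    + now apply b_up_height.
    + rewrite <- (Cconj_conj s), E. now apply saddle_height_conj, b_up_height.
    + apply REAL; [reflexivity|simpl; rewrite Rabs_pos_eq; lra].
    + apply REAL; [reflexivity|simpl; rewrite Rabs_left; lra].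
Qed.

(** * Smoothness *)

Lemma unit_open (t : R) : unit_itv t -> locally t unit_itv.
Proof. apply open_interval_locally. Qed.

Lemma is_derive_angle (t : R) : is_derive angle t (- PI).
Proof. unfold angle; auto_derive; [exact I|ring]. Qed.

Lemma smooth_angle : smooth_on unit_itv angle.
Proof.
  apply smooth_plus; [apply smooth_const|]. apply smooth_mult; [apply smooth_const|].
  apply smooth_mult; [apply smooth_const|apply smooth_id].
Qed.

Lemma smooth_trig_angle : smooth_on unit_itv (fun t => sin (angle t)) /\ smooth_on unit_itv (fun t => cos (angle t)).
Proof.
  destruct (smooth_sin_cos (fun _ => True)) as [S C].
  split; apply (smooth_comp unit_itv (fun _ => True)); auto; apply smooth_angle.
Qed.

Lemma smooth_radius : smooth_on unit_itv radius.
Proof.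
  destruct smooth_trig_angle as [S _].
  apply (smooth_comp unit_itv (fun y => 0 < y < sin2_fun 2) psi (fun t => sin (angle t) * sin (angle t))).
  - intros t Ht; now apply sin2_range, angle_range.
  - now apply smooth_psi.
  - now apply smooth_mult.
Qed.

Definition Xc (t : R) : R := cosh (radius t) * cos (angle t).
Definition Yc (t : R) : R := sinh (radius t) * sin (angle t).

Lemma smooth_XY : smooth_on unit_itv Xc /\ smooth_on unit_itv Yc.
Proof.
  destruct smooth_trig_angle as [S C]. destruct (smooth_sinh_cosh (fun _ => True)) as [Sh Ch].
  split; apply smooth_mult; try assumption;
  apply (smooth_comp unit_itv (fun _ => True)); auto; apply smooth_radius.
Qed.

Lemma smooth_den : smooth_on unit_itv (fun t => / ell_den (radius t) (angle t)).
Proof.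
  destruct smooth_trig_angle as [S C]. destruct (smooth_sinh_cosh (fun _ => True)) as [Sh _].
  apply smooth_inv.
  - intros t Ht. pose proof (den_pos (radius t) (angle t) (proj1 (proj1 (radius_spec t Ht)))); lra.
  - apply smooth_plus; apply smooth_mult; try assumption;
    apply (smooth_comp unit_itv (fun _ => True)); auto; apply smooth_radius.
Qed.

Lemma b_up_Re (t : R) : Re (b_up t) = 2 * (Xc t * / ell_den (radius t) (angle t)).
Proof. unfold b_up; rewrite re_conj; unfold s_ell, Xc, Rdiv; simpl; ring. Qed.

Lemma b_up_Im_eq (t : R) : Im (b_up t) = 2 * (Yc t * / ell_den (radius t) (angle t)).
Proof. unfold b_up; rewrite im_conj; unfold s_ell, Yc, Rdiv; simpl; ring. Qed.

Lemma smooth_b_up : smooth_on unit_itv (fun t => Re (b_up t)) /\ smooth_on unit_itv (fun t => Im (b_up t)).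
Proof.
  destruct smooth_XY as [SX SY]. split; intros n.
  - apply (smooth_upto_ext unit_itv n (fun t => 2 * (Xc t * / ell_den (radius t) (angle t)))); [intros t; symmetry; apply b_up_Re|].
    apply smooth_mult; [apply smooth_const|]. apply smooth_mult; [exact SX|apply smooth_den].
  - apply (smooth_upto_ext unit_itv n (fun t => 2 * (Yc t * / ell_den (radius t) (angle t)))); [intros t; symmetry; apply b_up_Im_eq|].
    apply smooth_mult; [apply smooth_const|]. apply smooth_mult; [exact SY|apply smooth_den].
Qed.

(** The saddle is recovered from s by 2 / s, in real coordinates. *)
Lemma XY_of_b_up (t : R) : unit_itv t ->
  let P := Re (b_up t) in let Q := Im (b_up t) in
  0 < P * P + Q * Q /\ Xc t = 2 * (P * / (P * P + Q * Q)) /\ Yc t = 2 * (Q * / (P * P + Q * Q)).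
Proof.
  intros Ht P Q. pose proof (den_pos (radius t) (angle t) (proj1 (proj1 (radius_spec t Ht)))) as N.
  pose proof (ell_norm (radius t) (angle t)) as E. fold (Xc t) (Yc t) in E.
  assert (PE : P = 2 * (Xc t * / ell_den (radius t) (angle t))) by apply b_up_Re.
  assert (QE : Q = 2 * (Yc t * / ell_den (radius t) (angle t))) by apply b_up_Im_eq.
  set (d := ell_den (radius t) (angle t)) in *.
  assert (S : P * P + Q * Q = 4 * / d).
  { rewrite PE, QE. transitivity (4 * (Xc t * Xc t + Yc t * Yc t) * (/ d * / d)); [ring|].
    rewrite E; field; lra. }
  assert (0 < / d) by now apply Rinv_0_lt_compat.
  rewrite S. split; [lra|]. rewrite PE, QE. split; field; lra.
Qed.

(** The saddle 2 / s is a rational function of the curve and of its conjugate,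
    so a critical parameter of the curve would be critical for cosh (radius +
    i angle), although the angle moves at constant speed. *)
Lemma b_up_regular (t : R) : unit_itv t ->
  Derive (fun u => Re (b_up u)) t <> 0 \/ Derive (fun u => Im (b_up u)) t <> 0.
Proof.
  intros Ht.
  destruct (Req_dec (Derive (fun u => Re (b_up u)) t) 0) as [D1|D1]; [|now left].
  destruct (Req_dec (Derive (fun u => Im (b_up u)) t) 0) as [D2|D2]; [exfalso|now right].
  destruct smooth_b_up as [SR SI].
  destruct (SR 1%nat) as [p' [HP _]]. destruct (SI 1%nat) as [q' [HQ _]].
  specialize (HP t Ht). specialize (HQ t Ht).
  rewrite (is_derive_unique _ _ _ HP) in D1. rewrite (is_derive_unique _ _ _ HQ) in D2.
  rewrite D1 in HP; rewrite D2 in HQ.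
  destruct (XY_of_b_up t Ht) as [N _].
  set (P := fun u => Re (b_up u)) in *. set (Q := fun u => Im (b_up u)) in *.
  assert (DN : is_derive (fun u => / (P u * P u + Q u * Q u)) t 0).
  { replace 0 with (- 1 * (((0 * P t + P t * 0) + (0 * Q t + Q t * 0)) *
      (/ (P t * P t + Q t * Q t) * / (P t * P t + Q t * Q t)))) by ring.
    apply (is_derive_inv_R (fun u => P u * P u + Q u * Q u)); [unfold P, Q; lra|].
    apply (is_derive_plus (V := R_NormedModule)); apply is_derive_mult_R; assumption. }
  assert (DX : is_derive Xc t 0).
  { apply (is_derive_ext_loc (fun u => 2 * (P u * / (P u * P u + Q u * Q u)))).
    - generalize (unit_open t Ht); apply filter_imp; intros u Hu; symmetry; now apply (XY_of_b_up u Hu).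
    - replace 0 with (2 * (0 * / (P t * P t + Q t * Q t) + P t * 0)) by ring.
      apply (is_derive_scal (fun u => P u * / (P u * P u + Q u * Q u))).
      apply (is_derive_mult_R P (fun u => / (P u * P u + Q u * Q u))); assumption. }
  assert (DY : is_derive Yc t 0).
  { apply (is_derive_ext_loc (fun u => 2 * (Q u * / (P u * P u + Q u * Q u)))).
    - generalize (unit_open t Ht); apply filter_imp; intros u Hu; symmetry; now apply (XY_of_b_up u Hu).
    - replace 0 with (2 * (0 * / (P t * P t + Q t * Q t) + Q t * 0)) by ring.
      apply (is_derive_scal (fun u => Q u * / (P u * P u + Q u * Q u))).
      apply (is_derive_mult_R Q (fun u => / (P u * P u + Q u * Q u))); assumption. }
  destruct (smooth_radius 1%nat) as [a' [HA _]]. specialize (HA t Ht).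
  destruct (radius_spec t Ht) as [Ra _]. pose proof (angle_range t Ht) as At.
  assert (EX : is_derive Xc t ((a' t * sinh (radius t)) * cos (angle t) + cosh (radius t) * (- PI * - sin (angle t)))).
  { apply (is_derive_mult_R (fun t => cosh (radius t)) (fun t => cos (angle t))).
    - apply (is_derive_comp cosh radius); [apply is_derive_cosh|exact HA].
    - apply (is_derive_comp cos angle); [apply is_derive_cos|apply is_derive_angle]. }
  assert (EY : is_derive Yc t ((a' t * cosh (radius t)) * sin (angle t) + sinh (radius t) * (- PI * cos (angle t)))).
  { apply (is_derive_mult_R (fun t => sinh (radius t)) (fun t => sin (angle t))).
    - apply (is_derive_comp sinh radius); [apply is_derive_sinh|exact HA].
    - apply (is_derive_comp sin angle); [apply is_derive_sin|apply is_derive_angle]. }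
  pose proof (is_derive_unique _ _ _ EX) as UX. rewrite (is_derive_unique _ _ _ DX) in UX.
  pose proof (is_derive_unique _ _ _ EY) as UY. rewrite (is_derive_unique _ _ _ DY) in UY.
  pose proof (sinh_pos _ (proj1 Ra)) as Sp. pose proof (cosh_pos (radius t)) as Cp.
  assert (Sn : 0 < sin (angle t)) by (apply sin_gt_0; lra). pose proof PI_RGT_0 as Pp.
  set (Sh := sinh (radius t)) in *. set (Ch := cosh (radius t)) in *.
  set (sn := sin (angle t)) in *. set (cs := cos (angle t)) in *. set (da := a' t) in *.
  assert (K : da * (Sh * cs * (Sh * cs) + Ch * sn * (Ch * sn)) = 0).
  { transitivity (Sh * cs * ((da * Sh) * cs + Ch * (- PI * - sn)) + Ch * sn * ((da * Ch) * sn + Sh * (- PI * cs)));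
      [ring|]. rewrite <- UX, <- UY; ring. }
  assert (Z : da = 0).
  { apply Rmult_integral in K; destruct K as [K|K]; [exact K|].
    assert (0 < Ch * sn) by (now apply Rmult_lt_0_compat). nra. }
  rewrite Z in UX.
  assert (0 < Ch * (PI * sn)) by (apply Rmult_lt_0_compat; [exact Cp|now apply Rmult_lt_0_compat]). lra.
Qed.

(** The curves of constant a are the upper halves of confocal ellipses; they
    are disjoint. *)
Lemma ell_injective (a1 t1 a2 t2 : R) : 0 < a1 -> 0 < a2 -> 0 < t1 < PI -> 0 < t2 < PI ->
  cosh a1 * cos t1 = cosh a2 * cos t2 -> sinh a1 * sin t1 = sinh a2 * sin t2 -> t1 = t2.
Proof.
  assert (LT : forall a1 t1 a2 t2, 0 < a1 -> a1 < a2 -> 0 < t1 < PI -> 0 < t2 < PI ->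
    cosh a1 * cos t1 = cosh a2 * cos t2 -> sinh a1 * sin t1 = sinh a2 * sin t2 -> False).
  { intros b1 u1 b2 u2 H1 H12 U1 U2 E1 E2.
    pose proof (cosh_increasing b1 b2 ltac:(lra) H12) as Ci'. pose proof (sinh_increasing b1 b2 H12) as Si.
    pose proof (sinh_pos b1 H1) as S1. pose proof (cosh_pos b1) as C1.
    assert (N1 : 0 < sin u1) by (apply sin_gt_0; lra). assert (N2 : 0 < sin u2) by (apply sin_gt_0; lra).
    pose proof (sin2_1 u1) as P1; pose proof (sin2_1 u2) as P2.
    assert (L1 : sin u2 < sin u1).
    { apply Rmult_lt_reg_l with (sinh b1); [exact S1|]. rewrite E2. apply Rmult_lt_compat_r; lra. }
    assert (L2 : Rabs (cos u2) <= Rabs (cos u1)).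
    { apply Rmult_le_reg_l with (cosh b2); [lra|].
      replace (cosh b2 * Rabs (cos u2)) with (cosh b1 * Rabs (cos u1)).
      - apply Rmult_le_compat_r; [apply Rabs_pos|lra].
      - rewrite <- (Rabs_pos_eq (cosh b1)), <- (Rabs_pos_eq (cosh b2)), <- !Rabs_mult, E1 by lra. reflexivity. }
    assert (L3 : cos u2 * cos u2 <= cos u1 * cos u1).
    { change (Rsqr (cos u2) <= Rsqr (cos u1)). rewrite (Rsqr_abs (cos u2)), (Rsqr_abs (cos u1)).
      apply Rsqr_incr_1; [exact L2|apply Rabs_pos|apply Rabs_pos]. }
    nra. }
  intros H1 H2 U1 U2 E1 E2.
  destruct (Rtotal_order a1 a2) as [H|[<-|H]].
  - exfalso; apply (LT a1 t1 a2 t2); assumption.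
  - pose proof (cosh_pos a1). apply Rmult_eq_reg_l in E1; [|lra].
    rewrite <- (acos_cos t1), <- (acos_cos t2) by lra. now rewrite E1.
  - exfalso; apply (LT a2 t2 a1 t1); auto.
Qed.

Lemma b_up_injective (t u : R) : unit_itv t -> unit_itv u -> b_up t = b_up u -> t = u.
Proof.
  intros Ht Hu E.
  destruct (XY_of_b_up t Ht) as [_ [X1 Y1]]. destruct (XY_of_b_up u Hu) as [_ [X2 Y2]].
  rewrite E in X1, Y1. rewrite <- X2 in X1. rewrite <- Y2 in Y1.
  destruct (radius_spec t Ht) as [R1 _]. destruct (radius_spec u Hu) as [R2 _].
  pose proof (ell_injective (radius t) (angle t) (radius u) (angle u) (proj1 R1) (proj1 R2)
    (angle_range t Ht) (angle_range u Hu) X1 Y1) as A.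
  unfold angle in A. pose proof PI_RGT_0. apply Rmult_eq_reg_l with PI; lra.
Qed.

Lemma smooth_curve_intro (b : R -> C) :
  smooth_on unit_itv (fun u => Re (b u)) -> smooth_on unit_itv (fun u => Im (b u)) ->
  (forall t, unit_itv t -> Derive (fun u => Re (b u)) t <> 0 \/ Derive (fun u => Im (b u)) t <> 0) ->
  (forall t u, unit_itv t -> unit_itv u -> b t = b u -> t = u) -> smooth_curve b.
Proof.
  intros SR SI D J; split; [|split; [exact D|exact J]].
  intros n t Ht; split; apply (smooth_ex_derive_n unit_itv); auto; exact unit_open.
Qed.

Lemma b_up_smooth : smooth_curve b_up.
Proof.
  destruct smooth_b_up as [SR SI]. apply smooth_curve_intro; [exact SR|exact SI|exact b_up_regular|exact b_up_injective].
Qed.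

Lemma b_down_smooth : smooth_curve b_down.
Proof.
  destruct smooth_b_up as [SR SI].
  assert (ER : forall t, Re (b_up t) = Re (b_down t)) by (intros t; apply re_conj).
  assert (EI : forall t, - 1 * Im (b_up t) = Im (b_down t)).
  { intros t; unfold b_up; rewrite im_conj; unfold b_down; ring. }
  apply smooth_curve_intro.
  - intros n; apply (smooth_upto_ext unit_itv n _ _ ER), SR.
  - intros n; apply (smooth_upto_ext unit_itv n _ _ EI). apply smooth_mult; [apply smooth_const|exact SI].
  - intros t Ht; destruct (b_up_regular t Ht) as [H|H].
    + left. now rewrite <- (Derive_ext _ _ t ER).
    + right. rewrite <- (Derive_ext _ _ t EI), Derive_scal. lra.
  - intros t u Ht Hu E. apply b_up_injective; try assumption. unfold b_up, b_down in *; now rewrite E.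
Qed.

(** * End points *)

Lemma radius_small (eps : R) : 0 < eps -> exists d, 0 < d /\
  forall t, unit_itv t -> sin (angle t) * sin (angle t) < d -> radius t < eps.
Proof.
  intros He. set (e := Rmin eps 1).
  assert (E0 : 0 < e) by (apply Rmin_pos; lra). assert (E1 : e <= eps) by apply Rmin_l.
  exists (sin2_fun e); split; [now apply sin2_fun_pos|]; intros t Ht Hs.
  destruct (radius_spec t Ht) as [Ra Rg]. apply Rlt_le_trans with e; [|exact E1].
  apply Rnot_le_lt; intros [K|K].
  - pose proof (sin2_fun_increasing _ _ E0 K); lra.
  - rewrite K in Hs; lra.
Qed.

(** As the sine of the angle tends to 0 so does the radius, and the saddle
    tends to cos th0, which is 1 or -1. *)
Lemma b_up_limit (F : (R -> Prop) -> Prop) {FF : Filter F} (th0 : R) :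
  sin th0 = 0 -> cos th0 <> 0 -> F unit_itv -> filterlim angle F (locally th0) ->
  filterlim b_up F (@locally C_UniformSpace (RtoC (2 / cos th0))).
Proof.
  intros S0 C0 FU FA.
  assert (Ls : filterlim (fun t => sin (angle t)) F (locally 0)).
  { rewrite <- S0. apply (filterlim_comp _ _ _ angle sin F (locally th0)); [exact FA|].
    apply (ex_derive_continuous sin); exists (cos th0); apply is_derive_sin. }
  assert (Lc : filterlim (fun t => cos (angle t)) F (locally (cos th0))).
  { apply (filterlim_comp _ _ _ angle cos F (locally th0)); [exact FA|].
    apply (ex_derive_continuous cos); exists (- sin th0); apply is_derive_cos. }
  assert (Ls2 : filterlim (fun t => sin (angle t) * sin (angle t)) F (locally 0)).
  { replace 0 with (0 * 0) by ring.
    apply (filterlim_comp_2 (G := locally 0) (H := locally 0)); [exact Ls|exact Ls|].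
    apply (filterlim_mult 0 0). }
  assert (La : filterlim radius F (locally 0)).
  { intros P [e HP]. destruct (radius_small e (cond_pos e)) as [d [Hd K]].
    assert (X : F (fun t => sin (angle t) * sin (angle t) < d)).
    { apply (Ls2 (fun y => y < d)), (open_lt d), Hd. }
    change (F (fun t => P (radius t))).
    generalize (filter_and _ _ FU X); apply filter_imp; intros t [Ht Hs].
    destruct (radius_spec t Ht) as [Ra _]. specialize (K t Ht Hs).
    apply HP. change (Rabs (radius t - 0) < e). rewrite Rminus_0_r, Rabs_pos_eq; lra. }
  assert (Lsh : filterlim (fun t => sinh (radius t)) F (locally 0)).
  { rewrite <- sinh_0. apply (filterlim_comp _ _ _ radius sinh F (locally 0)); [exact La|].
    apply (ex_derive_continuous sinh); exists (cosh 0); apply is_derive_sinh. }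
  assert (Lch : filterlim (fun t => cosh (radius t)) F (locally 1)).
  { rewrite <- cosh_0. apply (filterlim_comp _ _ _ radius cosh F (locally 0)); [exact La|].
    apply (ex_derive_continuous cosh); exists (sinh 0); apply is_derive_cosh. }
  assert (LZ : Clim F (fun t => z_ell (radius t) (angle t)) (RtoC (cos th0))).
  { replace (RtoC (cos th0)) with ((1 * cos th0, 0 * 0) : C) by (unfold RtoC; f_equal; ring).
    apply Clim_pair.
    - apply (filterlim_comp_2 (G := locally 1) (H := locally (cos th0))); [exact Lch|exact Lc|].
      apply (filterlim_mult 1 (cos th0)).
    - apply (filterlim_comp_2 (G := locally 0) (H := locally 0)); [exact Lsh|exact Ls|].
      apply (filterlim_mult 0 0). }
  assert (N : RtoC (cos th0) <> RtoC 0) by RtoC_neq.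
  pose proof (Clim_inv _ _ N LZ) as LI.
  assert (LC : Clim F (fun t => Cconj (RtoC 2 * / z_ell (radius t) (angle t)))%C (RtoC (2 / cos th0))).
  { intros eps He. pose proof (Clim_mult _ _ _ _ (Clim_const (RtoC 2)) LI eps He) as H.
    revert H; apply filter_imp; intros t H.
    replace (RtoC (2 / cos th0)) with (Cconj (RtoC 2 * / RtoC (cos th0))).
    - rewrite <- Cminus_conj, Cmod_conj. exact H.
    - rewrite <- RtoC_inv, <- RtoC_mult by exact C0. unfold Cconj, RtoC; simpl; f_equal; ring. }
  apply Clim_filterlim; [exact FF|].
  revert LC; apply Clim_ext_loc. generalize FU; apply filter_imp; intros t Ht.
  unfold b_up. f_equal.
  pose proof (den_pos (radius t) (angle t) (proj1 (proj1 (radius_spec t Ht)))) as D.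
  pose proof (s_ell_spec (radius t) (angle t) ltac:(lra)) as E.
  assert (NZ : z_ell (radius t) (angle t) <> RtoC 0).
  { intros Z; rewrite Z in E. assert (W : RtoC 0 = RtoC 2) by (rewrite <- E; ring). apply RtoC_inj in W; lra. }
  rewrite <- E. field; exact NZ.
Qed.

Lemma angle_cont (t : R) : filterlim angle (locally t) (locally (angle t)).
Proof. apply (ex_derive_continuous angle); exists (- PI); apply is_derive_angle. Qed.

Lemma b_up_starts : starts_at b_up (RtoC (-2)).
Proof.
  unfold starts_at. replace (-2) with (2 / cos PI) by (rewrite cos_PI; field).
  apply (b_up_limit (at_right 0)); [apply sin_PI|rewrite cos_PI; lra| |].
  - exists (mkposreal 1 Rlt_0_1); intros t Ht Hp. change (Rabs (t - 0) < 1) in Ht.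
    rewrite Rminus_0_r, Rabs_pos_eq in Ht by lra. unfold unit_itv; lra.
  - replace PI with (angle 0) by (unfold angle; ring).
    intros P HP. apply filter_le_within, angle_cont, HP.
Qed.

Lemma b_up_ends : ends_at b_up (RtoC 2).
Proof.
  unfold ends_at. replace 2 with (2 / cos 0) by (rewrite cos_0; field).
  apply (b_up_limit (at_left 1)); [apply sin_0|rewrite cos_0; lra| |].
  - exists (mkposreal 1 Rlt_0_1); intros t Ht Hp. change (Rabs (t - 1) < 1) in Ht.
    apply Rabs_def2 in Ht. unfold unit_itv; lra.
  - replace 0 with (angle 1) by (unfold angle; ring).
    intros P HP. apply filter_le_within, angle_cont, HP.
Qed.

End Curve.

(** * The level set is closed *)

Lemma ln_27 : 3 <= ln 27.
Proof.
  rewrite <- (ln_exp 3). assert (H : exp 3 <= 27).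
  { replace 3 with (1 + 1 + 1) by ring. rewrite !exp_plus. pose proof exp_le_3. pose proof (exp_pos 1). nra. }
  destruct H as [H|H]; [|now rewrite H]. apply Rlt_le, ln_increasing; [apply exp_pos|exact H].
Qed.

(** Near s = 0 the saddle 2/s escapes to infinity, where the logarithm in the
    height dominates the bounded term Re (s r). *)
Lemma height_nonzero_near_0 (s : C) : saddle_height_zero s -> / 100 <= Cmod s.
Proof.
  intros H. destruct (height_ell s H) as [a [th [Ha [Ht [N [Es Eq]]]]]].
  assert (Ez : (s * z_ell a th = 2)%C) by (rewrite Es; now apply s_ell_spec).
  apply Rnot_lt_le; intros Hs.
  pose proof (ell_height a th N) as EH. rewrite Eq, <- Es in EH.
  unfold edge_height in EH. set (z := z_ell a th) in *. set (r := r_ell a th) in *.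
  assert (V : Cmod (z + r) = exp a) by (unfold z, r; rewrite ell_sum; apply Cmod_Cexp).
  assert (SR : (z * z - r * r = 1)%C).
  { unfold r; rewrite ell_square. fold z; ring. }
  assert (W : Cmod (z - r) * exp a = 1).
  { rewrite <- V, <- Cmod_mult. replace ((z - r) * (z + r))%C with (RtoC 1); [apply Cmod_1|].
    rewrite <- SR; ring. }
  assert (EA : 1 <= exp a).
  { rewrite <- exp_0. destruct Ha as [Ha|<-]; [apply Rlt_le, exp_increasing, Ha|lra]. }
  assert (W1 : Cmod (z - r) <= 1) by (pose proof (Cmod_ge_0 (z - r)); nra).
  assert (SZ : Cmod s * Cmod z = 2) by (rewrite <- Cmod_mult, Ez, Cmod_R, Rabs_pos_eq; lra).
  assert (Z1 : 27 < Cmod z).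
  { pose proof (Cmod_ge_0 s). pose proof (Cmod_ge_0 z). nra. }
  assert (ZV : Cmod z <= Cmod (z + r)).
  { pose proof (Cmod_triangle (z + r) (z - r)) as T.
    replace (z + r + (z - r))%C with (RtoC 2 * z)%C in T by (rewrite RtoC_2; ring).
    rewrite Cmod_mult, Cmod_R, Rabs_pos_eq in T by lra. lra. }
  (* Height 0 now reads 6 <= 2 ln |z + r| = Re (s r) <= 2 + |s|. *)
  assert (L : 3 <= ln (Cmod (z + r))).
  { eapply Rle_trans; [apply ln_27|]. apply Rlt_le, ln_increasing; lra. }
  assert (B : Re (s * r) <= 2 + Cmod s).
  { replace (s * r)%C with (s * z - s * (z - r))%C by ring. rewrite Ez.
    eapply Rle_trans; [apply Rle_abs|]. eapply Rle_trans; [apply re_le_Cmod|].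
    unfold Cminus at 1. eapply Rle_trans; [apply Cmod_triangle|].
    rewrite Cmod_opp, Cmod_mult, Cmod_R, Rabs_pos_eq by lra.
    pose proof (Cmod_ge_0 s). nra. }
  lra.
Qed.

(** Away from s = 0 the equation says that a continuous function of s
    vanishes. *)
Lemma saddle_height_closed (s : C) :
  (forall eps, 0 < eps -> exists s', Cmod (s' - s) < eps /\ saddle_height_zero s') -> saddle_height_zero s.
Proof.
  intros H.
  assert (S0 : s <> RtoC 0).
  { intros ->. destruct (H (/ 100)) as [s' [H1 H2]]; [lra|].
    replace (s' - 0)%C with s' in H1 by ring. pose proof (height_nonzero_near_0 s' H2); lra. }
  set (z := (2 / s)%C). destruct (Csqrt_exists (z * z - 1)) as [r Er].
  exists z, r; split; [unfold z; field; exact S0|split; [exact Er|]].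
  destruct (Req_dec (edge_height s z r) 0) as [|N]; [assumption|exfalso].
  assert (P : 0 < Rabs (edge_height s z r)) by now apply Rabs_pos_lt.
  destruct (edge_height_continuous s z r _ Er P) as [d [Hd K]].
  assert (CI : Clim (near_C s) (fun w => 2 / w)%C (2 / s)%C).
  { apply Clim_div; [exact S0|apply Clim_const|apply Ccont_id]. }
  destruct (CI d Hd) as [d2 [Hd2 K2]].
  destruct (H (Rmin d d2)) as [s' [[B1 B2]%Rmin_lt [z' [r' [E1 [E2 E3]]]]]]; [now apply Rmin_pos|].
  assert (S0' : s' <> RtoC 0).
  { intros ->; assert (Z : RtoC 0 = RtoC 2) by (rewrite <- E1; ring). apply RtoC_inj in Z; lra. }
  assert (Z' : z' = (2 / s')%C) by (rewrite <- E1; field; exact S0').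
  specialize (K2 s' B2). rewrite <- Z' in K2.
  specialize (K s' z' r' B1 K2 E2). rewrite E3, Rabs_R0 in K.
  rewrite Rminus_0_l, Rabs_Ropp, Rabs_Rabsolu in K. lra.
Qed.

Lemma limit_on_curve (F : (R -> Prop) -> Prop) {FF : ProperFilter F} (b : R -> C) (s : C) :
  (forall s', on_curve b s' -> saddle_height_zero s') -> F (fun t => 0 < t < 1) ->
  filterlim b F (@locally C_UniformSpace s) -> saddle_height_zero s.
Proof.
  intros HB FU HL. apply saddle_height_closed; intros eps He.
  apply Clim_filterlim in HL; [|apply FF].
  destruct (filter_ex (F := F) _ (filter_and _ _ FU (HL eps He))) as [t [Ht Hc]].
  exists (b t); split; [exact Hc|]. apply HB; exists t; auto.
Qed.

Lemma breaking_set_height (s : C) : breaking_set s -> saddle_height_zero s.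
Proof.
  intros [b [[_ [HB _]] H]].
  assert (HB' : forall s', on_curve b s' -> saddle_height_zero s')
    by (intros s' Hs; now apply breaking_point_iff, HB).
  destruct H as [H|[H|H]].
  - now apply HB'.
  - apply (limit_on_curve (at_right 0) b s HB'); [|exact H].
    exists (mkposreal 1 Rlt_0_1); intros t Ht Hp. change (Rabs (t - 0) < 1) in Ht.
    rewrite Rminus_0_r, Rabs_pos_eq in Ht; lra.
  - apply (limit_on_curve (at_left 1) b s HB'); [|exact H].
    exists (mkposreal 1 Rlt_0_1); intros t Ht Hp. change (Rabs (t - 1) < 1) in Ht.
    apply Rabs_def2 in Ht; lra.
Qed.

Lemma breaking_curve_intro (b : R -> C) : smooth_curve b ->
  (forall t, 0 < t < 1 -> saddle_height_zero (b t)) ->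
  (forall t, 0 < t < 1 -> b t <> RtoC 2 /\ b t <> RtoC (-2)) -> breaking_curve b.
Proof.
  intros HS HB HN; split; [exact HS|split].
  - intros s [t [Ht ->]]; now apply breaking_point_iff, HB.
  - exists (b (1 / 2)); split; [exists (1 / 2); split; [lra|reflexivity]|].
    split; [apply breaking_point_iff, HB; lra|].
    intros C; apply critical_iff in C. destruct (HN (1 / 2)) as [N1 N2]; [lra|]. tauto.
Qed.

Lemma inverse_curve_smooth (c : R) : c <> 0 -> smooth_curve (fun t => RtoC (c * / t)).
Proof.
  intros Hc. apply smooth_curve_intro.
  - apply smooth_mult; [apply smooth_const|]. apply smooth_inv; [intros t Ht; lra|apply smooth_id].
  - apply (smooth_const _ 0).
  - intros t Ht; left. change (Derive (fun u => c * / u) t <> 0).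
    rewrite (is_derive_unique _ _ (c * (- 1 * (1 * (/ t * / t))))).
    + assert (T : 0 < / t * / t) by (assert (0 < / t) by (apply Rinv_0_lt_compat; lra); nra).
      intros E. apply Hc. apply Rmult_integral in E; destruct E as [E|E]; [exact E|lra].
    + apply (is_derive_scal (fun u => / u)). apply (is_derive_inv_R (fun u => u)); [lra|apply @is_derive_id].
  - intros t u Ht Hu E; apply RtoC_inj in E. apply Rmult_eq_reg_l in E; [|exact Hc].
    rewrite <- (Rinv_inv t), E; apply Rinv_inv.
Qed.

Lemma on_right_half_line (s : C) : on_curve (fun t => RtoC (2 * / t)) s <-> Im s = 0 /\ 2 < Re s.
Proof.
  split.
  - intros [t [Ht ->]]; simpl; split; [reflexivity|].
    apply Rmult_lt_reg_r with t; [lra|]. rewrite Rmult_assoc, Rinv_l; lra.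
  - intros [I R]; exists (2 * / Re s); split; [split|].
    + apply Rmult_lt_0_compat; [lra|apply Rinv_0_lt_compat; lra].
    + apply Rmult_lt_reg_r with (Re s); [lra|]. rewrite Rmult_assoc, Rinv_l; lra.
    + rewrite (RtoC_Re s I) at 1; f_equal; field; lra.
Qed.

Lemma on_left_half_line (s : C) : on_curve (fun t => RtoC (- (2) * / t)) s <-> Im s = 0 /\ Re s < -2.
Proof.
  split.
  - intros [t [Ht ->]]; simpl; split; [reflexivity|].
    apply Rmult_lt_reg_r with t; [lra|]. rewrite Rmult_assoc, Rinv_l; lra.
  - intros [I R]; exists (- (2) * / Re s).
    assert (N : / Re s < 0) by (apply Rinv_lt_0_compat; lra).
    assert (E : / Re s * Re s = 1) by (apply Rinv_l; lra).
    split; [split|].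
    + lra.
    + nra.
    + rewrite (RtoC_Re s I) at 1; f_equal; field; lra.
Qed.

Theorem theorem2p1 :
  (forall s : C, critical_breaking_point s <-> s = RtoC 2 \/ s = RtoC (-2)) /\
  exists b_minf b_inf b_plus b_minus : R -> C,
    (breaking_curve b_minf /\
      forall s : C, on_curve b_minf s <-> Im s = 0 /\ Re s < -2) /\
    (breaking_curve b_inf /\
      forall s : C, on_curve b_inf s <-> Im s = 0 /\ 2 < Re s) /\
    (breaking_curve b_plus /\ starts_at b_plus (RtoC (-2)) /\
      ends_at b_plus (RtoC 2) /\
      forall s : C, on_curve b_plus s -> 0 < Im s) /\
    (breaking_curve b_minus /\
      forall s : C, on_curve b_minus s <-> on_curve b_plus (Cconj s)) /\
    (forall s : C, breaking_set s <->
      on_curve b_minf s \/ on_curve b_inf s \/ on_curve b_plus s \/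
      on_curve b_minus s \/ s = RtoC 2 \/ s = RtoC (-2)).
Proof.
  split; [exact critical_iff|].
  destruct sin2_fun_inverse as [psi Hpsi].
  pose proof (height_zero_iff psi Hpsi) as HZ.
  assert (REFL : forall s, on_curve (b_down psi) s <-> on_curve (b_up psi) (Cconj s)).
  { intros s; split; intros [t [Ht E]]; exists t; split; try assumption.
    - now rewrite E.
    - unfold b_up in E. rewrite <- (Cconj_conj s), E. apply Cconj_conj. }
  assert (BL : breaking_curve (fun t => RtoC (- (2) * / t))).
  { apply breaking_curve_intro; [apply inverse_curve_smooth; lra| |].
    - intros t Ht; apply HZ; left; apply on_left_half_line; now exists t.
    - intros t Ht. destruct (proj1 (on_left_half_line (RtoC (- (2) * / t)))) as [_ K]; [now exists t|].
      split; intros E; rewrite E in K; simpl in K; lra. }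
  assert (BR : breaking_curve (fun t => RtoC (2 * / t))).
  { apply breaking_curve_intro; [apply inverse_curve_smooth; lra| |].
    - intros t Ht; apply HZ; right; left; apply on_right_half_line; now exists t.
    - intros t Ht. destruct (proj1 (on_right_half_line (RtoC (2 * / t)))) as [_ K]; [now exists t|].
      split; intros E; rewrite E in K; simpl in K; lra. }
  assert (BU : breaking_curve (b_up psi)).
  { apply breaking_curve_intro; [now apply b_up_smooth|now apply b_up_height|].
    intros t Ht; pose proof (b_up_Im psi Hpsi t Ht) as K.
    split; intros E; rewrite E in K; simpl in K; lra. }
  assert (BD : breaking_curve (b_down psi)).
  { apply breaking_curve_intro; [now apply b_down_smooth|now apply b_down_height|].
    intros t Ht; pose proof (b_up_Im psi Hpsi t Ht) as K. unfold b_up in K; rewrite im_conj in K.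
    split; intros E; unfold b_down in E; rewrite E in K; simpl in K; lra. }
  exists (fun t => RtoC (- (2) * / t)), (fun t => RtoC (2 * / t)), (b_up psi), (b_down psi).
  split; [split; [exact BL|exact on_left_half_line]|].
  split; [split; [exact BR|exact on_right_half_line]|].
  split; [split; [exact BU|split; [now apply b_up_starts|split; [now apply b_up_ends|]]]|].
  { intros s [t [Ht ->]]; now apply b_up_Im. }
  split; [split; [exact BD|exact REFL]|].
  intros s; split.
  - intros H; apply breaking_set_height, HZ in H.
    rewrite on_left_half_line, on_right_half_line, REFL. exact H.
  - assert (ON : forall b, breaking_curve b -> on_curve b s -> breaking_set s)
      by (intros b Hb Hs; exists b; auto).
    intros [H|[H|[H|[H|[H|H]]]]]; [exact (ON _ BL H)|exact (ON _ BR H)|exact (ON _ BU H)|exact (ON _ BD H)| |];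
      rewrite H; exists (b_up psi); split; try exact BU; right.
    + right; now apply b_up_ends.
    + left; now apply b_up_starts.
Qed.
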